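(* Fix $\lambda>0$ and set $\rho_1:=\frac{3\pi}{4}$, $\rho_2:=\frac{7\pi}{4}$. There exist $\delta>0$ and $N_0\in\mathbb{N}$ with the following property. For each turning window $$I_{n,j}:=[2\pi n+\rho_j-\delta,\ 2\pi n+\rho_j+\delta],\qquad n\ge N_0,\quad j\in\{1,2\},$$ there is a minimiser $(\ell_{n,j},\theta_{n,j})$ of $J^{(2)}_\lambda$ over the window class $\mathcal{A}^{(2)}(I_{n,j})$ that satisfies the midpoint transversality condition $$\lim_{s\uparrow\ell_{n,j}}(\theta_{n,j})_{sss}(s)=0,$$ and whose lifted turning $\Phi_{n,j}^{\dagger}:=\theta_{n,j}(\ell_{n,j})-\frac{\pi}{2}$ lies in the interior of $I_{n,j}$. Consequently the doubled arc reconstructed from $\theta_{n,j}$ is smooth through the midpoint $s=\ell_{n,j}$, and its $x$-axis reflection closure is a $C^\infty$ closed unit-speed immersed critical point $\Gamma_{n,j}:\mathbb{R}/(4\ell_{n,j})\mathbb{Z}\to\mathbb{R}^2$ of $J_\lambda$. The curve $\Gamma_{n,j}$ has the following properties. (i) (Symmetries) Let $B_{n,j}:=\Gamma_{n,j}(\ell_{n,j})$. Then $B_{n,j}=\Gamma_{n,j}(3\ell_{n,j})$; $\Gamma_{n,j}(\ell_{n,j}+s)=2B_{n,j}-\Gamma_{n,j}(\ell_{n,j}-s)$ for all $s\in[0,\ell_{n,j}]$; and, writing $\Gamma_{n,j}=(x,y)$, $\Gamma_{n,j}(s)=(x(4\ell_{n,j}-s),-y(4\ell_{n,j}-s))$ for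 $2\ell_{n,j}\le s\le 4\ell_{n,j}$. (ii) (Criticality) $\delta J_\lambda[\Gamma_{n,j}](V)=0$ for every smooth variation field $V$ along $\Gamma_{n,j}$; that is, $\Gamma_{n,j}$ is a smooth closed critical point of $J_\lambda$ among all smooth closed immersions. (iii) (Turning) If $\Theta_{n,j}$ is a continuous lifted tangent angle for $\Gamma_{n,j}$ with $\Theta_{n,j}(0)=\pi/2$, then $$\Theta_{n,j}(\ell_{n,j})=\tfrac\pi2+\Phi_{n,j}^{\dagger},\quad \Theta_{n,j}(2\ell_{n,j})=\tfrac\pi2,\quad \Theta_{n,j}(3\ell_{n,j})=\tfrac\pi2-\Phi_{n,j}^{\dagger},\quad \Theta_{n,j}(4\ell_{n,j})=\tfrac\pi2 .$$ Thus the four quarter-arc turnings are $\Phi_{n,j}^{\dagger},-\Phi_{n,j}^{\dagger},-\Phi_{n,j}^{\dagger},\Phi_{n,j}^{\dagger}$, and the total turning of $\Gamma_{n,j}$ is $0$. (iv) (Energy and distinctness) $$J_\lambda[\Gamma_{n,j}]\ \ge\ \frac{16}{3}\Big(\frac{9}{2}\Big)^{1/4}\lambda^{3/4}\,|\Phi_{n,j}^{\dagger}|^{1/2}.$$ In particular $J_\lambda[\Gamma_{n,j}]\to\infty$ as $n\to\infty$ for each $j\in\{1,2\}$, and consequently the collection $\{\Gamma_{n,j}\}$ contains an infinite pairwise non-congruent subsequence.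
   Context: For an immersed planar curve $\gamma$ with arclength parameter $s$, signed curvature $k$ and length $L[\gamma]$, $J_\lambda[\gamma]:=\frac12\int_\gamma k_s^2\,ds+\lambda L[\gamma]$. The first variation of $J_\lambda$ at $\Gamma$ in direction $V$ is denoted $\delta J_\lambda[\Gamma](V)$. Subscripts $s$ denote arclength derivatives. For $\Phi\in\mathbb{R}$, $\mathcal{A}^{(2)}(\Phi)$ is the set of pairs $(\ell,\theta)$ with $\ell>0$, $\theta\in H^2(0,2\ell)$, $\theta(0)=\frac{\pi}{2}$, $\theta(\ell)=\frac{\pi}{2}+\Phi$, $\theta(2\ell)=\frac\pi2$, $\theta$ even about $\ell$ (i.e. $\theta(\ell+s)=\theta(\ell-s)$ for a.e. $s\in(0,\ell)$), and $\int_0^\ell\sin\theta\,ds=0$. For a compact interval $I\subset\mathbb{R}$, $\mathcal{A}^{(2)}(I):=\bigcup_{\Phi\in I}\mathcal{A}^{(2)}(\Phi)$. The doubled energy is $J_\lambda^{(2)}(\ell,\theta):=\frac12\int_0^{2\ell}\theta_{ss}^2\,ds+2\lambda\ell$. The doubled arc reconstructed from $(\ell,\theta)$ is $\gamma(s)=(x(s),y(s))=\int_0^s(\cos\theta(\sigma),\sin\theta(\sigma))\,d\sigma$, $0\le s\le2\ell$. Its $x$-axis reflection closure is $\Gamma(s)=\gamma(s)$ for $0\le s\le 2\ell$ and $\Gamma(s)=(x(4\ell-s),-y(4\ell-s))$ for $2\ell\le s\le4\ell$. Two curves are congruent if they coincide up to a Euclidean isometry and reparametrisation. A lifted tangent angle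 is a function $\Theta$ with $\Gamma_s=(\cos\Theta,\sin\Theta)$. *)

(* Defs.v *)
From HB Require Import structures.
From mathcomp Require Import all_boot all_order all_algebra.
From mathcomp Require Import all_classical all_reals all_analysis.

Set Implicit Arguments.
Unset Strict Implicit.
Unset Printing Implicit Defensive.

Import Order.TTheory GRing.Theory Num.Theory.
Import numFieldNormedType.Exports.

Local Open Scope classical_set_scope.
Local Open Scope ring_scope.

Section Sobolev.
Variable R : realType.
Local Notation mu := (@lebesgue_measure R).
Implicit Types (a b : R) (u g phi : R -> R) (k m : nat).

Definition smooth (f : R -> R) : Prop :=
  forall (k : nat) (s : R), derivable (derive1n k f) s 1.

Definition smooth_near (x : R) (f : R -> R) : Prop :=
  \forall s \near x, forall k : nat, derivable (derive1n k f) s 1.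

Definition test_function a b phi : Prop :=
  smooth phi /\
  exists c d, [/\ a < c, d < b & forall x, x \notin `[c, d] -> phi x = 0].

(* Only the values on ]a, b[ matter: [u \_ D] is [u] extended by 0 off [D]. *)
Definition L2 a b u : Prop := (u \_ `]a, b[) \in Lfun mu 2%:E.

Definition is_weak_derivative k a b u g : Prop :=
  forall phi, test_function a b phi ->
    Rintegral mu `]a, b[ (fun s => u s * derive1n k phi s) =
    (-1) ^+ k * Rintegral mu `]a, b[ (fun s => g s * phi s).

Definition sobolev m a b u : Prop :=
  L2 a b u /\
  forall k, (k <= m)%N -> exists2 g, L2 a b g & is_weak_derivative k a b u g.

(* A chosen representative; it is unique up to null sets on ]a, b[. *)
Definition weak_derivative k a b u : R -> R :=
  get [set g | L2 a b g /\ is_weak_derivative k a b u g].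

End Sobolev.

Section DoubledArc.
Variable R : realType.
Local Notation mu := (@lebesgue_measure R).
Implicit Types (lam ell Phi : R) (theta : R -> R).

(* Elements of the class A^(2) are functions on all of [R], of which only the
   restriction to [0, 2 ell] is constrained. The within-continuity selects the
   continuous representative of the H^2 class, so that point values make
   sense. *)
Definition admissible Phi ell theta : Prop :=
  [/\ 0 < ell,
      sobolev 2 0 (2 * ell) theta /\ {within `[0, 2 * ell], continuous theta},
      [/\ theta 0 = pi / 2, theta ell = pi / 2 + Phi &
          theta (2 * ell) = pi / 2],
      {ae mu, forall s, s \in `]0, ell[ ->
                theta (ell + s) = theta (ell - s)} &
      Rintegral mu `[0, ell] (fun s => sin (theta s)) = 0].

Definition admissible_on (I : set R) ell theta : Prop :=
  exists2 Phi, I Phi & admissible Phi ell theta.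

Definition doubled_energy lam ell theta : R :=
  2^-1 * Rintegral mu `]0, (2 * ell)[
           (fun s => weak_derivative 2 0 (2 * ell) theta s ^+ 2)
  + 2 * lam * ell.

Definition is_minimiser_on lam (I : set R) ell theta : Prop :=
  admissible_on I ell theta /\
  forall ell' theta', admissible_on I ell' theta' ->
    doubled_energy lam ell theta <= doubled_energy lam ell' theta'.

(* The first clause makes the classical third derivative meaningful. *)
Definition midpoint_transversality ell theta : Prop :=
  (\forall s \near ell^'-,
      forall k : nat, (k < 3)%N -> derivable (derive1n k theta) s 1) /\
  derive1n 3 theta s @[s --> ell^'-] --> (0 : R).

Definition rho (j : nat) : R := if j == 1%N then 3 * pi / 4 else 7 * pi / 4.

Definition window (delta : R) (n j : nat) : set R :=
  `[2 * pi * n%:R + rho j - delta, 2 * pi * n%:R + rho j + delta].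

Definition doubled_arc theta (s : R) : R * R :=
  (Rintegral mu `[0, s] (fun sigma => cos (theta sigma)),
   Rintegral mu `[0, s] (fun sigma => sin (theta sigma))).

(* The [P]-periodic function agreeing with [f] on [0, P[. *)
Definition periodize (T : Type) (P : R) (f : R -> T) (s : R) : T :=
  f (s - P * (Num.floor (s / P))%:~R).

(* A map from R/(4 ell)Z, represented as a 4 ell-periodic map on [R]. *)
Definition reflection_closure ell theta : R -> R * R :=
  periodize (4 * ell) (fun s =>
    if s <= 2 * ell then doubled_arc theta s
    else ((doubled_arc theta (4 * ell - s)).1, - (doubled_arc theta (4 * ell - s)).2)).

End DoubledArc.

Section PlaneCurves.
Variable R : realType.
Local Notation mu := (@lebesgue_measure R).
Local Notation curve := (R -> R * R).
Implicit Types (c V : curve) (P lam : R).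

Definition xc c : R -> R := fun u => (c u).1.
Definition yc c : R -> R := fun u => (c u).2.

(* [c] is regarded as a smooth map from R/PZ to the plane. *)
Definition smooth_closed P c : Prop :=
  [/\ smooth (xc c), smooth (yc c) & periodic c P].

Definition speed c (u : R) : R :=
  Num.sqrt (derive1 (xc c) u ^+ 2 + derive1 (yc c) u ^+ 2).

Definition smooth_closed_immersion P c : Prop :=
  [/\ 0 < P, smooth_closed P c & forall u, speed c u != 0].

(* Arclength derivative of a function [f] along [c]. *)
Definition ds c (f : R -> R) : R -> R := fun u => derive1 f u / speed c u.

(* k = <c_ss, N> with unit tangent T = (x_s, y_s) and N = (- y_s, x_s). *)
Definition curvature c : R -> R := fun u =>
  ds c (xc c) u * ds c (ds c (yc c)) u - ds c (yc c) u * ds c (ds c (xc c)) u.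

Definition curve_length P c : R := Rintegral mu `[0, P] (speed c).

Definition J lam P c : R :=
  2^-1 * Rintegral mu `[0, P] (fun u => ds c (curvature c) u ^+ 2 * speed c u)
  + lam * curve_length P c.

Definition vary c V (eps : R) : curve :=
  fun u => (xc c u + eps * xc V u, yc c u + eps * yc V u).

Definition is_first_variation lam P c V (v : R) : Prop :=
  is_derive (0 : R) (1 : R) (fun eps => J lam P (vary c V eps)) v.

Definition tangent_lift (A : set R) c (Theta : R -> R) : Prop :=
  {within A, continuous Theta} /\
  forall s, A s -> ds c (xc c) s = cos (Theta s) /\
                   ds c (yc c) s = sin (Theta s).

Definition euclidean_dist (p q : R * R) : R :=
  Num.sqrt ((p.1 - q.1) ^+ 2 + (p.2 - q.2) ^+ 2).

Definition euclidean_isometry (F : R * R -> R * R) : Prop :=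
  forall p q, euclidean_dist (F p) (F q) = euclidean_dist p q.

(* Lifts to [R] of the diffeomorphisms R/PZ -> R/QZ, of either orientation. *)
Definition reparametrisation (P Q : R) (phi : R -> R) : Prop :=
  [/\ smooth phi, forall u, derive1 phi u != 0 &
      (forall u, phi (u + P) = phi u + Q) \/
      (forall u, phi (u + P) = phi u - Q)].

Definition congruent P c Q c' : Prop :=
  exists F phi, [/\ euclidean_isometry F, reparametrisation P Q phi &
                    forall u, c' (phi u) = F (c u)].

End PlaneCurves.

(* Main.v *)
(** After rescaling to [0, 1], f(x) = theta(l x) - pi/2 has f(0) = 0 and f'(1) = 0, and half of
    the doubled energy is D / (2 l^3) + lam l with D the integral of f''^2 over [0, 1]. Hence D
    is to be minimised subject to f(1) lying in the window and the closing constraint that cos f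
    has integral 0, and the optimal scale satisfies 2 lam l^4 = 3 D. We take delta = pi/4, so
    that a window is [p, p + pi/2] with sin p = 1 or -1.

    A second derivative f'' is encoded by the functional it induces on continuous functions,
    which makes the existence of a minimiser a pointwise compactness argument. Since D is at
    least 3 f(1)^2, with equality for a cubic, a minimiser is close to that cubic, and for large
    p stationary phase at x = 1 gives the closing integral a strict sign at each endpoint of the
    window: opposite signs for the cubics provide a competitor, and the sign for a minimiser
    keeps its turning off the endpoints. The Euler-Lagrange equation is then f'''' = kap sin f
    with f'''(1) = 0, and f extends, odd about 0 and even about 1, to a smooth solution on the
    line, from which the closed curve is integrated. Weak second derivatives of admissible
    angles enter through their pairing with trapezoids, which recovers point values.

    Criticality: theta'''' = m cos theta, and the choice of scale makes the constant of the
    first integral vanish, theta' theta''' - theta''^2 / 2 + lam = m sin theta. Integrating the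
    first variation by parts along a period leaves m times the integral of V_y', which is 0.
    Finally J = 16/3 lam l and D >= 3 Phi^2 give the energy bound, and congruent unit-speed
    closed curves have equal length while l tends to infinity. *)

Require Import Defs.
From HB Require Import structures.
From mathcomp Require Import all_boot all_order all_algebra.
From mathcomp Require Import all_classical all_reals all_analysis.
From mathcomp Require Import measurable_realfun ring lra.

Set Implicit Arguments.
Unset Strict Implicit.
Unset Printing Implicit Defensive.

Import Order.TTheory GRing.Theory Num.Theory.
Import numFieldNormedType.Exports.

Local Open Scope classical_set_scope.
Local Open Scope ring_scope.

(** * Calculus on the line *)

Section Calculus.
Variable R : realType.
Local Notation mu := (@lebesgue_measure R).
Implicit Types (f g h F G : R -> R) (x y a b c : R).

(** The encoding turns the bound [D <= d] into the inequalities [2 L phi - |phi|^2 <= d], one for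
    each continuous [phi], so that a limit of a minimising sequence needs no representing function;
    one appears afterwards, when stationarity exhibits [L] as the pairing with a continuous
    function. This is wanted even for a minimiser sitting at an end of the window, since the
    stationary phase estimate asks for a continuous second derivative: hence a second multiplier,
    for the turning, later shown to vanish. The value pi/4 makes both ends special: with sin p = s
    and cos q = - s, the leading term of the closing integral is a pure sine Fresnel integral at p
    and a pure cosine one at q, each at least 1/25 in absolute value. The closing cubic found in
    between turns by some Phi < q, and its energy 3 Phi^2 already keeps a minimiser away from q; at
    p that energy exceeds the cubic minimum 3 p^2 by O(p) only, an excess which the phase estimate
    tolerates. Admissible angles enter only as competitors: each yields an energy functional with
    the right point values. *)

Definition isd f x a : Prop := is_derive x 1 f a.

Lemma isd_eq f x a b : isd f x a -> a = b -> isd f x b.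
Proof. by move=> ? <-. Qed.

Lemma isd_cst c x : isd (fun _ : R => c) x 0.
Proof. exact: is_derive_cst. Qed.

Lemma isd_id x : isd (fun y : R => y) x 1.
Proof. exact: is_derive_id. Qed.

Lemma isd_add f g x a b : isd f x a -> isd g x b ->
  isd (fun y => f y + g y) x (a + b).
Proof. by move=> fa gb; exact: (is_deriveD (df := a) (dg := b)). Qed.

Lemma isd_opp f x a : isd f x a -> isd (fun y => - f y) x (- a).
Proof. by move=> fa; exact: (is_deriveN (df := a)). Qed.

Lemma isd_subc f x a c : isd f x a -> isd (fun y => f y - c) x a.
Proof.
by move=> fa; have := isd_add fa (isd_cst (- c) x); rewrite addr0.
Qed.

Lemma isd_mul f g x a b : isd f x a -> isd g x b ->
  isd (fun y => f y * g y) x (a * g x + f x * b).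
Proof.
move=> fa gb; have := @is_deriveM _ _ f g x 1 a b fa gb.
have -> : f * g = (fun y => f y * g y) by apply/funext => y; rewrite fctE.
move=> fg; have <- // : f x *: b + g x *: a = a * g x + f x * b.
by rewrite /GRing.scale/= addrC (mulrC (g x)).
Qed.

Lemma isd_exp f x a n : isd f x a ->
  isd (fun y => f y ^+ n) x (n%:R * f x ^+ n.-1 * a).
Proof.
move=> fa; have := @is_deriveX _ _ f n x 1 a fa.
by have -> : f ^+ n = (fun y => f y ^+ n) by apply/funext => y; rewrite fctE.
Qed.

Lemma isd_inv f x a : f x != 0 -> isd f x a ->
  isd (fun y => (f y)^-1) x (- (f x) ^- 2 * a).
Proof. by move=> fx0 fa; exact: (is_deriveV (t := a)). Qed.

Lemma isd_comp f g x a b : isd f (g x) a -> isd g x b ->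
  isd (fun y => f (g y)) x (a * b).
Proof.
by move=> fa gb; exact: (is_derive1_comp fa gb).
Qed.

Lemma isd_sqrt x : 0 < x -> isd (@Num.sqrt R) x (2 * Num.sqrt x)^-1.
Proof. by move=> x0; exact: is_derive1_sqrt. Qed.

Lemma isd_uniq f x a b : isd f x a -> isd f x b -> a = b.
Proof. by move=> [_ <-] [_ <-]. Qed.

Lemma isd_continuous f x a : isd f x a -> {for x, continuous f}.
Proof. by move=> [/derivable1_diffP/differentiable_continuous]. Qed.

Definition der f g := forall x, isd f x (g x).

Lemma der_continuous f g : der f g -> continuous f.
Proof. by move=> fg x; exact: isd_continuous (fg x). Qed.

Lemma der_uniq f g h : der f g -> der f h -> g = h.
Proof. by move=> fg fh; apply/funext => x; exact: isd_uniq (fg x) (fh x). Qed.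

Lemma der_eq f g h : der f h -> (forall x, h x = g x) -> der f g.
Proof. by move=> fh hg x; rewrite -hg; exact: fh. Qed.

Lemma der_derive1 f g : der f g -> derive1 f = g.
Proof. by move=> fg; apply/funext => x; rewrite derive1E; case: (fg x). Qed.

Lemma derivable_isd f x : derivable f x 1 -> isd f x (derive1 f x).
Proof. by move=> /derivableP; rewrite derive1E. Qed.

Lemma der_zero_cst f x y : der f (fun=> 0) -> f x = f y.
Proof. by move=> f0; apply: is_derive_0_is_cst => z; exact: f0. Qed.

Lemma der_diff_cst f g h : der f h -> der g h -> forall x y, f x - f y = g x - g y.
Proof.
move=> fh gh x y.
have /(_ x y) : forall x y, f x - g x = f y - g y.
  move=> {}x {}y; apply: (@der_zero_cst (fun z => f z - g z)) => z.
  by apply: (isd_eq (isd_add (fh z) (isd_opp (gh z)))); rewrite subrr.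
by move=> e; lra.
Qed.

Lemma cst_cont c : continuous (fun _ : R => c).
Proof. exact: cst_continuous. Qed.

Lemma id_cont : continuous (fun x : R => x).
Proof. by move=> x. Qed.

Lemma add_cont f g : continuous f -> continuous g -> continuous (fun x => f x + g x).
Proof. by move=> cf cg x; apply: cvgD; [exact: cf|exact: cg]. Qed.

Lemma opp_cont f : continuous f -> continuous (fun x => - f x).
Proof. by move=> cf x; apply: cvgN; exact: cf. Qed.

Lemma mul_cont f g : continuous f -> continuous g -> continuous (fun x => f x * g x).
Proof. by move=> cf cg x; apply: cvgM; [exact: cf|exact: cg]. Qed.

Lemma exp_cont f n : continuous f -> continuous (fun x => f x ^+ n).
Proof.
move=> cf x; apply: (@cvg_comp _ _ _ f (fun z => z ^+ n)); first exact: cf.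
exact: exprn_continuous.
Qed.

Lemma norm_cont f : continuous f -> continuous (fun x => `|f x|).
Proof. by move=> cf x; apply: cvg_norm; exact: cf. Qed.

Lemma comp_cont f g : continuous f -> continuous g -> continuous (fun x => f (g x)).
Proof. by move=> cf cg x; apply: continuous_comp; [exact: cg|exact: cf]. Qed.

Lemma inv_cont f : (forall x, f x != 0) -> continuous f -> continuous (fun x => (f x)^-1).
Proof. by move=> f0 cf x; apply: cvgV => //; exact: cf. Qed.

Lemma cos_cont f : continuous f -> continuous (fun x => cos (f x)).
Proof. by move=> cf; apply: comp_cont => //; exact: continuous_cos. Qed.

Lemma sin_cont f : continuous f -> continuous (fun x => sin (f x)).
Proof. by move=> cf; apply: comp_cont => //; exact: continuous_sin. Qed.

Lemma min_cont f g : continuous f -> continuous g -> continuous (fun x => Num.min (f x) (g x)).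
Proof.
move=> cf cg.
have -> : (fun x => Num.min (f x) (g x)) = (fun x => 2^-1 * (f x + g x - `|f x - g x|)).
  apply/funext => x; have [fg|fg] := leP (f x) (g x).
    by rewrite ler0_norm ?subr_le0//; lra.
  by rewrite gtr0_norm ?subr_gt0//; lra.
apply: mul_cont; first exact: cst_cont.
apply: add_cont; first exact: add_cont.
by apply/opp_cont/norm_cont/add_cont => //; exact: opp_cont.
Qed.

Lemma cont_integrable f a b : continuous f -> mu.-integrable `[a, b] (EFin \o f).
Proof.
move=> cf; apply: continuous_compact_integrable; first exact: segment_compact.
exact: continuous_subspaceT.
Qed.

Lemma nbhs_abs (P : R -> Prop) x e : 0 < e -> (forall y, `|y - x| < e -> P y) ->
  \forall y \near x, P y.
Proof. by move=> e0 H; exists e => //= y; rewrite /ball_ /= distrC; exact: H. Qed.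

Lemma nbhs_absP (P : R -> Prop) x : (\forall y \near x, P y) ->
  exists2 e, 0 < e & forall y, `|y - x| < e -> P y.
Proof. by case=> e /= e0 H; exists e => // y; rewrite distrC; exact: H. Qed.

Lemma continuous_absP f x : {for x, continuous f} <->
  forall e, 0 < e -> exists2 d, 0 < d & forall y, `|y - x| < d -> `|f y - f x| < e.
Proof.
split=> [/cvgrPdist_lt H e /H/nbhs_absP[d d0 Hd]|H].
  by exists d => // y /Hd; rewrite distrC.
apply/cvgrPdist_lt => e /H[d d0 Hd]; apply: (nbhs_abs d0) => y /Hd.
by rewrite distrC.
Qed.

Definition prim_def f x :=
  if 0 <= x then Rintegral mu `[0, x] f else - Rintegral mu `[x, 0] f.

(* Locked, since unification would otherwise unfold the Lebesgue integral. *)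
Definition prim := locked prim_def.

Lemma primE : prim = prim_def.
Proof. by rewrite /prim; unlock. Qed.

Lemma Rintegral_cat f a b c : continuous f -> a <= b -> b <= c ->
  Rintegral mu `[a, c] f = Rintegral mu `[a, b] f + Rintegral mu `[b, c] f.
Proof.
move=> cf ab bc.
have := @Rintegral_itvB _ f (BLeft a) (BRight c) b (@cont_integrable f (a) (c) cf).
rewrite !bnd_simp => /(_ ab bc) => e.
rewrite -(@Rintegral_itv_obnd_cbnd _ b (BRight c)); first by lra.
by apply: integrableS (@cont_integrable f (b) (c) cf) => //; exact: subset_itv_oc_cc.
Qed.

(** A base point to the left of both 0 and [y] removes the sign convention of [prim_def], so the
    fundamental theorem on an interval applies at every point. *)
Lemma prim_base f a y : continuous f -> a <= 0 -> a <= y ->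
  prim f y = Rintegral mu `[a, y] f - Rintegral mu `[a, 0] f.
Proof.
move=> cf a0 ay; rewrite primE /prim_def; case: leP => y0.
  by rewrite (@Rintegral_cat f a 0 y)//; lra.
by rewrite (@Rintegral_cat f a y 0)// ?(ltW y0)//; lra.
Qed.

Lemma der_prim f : continuous f -> der (prim f) f.
Proof.
move=> cf x; pose a := Num.min 0 x - 1.
have a0 : a < 0 by rewrite /a; case: (leP 0 x) => *; lra.
have ax : a < x by rewrite /a; case: (leP 0 x) => *; lra.
have xx : x < x + 1 by lra.
have [dG eG] := continuous_FTC1_closed xx (@cont_integrable f (a) (x + 1) cf) ax (cf x).
apply: (@near_eq_is_derive _ _ _
  (fun y => Rintegral mu `[a, y] f - Rintegral mu `[a, 0] f)).
  near=> y; apply/esym/prim_base => //; first exact: ltW.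
  near: y; apply: (@nbhs_abs _ _ (x - a)) => [|y]; first by lra.
  by rewrite ltr_norml; lra.
by apply: isd_subc; rewrite -eG; exact: derivable_isd.
Unshelve. all: by end_near. Qed.

(** A difference of primitives: the endpoints may come in any order, and concatenation and reversal
    become algebraic identities without side conditions. *)
Definition integ := locked (fun f a b => prim f b - prim f a).

Lemma integE f a b : integ f a b = prim f b - prim f a.
Proof. by rewrite /integ; unlock. Qed.

Lemma integ_FTC F f a b : der F f -> continuous f -> integ f a b = F b - F a.
Proof. by move=> Ff cf; rewrite integE; exact: der_diff_cst (der_prim cf) Ff b a. Qed.

Lemma integ_Rint f a b : continuous f -> a <= b ->
  Rintegral mu `[a, b] f = integ f a b.
Proof.
move=> cf ab; pose c := Num.min 0 a - 1.
have c0 : c <= 0 by rewrite /c; case: (leP 0 a) => *; lra.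
have ca : c <= a by rewrite /c; case: (leP 0 a) => *; lra.
rewrite integE !(@prim_base f c)//; last exact: le_trans ab.
by rewrite (Rintegral_cat cf ca ab); lra.
Qed.

Lemma integ_cat f a b c : integ f a c = integ f a b + integ f b c.
Proof. by rewrite !integE; lra. Qed.

Lemma integ_swap f a b : integ f a b = - integ f b a.
Proof. by rewrite !integE; lra. Qed.

Lemma integ_xx f a : integ f a a = 0.
Proof. by rewrite integE subrr. Qed.

Lemma der_integ f a : continuous f -> der (fun x => integ f a x) f.
Proof.
move=> cf x; have -> : (fun y => integ f a y) = (fun y => prim f y - prim f a).
  by apply/funext => y; rewrite integE.
by apply: isd_subc; exact: der_prim.
Qed.

Lemma integD f g a b : continuous f -> continuous g ->
  integ (fun x => f x + g x) a b = integ f a b + integ g a b.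
Proof.
move=> cf cg; rewrite (@integ_FTC (fun x => prim f x + prim g x)).
- by rewrite !integE; lra.
- by move=> x; apply: isd_add; exact: der_prim.
- exact: add_cont.
Qed.

Lemma integZ f c a b : continuous f ->
  integ (fun x => c * f x) a b = c * integ f a b.
Proof.
move=> cf; rewrite (@integ_FTC (fun x => c * prim f x)).
- by rewrite !integE; lra.
- move=> x; apply: (isd_eq (a := 0 * prim f x + c * f x)); last by lra.
  by apply: isd_mul; [exact: isd_cst|exact: der_prim].
- by apply: mul_cont => //; exact: cst_cont.
Qed.

Lemma integN f a b : continuous f -> integ (fun x => - f x) a b = - integ f a b.
Proof.
move=> cf; rewrite -mulN1r -integZ//; congr (integ _ a b).
by apply/funext => x; rewrite mulN1r.
Qed.

Lemma integB f g a b : continuous f -> continuous g ->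
  integ (fun x => f x - g x) a b = integ f a b - integ g a b.
Proof. by move=> cf cg; rewrite integD ?integN//; exact: opp_cont. Qed.

Lemma integ_cst c a b : integ (fun=> c) a b = c * (b - a).
Proof.
rewrite (@integ_FTC (fun x => c * x)); first by lra.
- move=> x; apply: (isd_eq (a := 0 * x + c * 1)); last by lra.
  by apply: isd_mul; [exact: isd_cst|exact: isd_id].
- exact: cst_cont.
Qed.

Lemma eq_integ f g a b : continuous f -> continuous g -> a <= b ->
  (forall x, a <= x <= b -> f x = g x) -> integ f a b = integ g a b.
Proof.
move=> cf cg ab fg; rewrite -!integ_Rint//; apply: eq_Rintegral => x.
by rewrite inE /= in_itv; exact: fg.
Qed.

Lemma le_integ f g a b : continuous f -> continuous g -> a <= b ->
  (forall x, a <= x <= b -> f x <= g x) -> integ f a b <= integ g a b.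
Proof.
move=> cf cg ab fg; rewrite -!integ_Rint//.
apply: le_Rintegral => //; [exact: (@cont_integrable f a b cf)|exact: (@cont_integrable g a b cg)].
Qed.

Lemma integ_ge0 f a b : continuous f -> a <= b ->
  (forall x, a <= x <= b -> 0 <= f x) -> 0 <= integ f a b.
Proof.
move=> cf ab f0; rewrite -[leLHS](mul0r (b - a)) -integ_cst.
by apply: le_integ => //; exact: cst_cont.
Qed.

Lemma integ_abs f a b : continuous f -> a <= b ->
  `|integ f a b| <= integ (fun x => `|f x|) a b.
Proof.
move=> cf ab; rewrite ler_norml -integN; last exact: norm_cont.
have cN := norm_cont cf; have cNN := opp_cont cN.
by apply/andP; split; apply: le_integ => // x _; have := ler_norm (f x);
  have := ler_norm (- f x); rewrite normrN; lra.
Qed.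

Lemma integ_abs_le f a b c : continuous f -> a <= b ->
  (forall x, a <= x <= b -> `|f x| <= c) -> `|integ f a b| <= c * (b - a).
Proof.
move=> cf ab fc; apply: (le_trans (integ_abs cf ab)); rewrite -integ_cst.
by apply: le_integ => //; [exact: norm_cont|exact: cst_cont].
Qed.

Lemma integ_by_parts u v u' v' a b : der u u' -> der v v' ->
  continuous u' -> continuous v' ->
  integ (fun x => u x * v' x) a b =
  u b * v b - u a * v a - integ (fun x => u' x * v x) a b.
Proof.
move=> du dv cu cv.
have cu0 := der_continuous du; have cv0 := der_continuous dv.
have := @integ_FTC (fun x => u x * v x) (fun x => u' x * v x + u x * v' x) a b.
rewrite integD; [|exact: mul_cont..] => <-; first by lra.
- by move=> x; exact: isd_mul.
- by apply: add_cont; exact: mul_cont.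
Qed.

Lemma integ_affine f c d a b : c != 0 -> continuous f ->
  integ (fun x => f (c * x + d)) a b = c^-1 * integ f (c * a + d) (c * b + d).
Proof.
move=> c0 cf; rewrite (@integ_FTC (fun x => c^-1 * prim f (c * x + d))).
- by rewrite !integE; lra.
- move=> x.
  apply: (isd_eq (a := 0 * prim f (c * x + d) +
      c^-1 * (f (c * x + d) * ((0 * x + c * 1) + 0)))).
    apply: isd_mul; first exact: isd_cst.
    apply: isd_comp; first exact: der_prim.
    apply: isd_add; last exact: isd_cst.
    by apply: isd_mul; [exact: isd_cst|exact: isd_id].
  by rewrite !mul0r mulr1 !add0r addr0 mulrCA mulVf// mulr1.
- apply: comp_cont => //; apply: add_cont; last exact: cst_cont.
  by apply: mul_cont; [exact: cst_cont|exact: id_cont].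
Qed.

Lemma integ_eq0 f a b : continuous f -> a < b ->
  (forall x, a <= x <= b -> 0 <= f x) -> integ f a b = 0 ->
  forall x, a <= x <= b -> f x = 0.
Proof.
move=> cf ab f0 i0.
suff H x : a <= x <= b -> 0 < f x -> False.
  move=> x xab; apply/eqP; rewrite eq_le f0// andbT leNgt; apply/negP => ?.
  exact: (H x).
move=> /andP[ax xb] fx.
have /continuous_absP/(_ (f x / 2))[|d d0 Hd] := cf x; first by lra.
pose l := Num.max a (x - d / 2); pose r := Num.min b (x + d / 2).
have [al lx xl] : [/\ a <= l, l <= x & x - d / 2 <= l].
  by rewrite /l; case: (leP a (x - d / 2)) => *; split; lra.
have [rb xr rx] : [/\ r <= b, x <= r & r <= x + d / 2].
  by rewrite /r; case: (leP b (x + d / 2)) => *; split; lra.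
have lr : l < r.
  rewrite /l /r; case: (leP a (x - d / 2)) => *; case: (leP b (x + d / 2)) => *; lra.
have : f x / 2 * (r - l) <= integ f l r.
  rewrite -integ_cst; apply: le_integ => //; [exact: cst_cont|exact: ltW|].
  move=> y /andP[ly yr].
  by have /Hd : `|y - x| < d; [rewrite ltr_norml; lra|rewrite ltr_norml; lra].
have : 0 <= integ f a l by apply: integ_ge0 => // y *; apply: f0; lra.
have : 0 <= integ f r b by apply: integ_ge0 => // y *; apply: f0; lra.
have : 0 < f x / 2 * (r - l) by apply: mulr_gt0; lra.
by move: i0; rewrite (integ_cat f a l b) (integ_cat f l r b); lra.
Qed.

End Calculus.

(** A head constant for continuity, so that the tactic below can match on the shape of the
    function. *)
Definition cnt (R : realType) (f : R -> R) : Prop := continuous f.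

Lemma cntW (R : realType) (f : R -> R) : cnt f -> continuous f.
Proof. by []. Qed.

Lemma cnt_comp (R : realType) (f g : R -> R) :
  continuous f -> cnt g -> cnt (fun x => f (g x)).
Proof. exact: comp_cont. Qed.

Lemma cnt_leaf (R : realType) (f : R -> R) : continuous f -> cnt f.
Proof. by []. Qed.

(* The goal is matched syntactically: [apply:] is slow on failing unifications. *)
Ltac cnt_step :=
  lazymatch goal with
  | |- cnt (fun _ => ?c) => exact: (@cst_cont _ c)
  | |- cnt (fun x => x) => exact: (@id_cont _)
  | |- cnt (@id _) => exact: (@id_cont _)
  | |- cnt (@Algebra.add _ ?c) => exact: (add_cont (@cst_cont _ c) (@id_cont _))
  | |- cnt (@GRing.mul _ ?c) => exact: (mul_cont (@cst_cont _ c) (@id_cont _))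
  | |- cnt (fun x => @?f x + @?g x)%R => refine (@add_cont _ f g _ _)
  | |- cnt (fun x => - @?f x)%R => refine (@opp_cont _ f _)
  | |- cnt (fun x => @?f x * @?g x)%R => refine (@mul_cont _ f g _ _)
  | |- cnt (fun x => @?f x ^+ ?n)%R => refine (@exp_cont _ f n _)
  | |- cnt (fun x => `| @?f x |)%R => refine (@norm_cont _ f _)
  | |- cnt (fun x => cos (@?f x)) => refine (@cos_cont _ f _)
  | |- cnt (fun x => sin (@?f x)) => refine (@sin_cont _ f _)
  | |- cnt (fun x => Num.min (@?f x) (@?g x)) => refine (@min_cont _ f g _ _)
  | |- cnt (fun x => ?f (@?g x)) =>
      first [refine (@cnt_comp _ f g _ _); [solve [eassumption]|] | apply: cnt_leaf]
  | |- cnt ?f => apply: cnt_leaf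
  end; cbv beta.

Ltac cont := apply: cntW;
  repeat (cnt_step; try match goal with |- continuous (fun x => _) => apply: cntW end); try eassumption.

(* Differentiates along the syntax of the function, using [isd] and [der] hypotheses. *)
Ltac isd_step :=
  lazymatch goal with
  | |- isd (fun _ => ?c) ?x _ => exact: (@isd_cst _ c x)
  | |- isd (fun x => x) ?x _ => exact: (@isd_id _ x)
  | |- isd (@GRing.mul _ ?c) ?x _ => refine (@isd_mul _ (fun _ => c) (fun y => y) x _ _ _ _)
  | |- isd (@Algebra.add _ ?c) ?x _ => refine (@isd_add _ (fun _ => c) (fun y => y) x _ _ _ _)
  | |- isd (fun y => @?f y + @?g y)%R ?x _ => refine (@isd_add _ f g x _ _ _ _)
  | |- isd (fun y => - @?f y)%R ?x _ => refine (@isd_opp _ f x _ _)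
  | |- isd (fun y => @?f y * @?g y)%R ?x _ => refine (@isd_mul _ f g x _ _ _ _)
  | |- isd (fun y => @?f y ^+ ?n)%R ?x _ => refine (@isd_exp _ f x _ n _)
  | |- isd (fun y => cos (@?g y)) ?x _ =>
      refine (@isd_comp _ cos g x _ _ (@is_derive_cos _ (g x)) _)
  | |- isd (fun y => sin (@?g y)) ?x _ =>
      refine (@isd_comp _ sin g x _ _ (@is_derive_sin _ (g x)) _)
  | H : isd ?f ?x _ |- isd ?f ?x _ => exact: H
  | H : der ?f _ |- isd ?f ?x _ => exact: (H x)
  | H : isd ?f ?x _ |- isd (fun y => ?f y) ?x _ => exact: H
  | H : der ?f _ |- isd (fun y => ?f y) ?x _ => exact: (H x)
  | H : der ?f _ |- isd (fun y => ?f (@?g y)) ?x _ =>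
      refine (@isd_comp _ f g x _ _ (H (g x)) _)
  end; cbv beta.

Ltac isd_by := eapply isd_eq; [by repeat isd_step|rewrite /=].

(** * Energy functionals and existence of minimisers *)

Section EnergyFunctionals.
Variable R : realType.
Implicit Types (f g h phi psi v : R -> R) (x y a b c d t : R).
Implicit Types (L : (R -> R) -> R).

Definition ip f g := integ (fun x => f x * g x) 0 1.

Lemma ipC f g : ip f g = ip g f.
Proof. by congr (integ _ 0 1); apply/funext => x; rewrite mulrC. Qed.

Lemma ipDr f g h : continuous f -> continuous g -> continuous h ->
  ip f (fun x => g x + h x) = ip f g + ip f h.
Proof.
move=> cf cg ch; rewrite /ip -integD; [|by cont..].
by congr (integ _ 0 1); apply/funext => x; rewrite mulrDr.
Qed.

Lemma ipZr c f g : continuous f -> continuous g ->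
  ip f (fun x => c * g x) = c * ip f g.
Proof.
move=> cf cg; rewrite /ip -integZ; [|by cont..].
by congr (integ _ 0 1); apply/funext => x; rewrite mulrCA.
Qed.

Lemma ipDl f g h : continuous f -> continuous g -> continuous h ->
  ip (fun x => g x + h x) f = ip g f + ip h f.
Proof. by move=> cf cg ch; rewrite ipC ipDr// (ipC g) (ipC h). Qed.

Lemma ipZl c f g : continuous f -> continuous g ->
  ip (fun x => c * g x) f = c * ip g f.
Proof. by move=> cf cg; rewrite ipC ipZr// (ipC g). Qed.

Lemma ip_ge0 f : continuous f -> 0 <= ip f f.
Proof.
by move=> cf; apply: integ_ge0 => // [|x _]; [by cont|rewrite -expr2 sqr_ge0].
Qed.

Lemma ip_eq0 f : continuous f -> ip f f = 0 -> forall x, 0 <= x <= 1 -> f x = 0.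
Proof.
move=> cf /integ_eq0 H x x01; have /(_ _ _ _ x x01)/eqP := H.
rewrite mulf_eq0 orbb => /(_ _ _ _)/eqP; apply => //; first by cont.
by move=> y _; rewrite -expr2 sqr_ge0.
Qed.

Lemma ip_le1 f : continuous f -> (forall x, `|f x| <= 1) -> ip f f <= 1.
Proof.
move=> cf f1; apply: (@le_trans _ _ (integ (fun=> 1 : R) 0 1)); last first.
  by rewrite integ_cst; lra.
apply: le_integ => //; [by cont|by cont|move=> x _].
by have := f1 x; rewrite ler_norml => /andP[]; nra.
Qed.

(* Solution operator of [u'' = phi] with [u 0 = 0] and [u' 1 = 0]. *)
Definition sol1 phi x := integ phi 1 x.
Definition sol phi x := integ (sol1 phi) 0 x.

Lemma der_sol1 phi : continuous phi -> der (sol1 phi) phi.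
Proof. exact: der_integ. Qed.

Lemma sol1_cont phi : continuous phi -> continuous (sol1 phi).
Proof. by move=> /der_sol1/der_continuous. Qed.

Lemma der_sol phi : continuous phi -> der (sol phi) (sol1 phi).
Proof. by move=> cp; apply/der_integ/sol1_cont. Qed.

Lemma sol_cont phi : continuous phi -> continuous (sol phi).
Proof. by move=> /der_sol/der_continuous. Qed.

Lemma sol1_1 phi : sol1 phi 1 = 0. Proof. exact: integ_xx. Qed.

Lemma sol_0 phi : sol phi 0 = 0. Proof. exact: integ_xx. Qed.

(** Both sides integrate by parts to minus the pairing of [sol1 phi] with [sol1 psi]; the boundary
    terms vanish because [sol] is 0 at 0 and [sol1] is 0 at 1. *)
Lemma ip_sol phi psi : continuous phi -> continuous psi ->
  ip phi (sol psi) = ip (sol phi) psi.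
Proof.
move=> cp cq; have cp1 := sol1_cont cp; have cq1 := sol1_cont cq.
have cp2 := sol_cont cp; have cq2 := sol_cont cq.
rewrite ipC /ip (integ_by_parts 0 1 (der_sol cq) (der_sol1 cp))//.
rewrite [in RHS](integ_by_parts 0 1 (der_sol cp) (der_sol1 cq))//.
rewrite !sol1_1 !sol_0 !mulr0 !mul0r; congr (_ - _).
by congr (integ _ 0 1); apply/funext => x; rewrite mulrC.
Qed.

(** Green function of [u'' = phi] with [u 0 = 0] and [u' 1 = 0]. *)
Definition kernel x : R -> R := fun r => - Num.min x r.

Lemma kernel_cont x : continuous (kernel x).
Proof. by rewrite /kernel; cont. Qed.

Lemma ip_kernel phi x : continuous phi -> 0 <= x <= 1 ->
  ip phi (kernel x) = sol phi x.
Proof.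
move=> cp /andP[x0 x1]; have cp1 := sol1_cont cp; have ck := @kernel_cont x.
rewrite ipC /ip (@integ_cat _ _ 0 x 1).
rewrite (@eq_integ _ _ (fun r => - r * phi r) 0 x) //; last 3 first.
- by cont.
- by cont.
- by move=> r /andP[r0 rx]; rewrite /kernel; case: (leP x r) => // xr; congr (- _ * _); lra.
rewrite (@eq_integ _ _ (fun r => - x * phi r) x 1) //; last 3 first.
- by cont.
- by cont.
- by move=> r /andP[xr r1]; rewrite /kernel; case: (leP x r) => // ?; congr (- _ * _); lra.
rewrite integZ// (integ_swap _ x 1) -/(sol1 phi x).
have dN : der (fun r : R => - r) (fun=> -1).
  by move=> r; exact: isd_opp (isd_id r).
rewrite (integ_by_parts _ _ dN (der_sol1 cp))//; last exact: cst_cont.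
by rewrite integZ// -/(sol phi x); lra.
Qed.

(* [L phi] plays the role of the pairing of [phi] with the second derivative of the
   profile [arc L], and the last clause says that this second derivative has
   squared norm at most [d]. *)
Definition energy_functional d L :=
  [/\ forall phi psi, continuous phi -> continuous psi ->
        L (fun x => phi x + psi x) = L phi + L psi,
      forall c phi, continuous phi -> L (fun x => c * phi x) = c * L phi &
      forall phi, continuous phi -> 2 * L phi - ip phi phi <= d].

(** Pairing the second derivative with the Green function gives the profile itself, so even an
    abstract functional has point values. *)
Definition arc L x := L (kernel x).

Lemma energy_functional_abs d L phi : energy_functional d L -> continuous phi ->
  `|L phi| <= (d + ip phi phi) / 2.
Proof.
move=> [_ LZ Ld] cp; rewrite ler_norml.
have := Ld _ cp; have cN : continuous (fun x => -1 * phi x) by cont.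
have := Ld _ cN; rewrite LZ// ipZr// ipZl//; lra.
Qed.

Lemma energy_functionalB d L phi psi : energy_functional d L ->
  continuous phi -> continuous psi ->
  L (fun x => phi x - psi x) = L phi - L psi.
Proof.
move=> [LD LZ _] cp cq; rewrite -[in RHS]mulN1r -LZ// -LD//; last by cont.
by congr L; apply/funext => x; rewrite mulN1r.
Qed.

(** [kernel y] and [kernel x] differ by at most [|y - x|], so their normalised difference has norm
    at most 1. The constant depends on [d] alone, which makes the arcs of a minimising sequence
    equicontinuous. *)
Lemma arc_lipschitz d L x y : energy_functional d L ->
  `|arc L y - arc L x| <= (d + 1) / 2 * `|y - x|.
Proof.
move=> aL; have [->|yx] := eqVneq y x; first by rewrite !subrr normr0 mulr0.
have yx0 : 0 < `|y - x| by rewrite normr_gt0 subr_eq0.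
have ck z := @kernel_cont z.
pose phi r := `|y - x|^-1 * (kernel y r - kernel x r).
have cphi : continuous phi by rewrite /phi; cont; exact: ck.
have n1 : ip phi phi <= 1.
  apply: ip_le1 => // r; rewrite /phi normrM gtr0_norm ?invr_gt0//.
  rewrite mulrC ler_pdivrMr// mul1r /kernel.
  by case: (leP x r) => ?; case: (leP y r) => ?; rewrite ler_norml;
    case: (ger0P (y - x)) => ?; lra.
have := energy_functional_abs aL cphi; have [_ LZ _] := aL.
rewrite /phi LZ; last by cont; exact: ck.
rewrite (energy_functionalB aL (ck y) (ck x)) -/(arc L y) -/(arc L x).
rewrite normrM gtr0_norm ?invr_gt0// mulrC ler_pdivrMr// => /le_trans; apply.
by rewrite ler_pM2r//; rewrite ler_pM2r ?invr_gt0//; rewrite lerD2l.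
Qed.

Lemma arc_cont d L : energy_functional d L -> continuous (arc L).
Proof.
move=> aL x; apply/continuous_absP => e e0.
have d0 : 0 < `|d| + 1 by rewrite ltr_wpDl.
exists (e / (`|d| + 1)) => [|y yx]; first exact: divr_gt0.
apply: (le_lt_trans (arc_lipschitz x y aL)).
apply: (@le_lt_trans _ _ ((`|d| + 1) * `|y - x|)).
  by apply: ler_wpM2r => //; have := ler_norm d; have := normr_ge0 d; lra.
by rewrite mulrC -ltr_pdivlMr.
Qed.

Lemma energy_functional_ip v : continuous v -> energy_functional (ip v v) (ip v).
Proof.
move=> cv; split=> [phi psi cp cq|c phi cp|phi cp]; [exact: ipDr|exact: ipZr|].
have : 0 <= ip (fun x => v x + -1 * phi x) (fun x => v x + -1 * phi x).
  by apply: ip_ge0; cont.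
rewrite ipDl; [|by cont..]; rewrite !ipDr; [|by cont..].
rewrite ipZl; [|by cont..]; rewrite !ipZr; [|by cont..].
by rewrite ipZl; [|by cont..]; rewrite (ipC phi v); lra.
Qed.

(** The squared norm of [L + t v] expands as in an inner product space, although [L] is not yet
    represented by a function: test [L] with [phi - t v]. *)
Lemma energy_functional_perturb d L t v : energy_functional d L -> continuous v ->
  energy_functional (d + 2 * t * L v + t ^+ 2 * ip v v)
    (fun phi => L phi + t * ip v phi).
Proof.
move=> [LD LZ Ld] cv; split=> [phi psi cp cq|c phi cp|phi cp].
- by rewrite LD// ipDr//; ring.
- by rewrite LZ// ipZr//; ring.
have c1 : continuous (fun x => phi x + (- t) * v x) by cont.
have := Ld _ c1; rewrite LD; [|by cont..]; rewrite LZ//.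
rewrite ipDl; [|by cont..]; rewrite !ipDr; [|by cont..].
rewrite ipZl; [|by cont..]; rewrite !ipZr; [|by cont..].
by rewrite ipZl; [|by cont..]; rewrite (ipC phi v); lra.
Qed.

(** [kernel 1] has squared norm 1/3. Testing with [c * arc L 1 * kernel 1] gives the factor
    [2 c - c^2 / 3], which is largest at [c = 3]. *)
Lemma energy_functional_lb d L : energy_functional d L -> 3 * arc L 1 ^+ 2 <= d.
Proof.
move=> [LD LZ Ld]; have ck := @kernel_cont 1.
have cp : continuous (fun x => 3 * arc L 1 * kernel 1 x) by cont.
have := Ld _ cp; rewrite LZ// ipZr// ipZl//.
suff -> : ip (kernel 1) (kernel 1) = 3^-1 by rewrite /arc; lra.
rewrite /ip (@eq_integ _ _ (fun x => x ^+ 2)) //; last 3 first.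
- by cont.
- by cont.
- by move=> x /andP[x0 x1]; rewrite /kernel; case: (leP 1 x) => ?; [have -> : x = 1 by lra|]; lra.
rewrite (@integ_FTC _ (fun x => 3^-1 * x ^+ 3) (fun x => x ^+ 2)); first by lra.
- by move=> x; isd_by; rewrite /=; lra.
- by cont.
Qed.

End EnergyFunctionals.

(** * Limits along ultrafilters and elementary trigonometric estimates *)

Section Compactness.
Variable R : realType.

Lemma ultra_fmap (T U : Type) (G : set_system T) (u : T -> U) :
  UltraFilter G -> UltraFilter (u @ G).
Proof.
move=> UG; split; first exact: fmap_proper_filter.
move=> H PH sGH; rewrite eqEsubset; split=> // A HA.
have [//|nA] := in_ultra_setVsetC (u @^-1` A) UG.
have /sGH HC : (u @ G) (~` A) by [].
have : H (A `&` ~` A) by exact: filterI.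
by rewrite setICr => /filter_ex[].
Qed.

Lemma ultra_bounded_cvg (u : nat -> R) b (G : set_system nat) : UltraFilter G ->
  (forall n, `|u n| <= b) -> exists l : R, u @ G --> l.
Proof.
move=> UG ub; have := @segment_compact R (- b) b; rewrite compact_ultra => H.
have [|l [_ ul]] := H (u @ G) (ultra_fmap u UG); last by exists l.
apply: (@filterS _ G _ setT) => [n _|]; last exact: filterT.
by rewrite /= in_itv/= -ler_norml.
Qed.

Lemma cvg_real_unique (T : Type) (G : set_system T) (u : T -> R) (a b : R) : ProperFilter G ->
  u @ G --> a -> u @ G --> b -> a = b.
Proof. by move=> PG ua ub; exact: (@cvg_unique _ (@Rhausdorff R) (u @ G) _ _ _ ua ub). Qed.

Lemma der_lip (F f : R -> R) (c x y : R) : der F f -> continuous f ->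
  (forall t, `|f t| <= c) -> `|F y - F x| <= c * `|y - x|.
Proof.
move=> Ff cf fc; wlog xy : x y / x <= y.
  move=> H; case: (leP x y) => [/H//|/ltW/H]; by rewrite distrC (distrC x).
rewrite -(integ_FTC x y Ff cf) [in leRHS]ger0_norm ?subr_ge0//.
by apply: integ_abs_le.
Qed.

Lemma der_sin : der (@sin R) (@cos R).
Proof. by move=> x; exact: is_derive_sin. Qed.

Lemma der_cos : der (@cos R) (fun x => - sin x).
Proof. by move=> x; exact: is_derive_cos. Qed.

Lemma sin_lip (x y : R) : `|sin y - sin x| <= `|y - x|.
Proof.
rewrite -[leRHS]mul1r; apply: (der_lip _ _ der_sin); first exact: continuous_cos.
exact: cos_max.
Qed.

Lemma cos_lip (x y : R) : `|cos y - cos x| <= `|y - x|.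
Proof.
rewrite -[leRHS]mul1r; apply: (der_lip _ _ der_cos).
  by cont; exact: continuous_sin.
by move=> t; rewrite normrN; exact: sin_max.
Qed.

Lemma cos_taylor (a b : R) : `|cos (a + b) - cos a + b * sin a| <= b ^+ 2.
Proof.
have cs : continuous (@sin R) by exact: continuous_sin.
pose f t : R := - sin (a + t) + sin a.
have cf : continuous f by rewrite /f; cont.
have fI : der (fun t => cos (a + t) + t * sin a) f.
  by move=> t; isd_by; rewrite /f; ring.
have -> : cos (a + b) - cos a + b * sin a = integ f 0 b.
  by rewrite (integ_FTC _ _ fI)// addr0; lra.
have fb t : `|f t| <= `|t|.
  rewrite /f addrC distrC; have e : a + t - a = t by lra.
  by have := sin_lip a (a + t); rewrite e distrC.
case: (leP 0 b) => b0.
  apply: (le_trans (@integ_abs_le _ f 0 b b cf b0 _)); last by lra.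
  by move=> t /andP[t0 tb]; apply: (le_trans (fb t)); rewrite ger0_norm.
rewrite integ_swap normrN.
apply: (le_trans (@integ_abs_le _ f b 0 (- b) cf (ltW b0) _)); last by lra.
by move=> t /andP[t0 tb]; apply: (le_trans (fb t)); rewrite ler0_norm; lra.
Qed.

Lemma near_forall_le (T : Type) (G : set_system T) (P : nat -> T -> Prop) m :
  Filter G -> (forall i, \forall n \near G, P i n) ->
  \forall n \near G, forall i, (i <= m)%N -> P i n.
Proof.
move=> FG H; elim: m => [|m IH].
  by apply: filterS (H 0%N) => n Pn [].
apply: filterS2 IH (H m.+1) => n IH Pn i; rewrite leq_eqVlt => /predU1P[->//|].
exact: IH.
Qed.

End Compactness.

(** * Existence of a minimiser by pointwise compactness *)

Section Minimiser.
Variable R : realType.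
Implicit Types (f g h phi psi v : R -> R) (x y a b c d t p q : R).
Implicit Types (L : (R -> R) -> R).

(** The arc is the angle minus pi/2, so the sine of the closing condition becomes a cosine. *)
Definition defect L := integ (fun x => cos (arc L x)) 0 1.

Definition competitor p q d L :=
  [/\ energy_functional d L, p <= arc L 1 <= q & defect L = 0].

(** One ultrafilter provides limits for all [phi] simultaneously; linearity, the quadratic bound and
    the window condition involve finitely many values at a time and pass to the limit. The defect
    does not, but the arcs are uniformly Lipschitz, so closeness on a finite grid controls it. *)
Lemma competitor_min p q d0 L0 : competitor p q d0 L0 ->
  exists M L, competitor p q M L /\
    forall d' L', competitor p q d' L' -> M <= d'.
Proof.
move=> c0.
pose E := [set d | exists L, competitor p q d L].
have lbE : lbound E 0.
  move=> d [L [[_ LZ Ld] _ _]].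
  have := Ld _ (@cst_cont R 0); have := LZ 0 _ (@cst_cont R 0).
  under eq_fun do rewrite mul0r; rewrite mul0r => ->.
  by rewrite /ip; under eq_fun do rewrite mul0r; rewrite integ_cst; lra.
have infE : has_inf E by split; [exists d0, L0|exists 0].
pose M := inf E.
have Mle d' L' : competitor p q d' L' -> M <= d'.
  by move=> c; apply: (ge_inf infE.2); exists L'.
have /choice[L_ L_c] n : exists L, competitor p q (M + n.+1%:R^-1) L.
  have n0 : 0 < n.+1%:R^-1 :> R by rewrite invr_gt0 ltr0n.
  have [d [L Lc] dM] := inf_adherent n0 infE; exists L.
  have [[LD LZ Ld] ? ?] := Lc; split=> //; split=> // phi cp.
  by apply: (le_trans (Ld _ cp)); exact: ltW.
have nM n : M + n.+1%:R^-1 <= M + 1.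
  by rewrite lerD2l invf_le1 ?ltr0n// ler1n.
have L_a n : energy_functional (M + 1) (L_ n).
  have [[LD LZ Ld] _ _] := L_c n; split=> // phi cp.
  exact: le_trans (Ld _ cp) (nM n).
(* Finer than convergence at infinity, so that [1 / (n + 1)] still tends to 0 along it. *)
have [G [UG subG]] := @ultraFilterLemma nat (nbhs \oo) _.
have PG : ProperFilter G by case: UG.
have [phi|L LG] := @choice _ _ (fun (phi : R -> R) (l : R) =>
    continuous phi -> (fun n => L_ n phi) @ G --> l).
  (* Off the continuous functions 0 is a default value. *)
  have [cp|ncp] := pselect (continuous phi); last by exists 0.
  have := @ultra_bounded_cvg R (fun n => L_ n phi) ((M + 1 + ip phi phi) / 2) G UG.
  case=> [n|l ul]; first exact: energy_functional_abs.
  by exists l.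
exists M, L; split; last exact: Mle.
have ck z := @kernel_cont R z.
have aL : energy_functional M L.
  split.
  - move=> phi psi cp cq; have cpq := add_cont cp cq.
    have := cvgD (LG _ cp) (LG _ cq).
    have -> : (fun n => L_ n phi) + (fun n => L_ n psi) = (fun n => L_ n (fun x => phi x + psi x)).
      by apply/funext => n; have [[LD _ _] _ _] := L_c n; rewrite LD.
    by move=> /(_ _)/(cvg_real_unique PG (LG _ cpq)).
  - move=> c phi cp; have cc : continuous (fun x => c * phi x) by cont.
    have : (fun n => c * L_ n phi) @ G --> c * L phi.
      by apply: cvgM; [exact: cvg_cst|exact: LG].
    have -> : (fun n => c * L_ n phi) = (fun n => L_ n (fun x => c * phi x)).
      by apply/funext => n; have [[_ LZ _] _ _] := L_c n; rewrite LZ.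
    exact: (cvg_real_unique PG (LG _ cc)).
  - move=> phi cp.
    suff H (e : R) : 0 < e -> 2 * L phi - ip phi phi <= M + e by apply/ler_addgt0Pr.
    move=> e0; have e4 : 0 < e / 4 by lra.
    have /cvgrPdist_lt/(_ _ e4) H1 := LG _ cp.
    have H2 : G [set n | n.+1%:R^-1 < e / 4].
      apply: subG.
      have := @cvg_harmonic R => /cvgrPdist_lt/(_ _ e4).
      by apply: filterS => n /=; rewrite sub0r normrN ger0_norm ?invr_ge0.
    have [n [H3 H4]] := filter_ex (filterI H1 H2).
    have [[_ _ Ld] _ _] := L_c n; have := Ld _ cp.
    move: H3 H4; rewrite /= ltr_norml; move: (n.+1%:R^-1) => r; lra.
have arcG x : (fun n => arc (L_ n) x) @ G --> arc L x by exact: LG (ck x).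
split=> //.
  have H : G [set n | p <= arc (L_ n) 1 <= q] by apply: filterE => n; have [] := L_c n.
  apply/andP; split.
    by apply: (cvgr_to_ge (arcG 1)); apply: filterS H => n /andP[].
  by apply: (cvgr_to_le (arcG 1)); apply: filterS H => n /andP[].
apply/eqP; rewrite -normr_le0.
suff H (e : R) : 0 < e -> `|defect L| <= e by apply/ler_addgt0Pr => e; rewrite add0r; exact: H.
move=> e0.
pose K := `|M| + 2.
have K0 : 0 < K by rewrite /K; have := normr_ge0 M; lra.
have lip L' : energy_functional (M + 1) L' -> forall x y, `|arc L' y - arc L' x| <= K * `|y - x|.
  move=> aL' x y; apply: (le_trans (arc_lipschitz x y aL')).
  by apply: ler_wpM2r => //; rewrite /K; have := ler_norm M; have := normr_ge0 M; lra.
have aL1 : energy_functional (M + 1) L.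
  by case: aL => ? ? H; split=> // phi /H; lra.
(* Mesh of the grid: between neighbouring points each of the two arcs moves by at most [e / 4], and
   at the grid points they differ by less than [e / 2]. *)
pose N := (Num.truncn (4 * K / e)).+1.
have N0 : 0 < N%:R :> R by rewrite ltr0n.
have NK : K / N%:R <= e / 4.
  rewrite ler_pdivrMr// mulrC -ler_pdivrMr ?divr_gt0//.
  have -> : K / (e / 4) = 4 * K / e by field; rewrite gt_eqF.
  by rewrite /N ltW// -truncn_lt_nat // ; apply: divr_ge0; lra.
have : \forall n \near G, forall i, (i <= N)%N ->
    `|arc L (i%:R / N%:R) - arc (L_ n) (i%:R / N%:R)| < e / 2.
  apply: near_forall_le => i.
  by have /cvgrPdist_lt := arcG (i%:R / N%:R); apply; lra.
case/filter_ex => n Hn.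
have [_ _ dn] := L_c n.
have cL := arc_cont aL; have cLn := arc_cont (L_a n).
rewrite -[defect L]subr0 -dn /defect -integB; [|by cont..].
rewrite -[leRHS]mulr1 -[X in _ * X](subr0 1); apply: integ_abs_le => //; first by cont.
move=> x /andP[x0 x1]; apply: (le_trans (cos_lip _ _)).
pose i := Num.truncn (x * N%:R).
have xN0 : 0 <= x * N%:R by apply: mulr_ge0 => //; exact: ltW.
have /andP[i1 i2] := truncn_itv xN0.
have iN : (i <= N)%N.
  by rewrite -(ler_nat R); apply: (le_trans i1); rewrite -[leRHS]mul1r ler_wpM2r// ltW.
have xi : `|x - i%:R / N%:R| <= N%:R^-1.
  have -> : x - i%:R / N%:R = (x * N%:R - i%:R) / N%:R by field; rewrite gt_eqF.
  rewrite normrM (@ger0_norm _ (N%:R^-1)) ?invr_ge0 ?(ltW N0)//.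
  apply: ler_piMl; first by rewrite invr_ge0 ltW.
  by rewrite ler_norml; move: i1 i2; rewrite -/i -natr1; lra.
have := Hn i iN.
have KN : K * `|x - i%:R / N%:R| <= e / 4.
  by apply: le_trans NK; rewrite ler_pM2l.
have := lip _ aL1 (i%:R / N%:R) x; have := lip _ (L_a n) (i%:R / N%:R) x.
set A := arc L x; set B := arc (L_ n) x; set C := arc L _; set D := arc (L_ n) _.
by rewrite !ler_norml ltr_norml => /andP[? ?] /andP[? ?] /andP[? ?]; apply/andP; split; lra.
Qed.

End Minimiser.

(** * Lagrange multipliers for the closing constraint and the turning *)

Section EulerLagrange.
Variable R : realType.
Implicit Types (f g h phi psi v w : R -> R) (x y a b c d s t p q : R).
Implicit Types (L : (R -> R) -> R).

(** [c * phi] has norm 0 for every [c], so [2 c L phi <= d] for all real [c]. *)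
Lemma energy_functional_vanish d L phi : energy_functional d L -> continuous phi ->
  (forall x, 0 <= x <= 1 -> phi x = 0) -> L phi = 0.
Proof.
move=> [_ LZ Ld] cp p0.
have ip0 c : ip (fun x => c * phi x) (fun x => c * phi x) = 0.
  rewrite -(mulr0 (1 - 0)) mulrC -integ_cst; apply: eq_integ => //; [by cont|by cont|].
  by move=> x /p0 ->; rewrite !mulr0.
have key c : 2 * c * L phi <= d.
  have cc : continuous (fun x => c * phi x) by cont.
  by have := Ld _ cc; rewrite LZ// ip0; lra.
have d0 : 0 <= d by have := key 0; lra.
apply/eqP; apply: contraT => L0.
have := key ((d + 1) / (2 * L phi)).
have -> : 2 * ((d + 1) / (2 * L phi)) * L phi = d + 1 by field.
lra.
Qed.

Lemma arc_0 d L : energy_functional d L -> arc L 0 = 0.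
Proof.
move=> aL; apply: (energy_functional_vanish aL); first exact: kernel_cont.
by move=> x /andP[x0 _]; rewrite /kernel; case: (leP 0 x) => ?; lra.
Qed.

Lemma cont_bounded f c d : c <= d -> continuous f ->
  exists2 k, 0 < k & forall x, c <= x <= d -> `|f x| <= k.
Proof.
move=> cd cf; have [z _ Hz] := @EVT_max R (fun x => `|f x|) c d cd
  (continuous_subspaceT (norm_cont cf)).
exists (`|f z| + 1) => [|x x01]; first by have := normr_ge0 (f z); lra.
by apply: (le_trans (Hz x _)); [rewrite in_itv|lra].
Qed.

Lemma sol_1 v : continuous v -> sol v 1 = - ip v id.
Proof.
move=> cv; have ck := @kernel_cont R 1; have cid := @id_cont R; rewrite -ip_kernel ?ler01 ?lexx//.
rewrite -mulN1r -(@ipZr _ (-1) v id) // /ip; apply: eq_integ => //; [by cont|by cont|].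
by move=> x /andP[x0 x1]; rewrite /kernel; case: (leP 1 x) => ?;
  [have -> : x = 1 by lra|]; lra.
Qed.

Lemma ip_id : ip (@id R) id = 3^-1.
Proof.
rewrite /ip (@integ_FTC _ (fun x => 3^-1 * x ^+ 3) (fun x => x * x)); first by lra.
- by move=> x; isd_by; rewrite /=; lra.
- by cont.
Qed.

Lemma isd_eq_open f g (a b x u u' : R) : a < x < b -> (forall y, a < y < b -> f y = g y) ->
  isd f x u -> isd g x u' -> u = u'.
Proof.
move=> axb fg fu; apply: isd_uniq; apply: near_eq_is_derive fu.
have e0 : 0 < Num.min (x - a) (b - x) by case: (leP (x - a) (b - x)) => *; lra.
apply: (nbhs_abs e0) => y; rewrite ltr_norml => H; apply: fg; move: H.
by case: (leP (x - a) (b - x)) => *; lra.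
Qed.

Section FirstVariation.
Variables (p q M : R) (L : (R -> R) -> R).
Hypothesis cL : competitor p q M L.
Hypothesis minL : forall d' L', competitor p q d' L' -> M <= d'.
Let u x := sin (arc L x).
(** Up to sign the gradient of the closing integral: its derivative along [v] is [- ip u (sol v)],
    which self-adjointness of [sol] turns into [- ip P v]. *)
Let P := sol u.

Let aL : energy_functional M L. Proof. by case: cL. Qed.
Let arcC : continuous (arc L). Proof. exact: arc_cont aL. Qed.
Let uC : continuous u. Proof. by rewrite /u; cont. Qed.
Let PC : continuous P. Proof. exact: sol_cont. Qed.

Lemma defect_perturb t s v w bv bw : continuous v -> continuous w ->
  (forall x, 0 <= x <= 1 -> `|sol v x| <= bv) ->
  (forall x, 0 <= x <= 1 -> `|sol w x| <= bw) ->
  `|integ (fun x => cos (arc L x + t * sol v x + s * sol w x)) 0 1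
     + t * ip P v + s * ip P w| <= 2 * t ^+ 2 * bv ^+ 2 + 2 * s ^+ 2 * bw ^+ 2.
Proof.
move=> cv cw Hv Hw; have cV := sol_cont cv; have cW := sol_cont cw.
have [_ _ d0] := cL.
pose b x := t * sol v x + s * sol w x.
have cb : continuous b by rewrite /b; cont.
have -> : integ (fun x => cos (arc L x + t * sol v x + s * sol w x)) 0 1
     + t * ip P v + s * ip P w =
   integ (fun x => cos (arc L x + b x) - cos (arc L x) + b x * sin (arc L x)) 0 1.
  rewrite integD; [|by cont..]; rewrite integB; [|by cont..].
  rewrite -/(defect L) d0 subr0 -addrA; congr (_ + _).
    by congr (integ _ 0 1); apply/funext => x; rewrite /b addrA.
  rewrite -/(u _) /b /P -!ip_sol// -!ipZr// -ipDr; [|by cont..].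
  by rewrite ipC.
rewrite -[leRHS]mulr1 -[X in _ * X](subr0 1); apply: integ_abs_le => //; first by cont.
move=> x x01; apply: (le_trans (cos_taylor _ _)); rewrite /b.
have := Hv x x01; have := Hw x x01; rewrite !ler_norml => /andP[w1 w2] /andP[v1 v2].
set V := sol v x in v1 v2 *; set W := sol w x in w1 w2 *.
have V2 : V ^+ 2 <= bv ^+ 2 by nra.
have W2 : W ^+ 2 <= bw ^+ 2 by nra.
have := ler_wpM2l (sqr_ge0 t) V2; have := ler_wpM2l (sqr_ge0 s) W2.
have := sqr_ge0 (t * V - s * W); lra.
Qed.

(** If [L v < 0], moving by [t v] lowers the energy at first order and breaks the closing constraint
    only at order [t^2]. A correction [s w] with [|s| <= C t^2], found by the intermediate value
    theorem, restores closing; it leaves the turning alone since [sol w 1 = 0] and changes the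
    energy at second order only. The last hypothesis keeps the turning in the window for small
    [t]. *)
Lemma first_variation_ge0 v w : continuous v -> continuous w ->
  ip P v = 0 -> ip P w = 1 -> sol w 1 = 0 ->
  sol v 1 = 0 \/ p < arc L 1 < q -> 0 <= L v.
Proof.
move=> cv cw Pv Pw w1 v1; rewrite leNgt; apply/negP => Lv.
have cV := sol_cont cv; have cW := sol_cont cw.
have [bv bv0 Hv] := cont_bounded ler01 cV; have [bw bw0 Hw] := cont_bounded ler01 cW.
have [_ pq _] := cL.
have [r r0 Hr] : exists2 r, 0 < r &
    forall t, 0 < t <= r -> p <= arc L 1 + t * sol v 1 <= q.
  case: v1 => [->|/andP[p1 q1]].
    by exists 1 => // t _; rewrite mulr0 addr0.
  exists (Num.min (arc L 1 - p) (q - arc L 1) / bv).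
    by apply: divr_gt0 => //; case: (leP (arc L 1 - p) (q - arc L 1)) => *; lra.
  move=> t /andP[t0]; rewrite ler_pdivlMr// => tb.
  have : `|t * sol v 1| <= t * bv.
    by rewrite normrM (gtr0_norm t0) ler_wpM2l ?(ltW t0)// Hv// ler01 lexx.
  by move: tb; case: (leP (arc L 1 - p) (q - arc L 1)) => ? tb; rewrite ler_norml; lra.
(* [C t^2] bounds the correction and [D t^2] all second-order changes of the energy. The condition
   [t E <= 1] makes the quadratic remainder caused by [w] at most [t^2], the share provided by the
   summand 1 of [C]. *)
pose C := 2 * bv ^+ 2 + 1.
have C0 : 0 < C by rewrite /C; have := sqr_ge0 bv; lra.
pose D := `|ip v v| + 2 * C * (`|L w| + `|ip v w|) + C ^+ 2 * `|ip w w| + 1.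
have D0 : 0 < D.
  have H1 := normr_ge0 (ip v v); have H2 := normr_ge0 (L w); have H3 := normr_ge0 (ip v w).
  have H4 : 0 <= C ^+ 2 * `|ip w w| by apply: mulr_ge0 => //; exact: sqr_ge0.
  have H5 : 0 <= C * (`|L w| + `|ip v w|) by apply: mulr_ge0; lra.
  by rewrite /D; lra.
pose E := 2 * C ^+ 2 * bw ^+ 2 + 1.
have E0 : 0 < E.
  have : 0 <= C ^+ 2 * bw ^+ 2 by apply: mulr_ge0; exact: sqr_ge0.
  by rewrite /E; lra.
pose t := Num.min (Num.min 1 r) (Num.min (E^-1) (- L v / D)).
have [t0 t1 tr tE tD] : [/\ 0 < t, t <= 1, t <= r, t <= E^-1 & t <= - L v / D].
  have i1 : 0 < E^-1 by rewrite invr_gt0.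
  have i2 : 0 < - L v / D by apply: divr_gt0 => //; lra.
  split; rewrite /t ?lt_min ?i1 ?i2 ?ltr01 ?r0 //.
  - by rewrite !ge_min lexx.
  - by rewrite !ge_min lexx ?orbT.
  - by rewrite !ge_min lexx ?orbT.
  - by rewrite !ge_min lexx ?orbT.
have tE' : t * E <= 1 by rewrite -ler_pdivlMr// div1r.
have tD' : t * D <= - L v by rewrite -ler_pdivlMr.
pose F s := integ (fun x => cos (arc L x + t * sol v x + s * sol w x)) 0 1.
have Fs s : `|F s + s| <= 2 * t ^+ 2 * bv ^+ 2 + 2 * s ^+ 2 * bw ^+ 2.
  by have := @defect_perturb t s v w bv bw cv cw Hv Hw; rewrite Pv Pw mulr0 mulr1 addr0.
have FC : continuous F.
  move=> s0; apply/continuous_absP => e e0; exists (e / bw); first exact: divr_gt0.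
  move=> s ss; rewrite /F -integB; [|by cont..].
  apply: (@le_lt_trans _ _ (`|s - s0| * bw)); last by rewrite -ltr_pdivlMr.
  rewrite -[leRHS]mulr1 -[X in _ * X](subr0 1); apply: integ_abs_le => //; first by cont.
  move=> x x01; apply: (le_trans (cos_lip _ _)).
  have -> : arc L x + t * sol v x + s * sol w x - (arc L x + t * sol v x + s0 * sol w x) =
     (s - s0) * sol w x by lra.
  by rewrite normrM ler_wpM2l// Hw.
pose s1 := C * t ^+ 2.
have t2 : 0 < t ^+ 2 by rewrite exprn_gt0.
have s10 : 0 < s1 by apply: mulr_gt0.
have small : 2 * t ^+ 2 * bv ^+ 2 + 2 * s1 ^+ 2 * bw ^+ 2 <= s1.
  have : t ^+ 2 * (2 * C ^+ 2 * bw ^+ 2) <= 1.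
    apply: le_trans tE'; apply: (@le_trans _ _ (t ^+ 2 * E)).
      by rewrite ler_wpM2l ?(ltW t2)// /E; lra.
    by rewrite ler_wpM2r ?(ltW E0)// expr2; nra.
  move=> H; have := ler_wpM2l (ltW t2) H; rewrite /s1 /C; nra.
(* [F s] is close to [- s], hence nonnegative at [- s1] and nonpositive at [s1]. *)
have [s ss Fs0] : exists2 s, s \in `[- s1, s1] & F s = 0.
  apply: (@IVT R F (- s1) s1); first by lra.
    exact: continuous_subspaceT.
  have := Fs s1; have := Fs (- s1); rewrite sqrrN !ler_norml => /andP[? ?] /andP[? ?].
  by rewrite ge_min le_max; apply/andP; split; apply/orP; [right|left]; lra.
have sabs : `|s| <= s1 by rewrite ler_norml; move: ss; rewrite in_itv.
have a1 := energy_functional_perturb t aL cv.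
have a2 := energy_functional_perturb s a1 cw.
pose L2 phi := L phi + t * ip v phi + s * ip w phi.
have H1 : p <= arc L2 1 <= q.
  by rewrite /arc /L2 !ip_kernel ?lexx ?ler01// w1 mulr0 addr0; apply: Hr; rewrite t0 tr.
have H2 : defect L2 = 0.
  rewrite -[RHS]Fs0 /defect /F.
  have cc2 : continuous (arc L2) := arc_cont a2.
  apply: eq_integ => //; [by cont|by cont|].
  by move=> x x01; rewrite /arc /L2 !ip_kernel.
have Hmin := minL (And3 a2 H1 H2); rewrite /= in Hmin.
have s2 : s ^+ 2 <= C ^+ 2 * t ^+ 2.
  have : s ^+ 2 <= s1 ^+ 2 by move: sabs; rewrite ler_norml => /andP[]; nra.
  move=> /le_trans; apply; rewrite /s1 exprMn ler_wpM2l ?sqr_ge0// expr2 ler_piMr ?(ltW t2)//.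
  by rewrite expr2; nra.
have B1 : 2 * s * (L w + t * ip v w) <= 2 * (C * t ^+ 2) * (`|L w| + `|ip v w|).
  apply: (le_trans (ler_norm _)); rewrite !normrM (@ger0_norm _ 2)//.
  apply: ler_pM => //; first by rewrite ler_wpM2l.
  apply: (le_trans (ler_normD _ _)); rewrite lerD2l normrM gtr0_norm//.
  by rewrite ler_piMl.
have B2 : s ^+ 2 * ip w w <= C ^+ 2 * t ^+ 2 * `|ip w w|.
  apply: (le_trans (ler_norm _)); rewrite normrM ger0_norm ?sqr_ge0//.
  by rewrite ler_wpM2r.
have B3 : t ^+ 2 * ip v v <= t ^+ 2 * `|ip v v|.
  by rewrite ler_wpM2l ?(ltW t2)// ler_norm.
have B4 : t ^+ 2 * D <= - t * L v by nra.
have : t * L v < 0 by nra.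
have DE : t ^+ 2 * D = t ^+ 2 * `|ip v v| + 2 * (C * t ^+ 2) * (`|L w| + `|ip v w|) +
    C ^+ 2 * t ^+ 2 * `|ip w w| + t ^+ 2 by rewrite /D; ring.
by move: B1 B2 B3 B4 Hmin; rewrite DE; lra.
Qed.

Lemma first_variation_eq0 v w : continuous v -> continuous w ->
  ip P v = 0 -> ip P w = 1 -> sol w 1 = 0 ->
  sol v 1 = 0 \/ p < arc L 1 < q -> L v = 0.
Proof.
move=> cv cw Pv Pw w1 v1; apply/eqP; rewrite eq_le.
rewrite (first_variation_ge0 cv cw)// andbT -oppr_ge0.
have cNv : continuous (fun x => -1 * v x) by cont.
have [_ LZ _] := aL; rewrite -mulN1r -LZ//.
apply: (first_variation_ge0 cNv cw) => //; first by rewrite ipZr// Pv mulr0.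
case: v1 => [v1|]; [left|by right].
have cid := @id_cont R; move: v1; rewrite !sol_1// (@ipZl _ (-1) id v)//; lra.
Qed.

Hypothesis not_flat : exists2 x, 0 < x < 1 & sin (arc L x) != 0.

(** Gram-Schmidt: [w0] is [P] without its component along [id], so by [sol_1] it does not change the
    turning; the 3 is the inverse of [ip id id]. It is not 0, for otherwise [P] would be linear on
    the unit interval and its second derivative [u] would vanish inside, against [not_flat]. *)
Lemma multiplier_direction : exists w, [/\ continuous w, ip P w = 1 & sol w 1 = 0].
Proof.
have cid := @id_cont R.
pose c := 3 * ip P id; pose w0 x := P x + (- c) * x.
have cw0 : continuous w0 by rewrite /w0; cont.
have w0id : ip w0 id = 0.
  by rewrite ipDl; [|by cont..]; rewrite (@ipZl _ (- c) id id)// ip_id /c; lra.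
have Pw0 : ip P w0 = ip w0 w0.
  rewrite [in RHS]ipDl; [|by cont..].
  by rewrite (@ipZl _ (- c) w0 id)// (ipC id) w0id; lra.
have n0 : ip w0 w0 != 0.
  apply/eqP => /(ip_eq0 cw0) w00; have [x0 x01 /eqP] := not_flat; apply.
  have dP : der w0 (fun x => sol1 u x - c).
    by move=> x; have H := der_sol uC; rewrite /w0 /P; isd_by; ring.
  have dP1 : der (fun x => sol1 u x - c) u.
    by move=> x; have H := der_sol1 uC; isd_by; ring.
  have e1 x : 0 < x < 1 -> sol1 u x - c = 0.
    move=> xx; apply: (@isd_eq_open w0 (fun=> 0) 0 1 x _ _ xx _ (dP x)) => [y /andP[y0 y1]|].
      by apply: w00; rewrite !ltW.
    exact: isd_cst.
  by apply: (@isd_eq_open _ (fun=> 0) 0 1 x0 _ _ x01 e1 (dP1 x0)); exact: isd_cst.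
exists (fun x => (ip w0 w0)^-1 * w0 x); split; first by cont.
  by rewrite ipZr// Pw0 mulVf.
by rewrite sol_1; [|by cont]; rewrite ipZl// w0id; lra.
Qed.

(* The curvature profile of a minimiser is [kap * P + nu * id]: the multiplier [kap]
   comes from the closing constraint, [nu] from the prescribed turning. *)
Lemma euler_lagrange : exists kap nu,
  (forall phi, continuous phi -> L phi = ip (fun x => kap * P x + nu * x) phi) /\
  (p < arc L 1 < q -> nu = 0).
Proof.
have [w [cw Pw w1]] := multiplier_direction.
have cid := @id_cont R.
have [LD LZ _] := aL.
have idw : ip id w = 0 by move: w1; rewrite sol_1// ipC; lra.
(* In the interior every direction orthogonal to [P] may be tested. At an end the direction must
   also preserve the turning, so its component along [id] is removed as well, and this produces the
   multiplier [nu]. *)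
have [int|nint] := boolP (p < arc L 1 < q).
  exists (L w), 0; split=> // phi cp.
  have cv : continuous (fun x => phi x + (- ip P phi) * w x) by cont.
  have : L (fun x => phi x + (- ip P phi) * w x) = 0.
    apply: (first_variation_eq0 cv cw) => //; last by right.
    by rewrite ipDr; [|by cont..]; rewrite ipZr// Pw; lra.
  rewrite LD; [|by cont..]; rewrite LZ//.
  by rewrite ipDl; [|by cont..]; rewrite (ipZl _ cp PC) (@ipZl _ 0 phi id)//; lra.
exists (L w), (3 * L id - 3 * L w * ip P id); split=> [phi cp|H]; last by [].
pose be := 3 * ip id phi; pose al := ip P phi - be * ip P id.
have cv : continuous (fun x => phi x + ((- al) * w x + (- be) * x)) by cont.
have : L (fun x => phi x + ((- al) * w x + (- be) * x)) = 0.
  apply: (first_variation_eq0 cv cw) => //.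
    rewrite ipDr; [|by cont..]; rewrite ipDr; [|by cont..].
    by rewrite ipZr// (@ipZr _ (- be) P id)// Pw /al; lra.
  left; rewrite sol_1// ipC ipDr; [|by cont..]; rewrite ipDr; [|by cont..].
  by rewrite ipZr// (@ipZr _ (- be) id id)// idw ip_id /be; lra.
rewrite LD; [|by cont..]; rewrite LD; [|by cont..]; rewrite LZ// (LZ (- be) id)//.
rewrite ipDl; [|by cont..]; rewrite (ipZl _ cp PC) (@ipZl _ _ phi id)//.
by rewrite /al /be; lra.
Qed.

End FirstVariation.

End EulerLagrange.

(** * Stationary phase and the window endpoints *)

Section StationaryPhase.
Variable R : realType.
Implicit Types (f g h u v w F U : R -> R) (x y z a b c d s t K : R).

Lemma isd_nondecreasing U u a b : a <= b ->
  (forall y, a <= y <= b -> isd U y (u y)) -> (forall y, a <= y <= b -> 0 <= u y) ->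
  U a <= U b.
Proof.
move=> ab Uu u0.
have [| |c] := @MVT_segment R U u a b ab.
- by move=> y; rewrite in_itv => /andP[ay yb]; apply: Uu; rewrite !ltW.
- apply: continuous_in_subspaceT => y; rewrite inE /= in_itv => aby.
  exact: isd_continuous (Uu y aby).
- rewrite in_itv => /= cab e; rewrite -subr_ge0 e mulr_ge0 ?subr_ge0//.
  exact: u0.
Qed.

Lemma sin_le z : 0 <= z -> sin z <= z.
Proof.
move=> z0; have := sin_lip 0 z; rewrite sin0 !subr0 (ger0_norm z0).
exact: le_trans (ler_norm _).
Qed.

Lemma cos_ge z : 1 - z ^+ 2 / 2 <= cos z.
Proof.
wlog z0 : z / 0 <= z.
  move=> H; case: (leP 0 z) => [/H//|z0]; rewrite -cosN -sqrrN; apply: H; lra.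
have := @isd_nondecreasing (fun t => cos t + t ^+ 2 / 2) (fun t => t - sin t) 0 z z0.
rewrite cos0 => H; suff : 1 + 0 ^+ 2 / 2 <= cos z + z ^+ 2 / 2 by lra.
apply: H => t /andP[t0 tz]; last by have := sin_le t0; lra.
by isd_by; lra.
Qed.

Lemma sin_ge z : 0 <= z -> z - z ^+ 3 / 6 <= sin z.
Proof.
move=> z0.
have := @isd_nondecreasing (fun t => sin t - t + t ^+ 3 / 6)
  (fun t => cos t - 1 + t ^+ 2 / 2) 0 z z0.
rewrite sin0 => H; suff : 0 - 0 + 0 ^+ 3 / 6 <= sin z - z + z ^+ 3 / 6 by lra.
apply: H => t /andP[t0 tz]; last by have := cos_ge t; lra.
by isd_by; lra.
Qed.

(** On [0, 1] the Taylor bound gives at least 83/200. Beyond 1, integration by parts with [1 - cos]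
    as primitive of the oscillating factor leaves a nonnegative remainder, so [U] increases and the
    tail loses at most [(1 - cos (3/2)) / 3 <= 3/8]. The difference is 1/25. *)
Lemma fresnel_sin_ge K : 1 <= K -> 1 / 25 <= integ (fun t => sin (3 / 2 * t ^+ 2)) 0 K.
Proof.
move=> K1; set f := fun t => _.
have cf : continuous f by rewrite /f; cont.
rewrite (integ_cat f 0 1 K).
have h1 : 83 / 200 <= integ f 0 1.
  have cg : continuous (fun t => 3 / 2 * t ^+ 2 - (3 / 2) ^+ 3 / 6 * t ^+ 6) by cont.
  apply: (@le_trans _ _ (integ (fun t => 3 / 2 * t ^+ 2 - (3 / 2) ^+ 3 / 6 * t ^+ 6) 0 1)).
    rewrite (@integ_FTC _ (fun t => 2^-1 * t ^+ 3 - (3 / 2) ^+ 3 / 42 * t ^+ 7)) //; first by lra.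
    by move=> t; isd_by; lra.
  apply: le_integ => // t /andP[t0 t1].
  apply: (le_trans _ (sin_ge _)); last by rewrite mulr_ge0 ?sqr_ge0//; lra.
  have -> : (3 / 2 * t ^+ 2) ^+ 3 = (3 / 2) ^+ 3 * t ^+ 6 by ring.
  lra.
pose U t := integ f 0 t - (1 - cos (3 / 2 * t ^+ 2)) * (3 * t)^-1.
have h2 : U 1 <= U K.
  have dF : der (fun t => integ f 0 t) f by exact: der_integ.
  apply: (@isd_nondecreasing _ (fun t => (1 - cos (3 / 2 * t ^+ 2)) / (3 * t ^+ 2))) => // y.
    move=> /andP[y1 yK]; have y0 : 3 * y != 0 by rewrite gt_eqF//; lra.
    have y0' : y != 0 by rewrite gt_eqF//; lra.
    have dI : isd (fun t => (3 * t)^-1) y (- (3 * y) ^- 2 * (0 * y + 3 * 1)).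
      by apply: isd_inv => //; repeat isd_step.
    by rewrite /U; isd_by; rewrite /f; field.
  move=> /andP[y1 yK]; apply: divr_ge0; first by have := cos_le1 (3 / 2 * y ^+ 2); lra.
  by rewrite mulr_ge0 ?sqr_ge0.
have e1 : integ f 0 K = integ f 0 1 + integ f 1 K := integ_cat f 0 1 K.
move: h2; rewrite /U e1.
have : 0 <= (1 - cos (3 / 2 * K ^+ 2)) * (3 * K)^-1.
  by apply: divr_ge0; [have := cos_le1 (3 / 2 * K ^+ 2); lra|lra].
have := cos_ge (3 / 2 * 1 ^+ 2); rewrite expr1n !mulr1.
have -> : (3^-1 : R) = 1 / 3 by lra.
by move: h1; lra.
Qed.

(** Here a single integration by parts leaves a remainder without sign; a second one, with [1 - cos]
    as primitive, leaves the nonnegative [(1 - cos) / (3 t^4)]. The assumption [3 <= K] bounds the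
    boundary term at [K] by 1/9. *)
Lemma fresnel_cos_ge K : 3 <= K -> 1 / 25 <= integ (fun t => cos (3 / 2 * t ^+ 2)) 0 K.
Proof.
move=> K3; have K1 : 1 <= K by lra.
set f := fun t => _.
have cf : continuous f by rewrite /f; cont.
rewrite (integ_cat f 0 1 K).
have h1 : 3 / 4 <= integ f 0 1.
  have cg : continuous (fun t => 1 - (3 / 2) ^+ 2 / 2 * t ^+ 4) by cont.
  apply: (@le_trans _ _ (integ (fun t => 1 - (3 / 2) ^+ 2 / 2 * t ^+ 4) 0 1)).
    rewrite (@integ_FTC _ (fun t => t - (3 / 2) ^+ 2 / 10 * t ^+ 5)) //; first by lra.
    by move=> t; isd_by; lra.
  apply: le_integ => // t /andP[t0 t1].
  apply: (le_trans _ (cos_ge _)).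
  have -> : (3 / 2 * t ^+ 2) ^+ 2 = (3 / 2) ^+ 2 * t ^+ 4 by ring.
  lra.
pose U t := integ f 0 t - sin (3 / 2 * t ^+ 2) * (3 * t)^-1
  - (1 - cos (3 / 2 * t ^+ 2)) * (9 * t ^+ 3)^-1.
have h2 : U 1 <= U K.
  have dF : der (fun t => integ f 0 t) f by exact: der_integ.
  apply: (@isd_nondecreasing _ (fun t => (1 - cos (3 / 2 * t ^+ 2)) / (3 * t ^+ 4))) => // y.
    move=> /andP[y1 yK]; have y0 : 3 * y != 0 by rewrite gt_eqF//; lra.
    have y0' : y != 0 by rewrite gt_eqF//; lra.
    have y03 : 9 * y ^+ 3 != 0 by rewrite mulf_neq0 ?expf_neq0.
    have dI : isd (fun t => (3 * t)^-1) y (- (3 * y) ^- 2 * (0 * y + 3 * 1)).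
      by apply: isd_inv => //; repeat isd_step.
    have dI3 : isd (fun t => (9 * t ^+ 3)^-1) y
        (- (9 * y ^+ 3) ^- 2 * (0 * y ^+ 3 + 9 * (3%:R * y ^+ 2 * 1))).
      by apply: isd_inv => //; repeat isd_step.
    by rewrite /U; isd_by; rewrite /f; field.
  move=> /andP[y1 yK]; apply: divr_ge0; first by have := cos_le1 (3 / 2 * y ^+ 2); lra.
  by rewrite mulr_ge0 ?exprn_ge0//; lra.
have e1 : integ f 0 K = integ f 0 1 + integ f 1 K := integ_cat f 0 1 K.
move: h2; rewrite /U e1 !expr1n !mulr1.
have : 0 <= (1 - cos (3 / 2 * K ^+ 2)) * (9 * K ^+ 3)^-1.
  apply: divr_ge0; first by have := cos_le1 (3 / 2 * K ^+ 2); lra.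
  by rewrite mulr_ge0 ?exprn_ge0//; lra.
have : - (1 / 9) <= sin (3 / 2 * K ^+ 2) * (3 * K)^-1.
  rewrite ler_pdivlMr; last by lra.
  by have := sin_geN1 (3 / 2 * K ^+ 2); lra.
have := cos_ge (3 / 2); have := sin_le1 (3 / 2 : R).
have -> : (3^-1 : R) = 1 / 3 by lra.
have -> : (9^-1 : R) = 1 / 9 by lra.
by move: h1; lra.
Qed.

Section OscillatoryIntegral.
Variables (w eta eta1 : R -> R) (b C K : R).
Hypotheses (deta : der eta eta1) (deta1 : der eta1 w) (cw : continuous w).
Hypotheses (eta0 : eta 0 = 0) (eta10 : eta1 0 = 0) (eta_1 : eta 1 = 0).
Hypothesis w2 : integ (fun y => w y ^+ 2) 0 1 <= C * b ^+ 4.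
Hypotheses (b0 : 0 < b) (C0 : 0 <= C) (K0 : 0 < K) (Kb : K <= b ^+ 2)
  (CK : C <= b ^+ 2 * K / 4).
(** [y] is the distance to the stationary point and [b^4] the turning. The bracket is the cubic
    [3/2 x - x^3 / 2] at [x = 1 - y], and [eta] is the deviation from it. *)
Let F y := b ^+ 4 * (1 - 3 / 2 * y ^+ 2 + 2^-1 * y ^+ 3) + eta y.
Let D y := b ^+ 4 * (- 3 * y + 3 / 2 * y ^+ 2) + eta1 y.
(** The phase [3/2 b^4 y^2] makes [b^-2] the width of the stationary zone; the integral is cut after
    [K] such widths. *)
Let Y := K / b ^+ 2.

Let ceta : continuous eta. Proof. exact: der_continuous deta. Qed.
Let ceta1 : continuous eta1. Proof. exact: der_continuous deta1. Qed.
Let cF : continuous F. Proof. by rewrite /F; cont. Qed.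
Let dF : der F D. Proof. by move=> y; rewrite /F; isd_by; rewrite /D; lra. Qed.
Let b20 : 0 < b ^+ 2. Proof. exact: exprn_gt0. Qed.
Let b40 : 0 < b ^+ 4. Proof. exact: exprn_gt0. Qed.
Let Y0 : 0 < Y. Proof. exact: divr_gt0. Qed.
Let Y1 : Y <= 1. Proof. by rewrite ler_pdivrMr// mul1r. Qed.
Let b4Y : b ^+ 4 * Y = b ^+ 2 * K.
Proof. by rewrite /Y; field; rewrite gt_eqF. Qed.

(** Young's inequality with a free weight [t], later [b^4 / 2], [b^2] or [b^3] according to the term
    that has to absorb the result. *)
Lemma integ_abs_w t y : 0 < t -> 0 <= y <= 1 ->
  integ (fun y => `|w y|) 0 y <= (y * t + C * b ^+ 4 / t) / 2.
Proof.
move=> t0 /andP[y0 y1].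
have cN : continuous (fun y => `|w y|) by cont.
have cw2 : continuous (fun y => w y ^+ 2) by cont.
have cc : continuous (fun y => t / 2 + (2 * t)^-1 * w y ^+ 2) by cont.
apply: (@le_trans _ _ (integ (fun y => t / 2 + (2 * t)^-1 * w y ^+ 2) 0 y)).
  apply: le_integ => // z _.
  rewrite -(@ler_pM2l _ (2 * t)); last by lra.
  have -> : 2 * t * (t / 2 + (2 * t)^-1 * w z ^+ 2) = t ^+ 2 + w z ^+ 2.
    by field; rewrite gt_eqF.
  have := sqr_ge0 (t - `|w z|); rewrite sqrrB -normrX (ger0_norm (sqr_ge0 (w z))).
  by rewrite -mulr_natl; lra.
rewrite integD; [|by cont..]; rewrite integ_cst integZ// subr0.
have i1 : 0 <= integ (fun y => w y ^+ 2) y 1 by apply: integ_ge0 => // z _; exact: sqr_ge0.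
have i2 := integ_cat (fun y => w y ^+ 2) 0 y 1.
have i3 : integ (fun y => w y ^+ 2) 0 y <= C * b ^+ 4 by move: w2; rewrite i2; lra.
have t20 : 0 <= (2 * t)^-1 by rewrite invr_ge0; lra.
have := ler_wpM2l t20 i3.
have -> : (2 * t)^-1 * (C * b ^+ 4) = C * b ^+ 4 / t / 2 by field; rewrite gt_eqF.
lra.
Qed.

Lemma eta1_le t y : 0 < t -> 0 <= y <= 1 -> `|eta1 y| <= (y * t + C * b ^+ 4 / t) / 2.
Proof.
move=> t0 /andP[y0 y1].
have -> : eta1 y = integ w 0 y by rewrite (integ_FTC _ _ deta1)// eta10 subr0.
apply: (le_trans (integ_abs cw y0)).
by apply: integ_abs_w => //; rewrite y0.
Qed.

(** The cubic alone has slope at least [3/2 b^4 y]. The deviation costs at most [b^4 y / 4 + C], and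
    [C <= b^2 K / 4 = b^4 Y / 4] is at most another [b^4 y / 4]. *)
Lemma phase_slope y : Y <= y <= 1 -> b ^+ 4 * y <= - D y.
Proof.
have Hb0 := b0; have HK0 := K0; have HC0 := C0; have HY0 := Y0; have HY1 := Y1; have Hb4 := b40; have Hb2 := b20.
move=> /andP[Yy y1]; have y0 : 0 < y := lt_le_trans Y0 Yy.
have t0 : 0 < b ^+ 4 / 2 by lra.
have := @eta1_le (b ^+ 4 / 2) y t0; rewrite y1 (ltW y0) => /(_ isT).
have -> : C * b ^+ 4 / (b ^+ 4 / 2) = 2 * C by field; rewrite gt_eqF.
have : b ^+ 4 * Y <= b ^+ 4 * y by rewrite ler_pM2l.
rewrite b4Y ler_norml => H /andP[H1 H2]; rewrite /D.
have : 0 <= b ^+ 4 * (y * (1 - y)) by rewrite mulr_ge0 ?mulr_ge0 ?(ltW b40)//; lra.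
by move: H H1 H2 CK; nra.
Qed.

(** Non-stationary phase: [cos F] is the derivative of [sin F / D] plus [sin F * D' / D^2], where
    [|D'| <= 3 b^4 + |w|] and [|D| >= b^4 y]. Adding a primitive of the resulting majorant to plus
    or minus the error makes [V s] nondecreasing for both signs [s]. The boundary term at 1 vanishes
    because [F 1 = 0]. *)
Lemma far_integral : `|integ (fun y => cos (F y)) Y 1| <=
  (4 / K + (1 + C) / (2 * K ^+ 2)) / b ^+ 2.
Proof.
have Hb0 := b0; have HK0 := K0; have HC0 := C0; have HY0 := Y0; have HY1 := Y1; have Hb4 := b40; have Hb2 := b20.
have cN : continuous (fun y => `|w y|) by cont.
have ccos : continuous (fun y => cos (F y)) by cont.
pose k := (b ^+ 4 * Y) ^- 2.
have k0 : 0 <= k by rewrite invr_ge0 sqr_ge0.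
have dI : der (fun y => integ (fun y => cos (F y)) Y y) (fun y => cos (F y)) by exact: der_integ.
have dW : der (fun y => integ (fun y => `|w y|) Y y) (fun y => `|w y|) by exact: der_integ.
pose V s y := s * (integ (fun y => cos (F y)) Y y - sin (F y) * (D y)^-1)
  + (- 3 / b ^+ 4 * y^-1 + k * integ (fun y => `|w y|) Y y).
have dD : der D (fun y => b ^+ 4 * (3 * y - 3) + w y).
  by move=> y; rewrite /D; isd_by; lra.
have mono s : s ^+ 2 = 1 -> V s Y <= V s 1.
  move=> s2; apply: (@isd_nondecreasing _ (fun y =>
     s * (sin (F y) * (b ^+ 4 * (3 * y - 3) + w y) * (D y) ^- 2) +
      (3 / b ^+ 4 * y ^- 2 + k * `|w y|))) => // y Yy1.
    have yp : 0 < y by case/andP: Yy1 => Yy _; exact: lt_le_trans Y0 Yy.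
    have y0 : y != 0 by rewrite gt_eqF.
    have Dy : D y != 0.
      suff Dn : D y < 0 by rewrite lt_eqF.
      by have := phase_slope Yy1; have := mulr_gt0 Hb4 yp; lra.
    have dDi : isd (fun y => (D y)^-1) y (- (D y) ^- 2 * (b ^+ 4 * (3 * y - 3) + w y)).
      exact: isd_inv.
    have dyi : isd (fun y => y^-1) y (- y ^- 2 * 1) by apply: isd_inv => //; exact: isd_id.
    by rewrite /V; isd_by; field; rewrite ?Dy ?y0 ?gt_eqF.
  have /andP[Yy y1] := Yy1; have y0 : 0 < y := lt_le_trans Y0 Yy.
  have := phase_slope Yy1 => sl.
  have b4y : 0 < b ^+ 4 * y by rewrite mulr_gt0.
  have D2 : (b ^+ 4 * y) ^+ 2 <= D y ^+ 2 by nra.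
  have D2V : (D y) ^- 2 <= (b ^+ 4 * y) ^- 2.
    have p1 : 0 < (b ^+ 4 * y) ^+ 2 by exact: exprn_gt0.
    by rewrite lef_pV2 ?posrE//; exact: lt_le_trans D2.
  have kV : (b ^+ 4 * y) ^- 2 <= k.
    have p1 : 0 < (b ^+ 4 * y) ^+ 2 by exact: exprn_gt0.
    have p2 : 0 < b ^+ 4 * Y by exact: mulr_gt0.
    have p3 : b ^+ 4 * Y <= b ^+ 4 * y by rewrite ler_pM2l.
    by rewrite /k lef_pV2 ?posrE ?exprn_gt0//; nra.
  have main : `|s * (sin (F y) * (b ^+ 4 * (3 * y - 3) + w y) * (D y) ^- 2)| <=
      3 / b ^+ 4 * y ^- 2 + k * `|w y|.
    rewrite !normrM.
    have -> : `|s| = 1 by apply/eqP; rewrite -sqrp_eq1// real_normK ?num_real// s2.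
    rewrite mul1r; apply: (@le_trans _ _ ((3 * b ^+ 4 + `|w y|) * (b ^+ 4 * y) ^- 2)).
      rewrite normrV ?unitfE ?expf_neq0//; last first.
        by rewrite lt_eqF//; nra.
      rewrite (ger0_norm (sqr_ge0 _)).
      apply: ler_pM => //; first by rewrite invr_ge0 sqr_ge0.
      rewrite -[leRHS]mul1r; apply: ler_pM => //; first exact: sin_max.
      apply: (le_trans (ler_normD _ _)); rewrite lerD2r normrM gtr0_norm//.
      by rewrite mulrC ler_pM2r// ler_norml; lra.
    rewrite mulrDl; apply: lerD.
      by rewrite le_eqVlt; apply/orP; left; apply/eqP; field; rewrite ?gt_eqF.
    by rewrite mulrC ler_wpM2r.
  by move: main; rewrite ler_norml => /andP[]; lra.
have F1 : sin (F 1) = 0.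
  have F10 : F 1 = 0 by rewrite /F eta_1 !expr1n; lra.
  by rewrite F10 sin0.
have W : integ (fun y => `|w y|) Y 1 <= (1 + C) * b ^+ 2 / 2.
  have := @integ_abs_w (b ^+ 2) 1 b20; rewrite ler01 lexx => /(_ isT).
  have := integ_cat (fun y => `|w y|) 0 Y 1.
  have : 0 <= integ (fun y => `|w y|) 0 Y by apply: integ_ge0 => // ; exact: ltW.
  have -> : C * b ^+ 4 / b ^+ 2 = C * b ^+ 2 by field; rewrite gt_eqF.
  lra.
have kW := ler_wpM2l k0 W.
have DY : `|sin (F Y) * (D Y)^-1| <= (b ^+ 4 * Y)^-1.
  have sl : b ^+ 4 * Y <= - D Y by apply: phase_slope; rewrite lexx.
  have p : 0 < b ^+ 4 * Y by rewrite mulr_gt0.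
  rewrite normrM -[leRHS]mul1r; apply: ler_pM => //; first exact: sin_max.
  rewrite normfV lef_pV2 ?posrE//; last by rewrite normr_gt0 lt_eqF//; lra.
  by rewrite ltr0_norm//; lra.
have e1 : (4 / K + (1 + C) / (2 * K ^+ 2)) / b ^+ 2 =
   (b ^+ 4 * Y)^-1 + 3 / b ^+ 4 * Y^-1 + k * ((1 + C) * b ^+ 2 / 2).
  by rewrite /k /Y; field; rewrite !gt_eqF.
have s1 : (1 : R) ^+ 2 = 1 by rewrite expr1n.
have s2 : (-1 : R) ^+ 2 = 1 by rewrite sqrrN expr1n.
have b4i : 0 < 3 / b ^+ 4 by rewrite divr_gt0.
have := mono _ s1; have := mono _ s2; rewrite /V !integ_xx F1 mul0r subr0 invr1 e1.
move: DY; rewrite !ler_norml => /andP[? ?] ? ?; apply/andP; split; lra.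
Qed.

(** In the stationary zone the cubic term of the phase and [eta] are uniformly small and the cosine
    is 1-Lipschitz; the length [Y] of the zone supplies the factor [1 / b^2]. *)
Lemma near_integral :
  `|integ (fun y => cos (F y)) 0 Y - integ (fun y => cos (b ^+ 4 - 3 / 2 * b ^+ 4 * y ^+ 2)) 0 Y|
   <= (K ^+ 4 / (2 * b ^+ 2) + K ^+ 2 * (K + C) / (2 * b)) / b ^+ 2.
Proof.
have Hb0 := b0; have HK0 := K0; have HC0 := C0; have HY0 := Y0; have HY1 := Y1; have Hb4 := b40; have Hb2 := b20.
rewrite -integB; [|by cont..].
have -> : (K ^+ 4 / (2 * b ^+ 2) + K ^+ 2 * (K + C) / (2 * b)) / b ^+ 2 =
   (b ^+ 4 * Y ^+ 3 / 2 + (K + C) * b / 2 * Y) * (Y - 0).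
  by rewrite /Y subr0; field; rewrite gt_eqF.
apply: integ_abs_le; [by cont|exact: ltW|move=> y /andP[y0 yY]].
apply: (le_trans (cos_lip _ _)).
have -> : F y - (b ^+ 4 - 3 / 2 * b ^+ 4 * y ^+ 2) = b ^+ 4 * y ^+ 3 / 2 + eta y.
  by rewrite /F; lra.
apply: (le_trans (ler_normD _ _)); apply: lerD.
  rewrite ger0_norm; last by rewrite divr_ge0// mulr_ge0 ?exprn_ge0// ltW.
  by rewrite ler_pM2r ?invr_gt0// ler_pM2l// lerXn2r// ?nnegrE// ltW.
have -> : eta y = integ eta1 0 y by rewrite (integ_FTC _ _ deta)// eta0 subr0.
apply: (@le_trans _ _ ((K + C) * b / 2 * (y - 0))); last first.
  by rewrite subr0 ler_wpM2l// divr_ge0// mulr_ge0 ?ltW//; lra.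
apply: integ_abs_le => // z /andP[z0 zy].
have b30 : 0 < b ^+ 3 by exact: exprn_gt0.
have := @eta1_le (b ^+ 3) z b30; rewrite z0 => /(_ _)/le_trans; apply; first by lra.
have -> : C * b ^+ 4 / b ^+ 3 = C * b by field; rewrite gt_eqF.
have -> : (K + C) * b / 2 = (Y * b ^+ 3 + C * b) / 2.
  by rewrite /Y; field; rewrite gt_eqF.
by rewrite ler_pM2r ?invr_gt0// lerD2r ler_pM2r//; lra.
Qed.

Lemma oscillatory_integral :
  `|b ^+ 2 * integ (fun y => cos (F y)) 0 1
     - integ (fun t => cos (b ^+ 4 - 3 / 2 * t ^+ 2)) 0 K| <=
  4 / K + (1 + C) / (2 * K ^+ 2) + (K ^+ 4 / (2 * b ^+ 2) + K ^+ 2 * (K + C) / (2 * b)).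
Proof.
have cg : continuous (fun t => cos (b ^+ 4 - 3 / 2 * t ^+ 2)) by cont.
have := @integ_affine _ (fun t => cos (b ^+ 4 - 3 / 2 * t ^+ 2)) (b ^+ 2) 0 0 Y _ cg.
rewrite gt_eqF// => /(_ isT); rewrite mulr0 !addr0.
have -> : b ^+ 2 * Y = K by rewrite /Y; field; rewrite gt_eqF.
have -> : (fun x => cos (b ^+ 4 - 3 / 2 * (b ^+ 2 * x + 0) ^+ 2)) =
    (fun y => cos (b ^+ 4 - 3 / 2 * b ^+ 4 * y ^+ 2)).
  by apply/funext => y; congr cos; ring.
move=> e; have := near_integral; rewrite e; have := far_integral.
rewrite (integ_cat _ 0 Y 1).
set A := integ _ 0 Y; set B := integ _ Y 1; set G := integ _ 0 K.
move: (4 / K + _) (_ / (2 * b ^+ 2) + _) => x1 x2 h1 h2.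
have -> : b ^+ 2 * (A + B) - G = b ^+ 2 * B + b ^+ 2 * (A - (b ^+ 2)^-1 * G).
  by field; rewrite gt_eqF.
apply: (le_trans (ler_normD _ _)); apply: lerD; rewrite normrM (gtr0_norm b20) mulrC.
  by rewrite -ler_pdivlMr.
by rewrite -ler_pdivlMr.
Qed.

End OscillatoryIntegral.

End StationaryPhase.

(** * Sign of the closing integral for nearly cubic profiles *)

Section DefectSign.
Variable R : realType.
Implicit Types (f g h u v w : R -> R) (x y z a b c d s t p q K : R).
Implicit Types (L : (R -> R) -> R).

(* For large turning [Phi] such a profile is close to a cubic, and the closing integral is
   dominated by the stationary phase at [x = 1], where its sign can be read off. *)
Lemma defect_sign C : 0 <= C -> exists2 Phi0, 1 <= Phi0 & forall Phi v s, Phi0 <= Phi ->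
  continuous v -> sol v 1 = Phi -> ip v v <= 3 * Phi ^+ 2 + C * Phi -> s ^+ 2 = 1 ->
  sin Phi = s \/ cos Phi = s -> 0 < s * integ (fun x => cos (sol v x)) 0 1.
Proof.
(* [K] makes each of the two far-zone errors at most 1/200, and [B], a lower bound for the fourth
   root of the turning, does so for the two near-zone errors. Their sum 1/50 is below the Fresnel
   bound 1/25. *)
move=> C0; pose K := 800 + 100 * C; have K8 : 800 <= K by rewrite /K; lra.
pose B := 100 * K ^+ 4 + 100 * (K ^+ 2 * (K + C)) + 1.
have K0 : 0 < K by lra.
have K4 : 0 < K ^+ 4 by exact: exprn_gt0.
have K2 : 0 < K ^+ 2 * (K + C) by rewrite mulr_gt0 ?exprn_gt0//; lra.
have B1 : 1 <= B by rewrite /B; lra.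
exists (B ^+ 4) => [|Phi v s PhiB cv v1 vv s2 sc]; first exact: exprn_ege1.
have Phi0 : 0 <= Phi by apply: le_trans PhiB; apply: exprn_ge0; lra.
pose b := Num.sqrt (Num.sqrt Phi).
have b4 : b ^+ 4 = Phi by rewrite (exprM b 2 2) !sqr_sqrtr ?sqrtr_ge0.
have bB : B <= b.
  have bge0 : 0 <= b by exact: sqrtr_ge0.
  by rewrite -(@ler_pXn2r _ 4) ?nnegrE//; [rewrite b4|lra].
have b1 : 1 <= b := le_trans B1 bB.
have b0 : 0 < b := lt_le_trans ltr01 b1.
have bb : b <= b ^+ 2 by rewrite expr2 ler_peMl//; lra.
pose eta y := sol v (1 - y) - Phi * (1 - 3 / 2 * y ^+ 2 + 2^-1 * y ^+ 3).
pose eta1 y := - sol1 v (1 - y) - Phi * (- 3 * y + 3 / 2 * y ^+ 2).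
pose w y := v (1 - y) + Phi * (3 * (1 - y)).
have dv := der_sol cv; have dv1 := der_sol1 cv.
have cw : continuous w by rewrite /w; cont.
have deta : der eta eta1 by move=> y; rewrite /eta; isd_by; rewrite /eta1; field.
have deta1 : der eta1 w by move=> y; rewrite /eta1; isd_by; rewrite /w; field.
have eta0 : eta 0 = 0 by rewrite /eta subr0 v1; field.
have eta10 : eta1 0 = 0 by rewrite /eta1 subr0 sol1_1; field.
have eta_1 : eta 1 = 0 by rewrite /eta subrr sol_0 !expr1n; field.
(* The energy excess controls the deviation: as [ip v id = - Phi], the squared norm of
   [v + 3 Phi id] is [ip v v - 3 Phi^2]. *)
have w2 : integ (fun y => w y ^+ 2) 0 1 <= C * b ^+ 4.
  have cid := @id_cont R.
  have c3 : continuous (fun x => v x + 3 * Phi * x) by cont.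
  have := @integ_affine R (fun x => (v x + 3 * Phi * x) ^+ 2) (-1) 1 0 1.
  rewrite oppr_eq0 oner_eq0 => /(_ isT (exp_cont (n := 2) c3)).
  have -> : (fun x => (v (-1 * x + 1) + 3 * Phi * (-1 * x + 1)) ^+ 2) = (fun y => w y ^+ 2).
    apply/funext => x; rewrite /w; congr (_ ^+ 2).
    have e : -1 * x + 1 = 1 - x by ring.
  by rewrite e; field.
  rewrite mulr0 add0r mulr1 addNr (integ_swap _ 1 0) => ->.
  have -> : integ (fun x => (v x + 3 * Phi * x) ^+ 2) 0 1 =
      ip (fun x => v x + 3 * Phi * x) (fun x => v x + 3 * Phi * x) by [].
  rewrite ipDl; [|by cont..]; rewrite !ipDr; [|by cont..].
  rewrite (@ipZl _ (3 * Phi) v id)// (@ipZr _ (3 * Phi) v id)//.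
  rewrite (@ipZl _ (3 * Phi) _ id)//; last by cont.
  rewrite (@ipZr _ (3 * Phi) id id)// ip_id (ipC id v).
  have -> : ip v id = - Phi by have := sol_1 cv; rewrite v1; clear; lra.
  by rewrite b4 invrN1; move: vv; clear; lra.
have Kb : K <= b ^+ 2.
  apply: le_trans bb; apply: le_trans bB; rewrite /B.
  have : K <= K ^+ 4 by rewrite -[leLHS]expr1 ler_eXn2l//; move: K8; clear; lra.
  by move: K4 K2; clear; lra.
have CK : C <= b ^+ 2 * K / 4.
  have : K <= b ^+ 2 * K by rewrite ler_peMl ?(ltW K0)//; exact: le_trans bb.
  by rewrite /K; lra.
have := oscillatory_integral deta deta1 cw eta0 eta10 eta_1 w2 b0 C0 K0 Kb CK.
have -> : integ (fun y => cos (b ^+ 4 * (1 - 3 / 2 * y ^+ 2 + 2^-1 * y ^+ 3) + eta y)) 0 1 =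
    integ (fun x => cos (sol v x)) 0 1.
  have csol : continuous (sol v) := sol_cont cv.
  have cc : continuous (fun x => cos (sol v x)) by cont.
  have := @integ_affine R (fun x => cos (sol v x)) (-1) 1 0 1.
  rewrite oppr_eq0 oner_eq0 => /(_ isT cc); rewrite mulr0 add0r mulr1 addNr (integ_swap _ 1 0) invrN1.
  rewrite mulrNN mul1r => <-.
  congr (integ _ 0 1); apply/funext => y; congr cos; rewrite b4 /eta.
  have e : -1 * y + 1 = 1 - y by ring.
  by rewrite e; field.
set I := integ _ 0 1; rewrite b4.
have E1 : 4 / K <= 1 / 200 by rewrite ler_pdivrMr//; move: K8; clear; lra.
have E2 : (1 + C) / (2 * K ^+ 2) <= 1 / 200.
  rewrite ler_pdivrMr ?mulr_gt0 ?exprn_gt0//.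
  have : 800 * K <= K ^+ 2 by rewrite expr2 ler_pM2r.
  by move: C0 K8; rewrite /K; clear; lra.
have E3 : K ^+ 4 / (2 * b ^+ 2) <= 1 / 200.
  rewrite ler_pdivrMr ?mulr_gt0 ?exprn_gt0//.
  by move: bB bb K4 K2 b1; rewrite /B; clear; lra.
have E4 : K ^+ 2 * (K + C) / (2 * b) <= 1 / 200.
  rewrite ler_pdivrMr ?mulr_gt0 ?exprn_gt0//.
  by move: bB K4 K2 b1; rewrite /B; clear; lra.
have b2 : 0 < b ^+ 2 by exact: exprn_gt0.
have fin J : `|b ^+ 2 * I - s * J| <= 4 / K + (1 + C) / (2 * K ^+ 2) +
    (K ^+ 4 / (2 * b ^+ 2) + K ^+ 2 * (K + C) / (2 * b)) -> 1 / 25 <= J -> 0 < s * I.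
  move=> H J1; rewrite -(pmulr_rgt0 _ b2).
  have : `|b ^+ 2 * I - s * J| <= 1 / 50.
    by apply: (le_trans H); move: E1 E2 E3 E4; clear; lra.
  have /eqP : (s - 1) * (s + 1) = 0 by rewrite -(subr_sqr_1 s) s2 subrr.
  have -> : b ^+ 2 * (s * I) = s * (b ^+ 2 * I) by ring.
  move: J1; rewrite mulf_eq0 subr_eq0 addr_eq0 ler_norml; move: (b ^+ 2 * I) => x.
  by move=> + /orP[] /eqP -> => + /andP[]; clear; lra.
(* When one of sine and cosine of [Phi] is the sign [s] the other is 0, so [cos (Phi - r)] is [s]
   times [sin r] or [cos r]. *)
case: sc => e.
- have c0 : cos Phi = 0.
    by apply: sin1cos0; rewrite e; apply/eqP; rewrite -sqrp_eq1// real_normK ?num_real// s2.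
  have -> : integ (fun t => cos (Phi - 3 / 2 * t ^+ 2)) 0 K =
      s * integ (fun t => sin (3 / 2 * t ^+ 2)) 0 K.
    rewrite -integZ; last by cont.
    by congr (integ _ 0 K); apply/funext => t; rewrite cosB c0 e; ring.
  by move=> /fin; apply; apply: fresnel_sin_ge; move: K8; clear; lra.
- have c0 : sin Phi = 0.
    by apply: cos1sin0; rewrite e; apply/eqP; rewrite -sqrp_eq1// real_normK ?num_real// s2.
  have -> : integ (fun t => cos (Phi - 3 / 2 * t ^+ 2)) 0 K =
      s * integ (fun t => cos (3 / 2 * t ^+ 2)) 0 K.
    rewrite -integZ; last by cont.
    by congr (integ _ 0 K); apply/funext => t; rewrite cosB c0 e; ring.
  by move=> /fin; apply; apply: fresnel_cos_ge; move: K8; clear; lra.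
Qed.

End DefectSign.

(** * Minimisers turning strictly inside the window *)

Section WindowMinimiser.
Variable R : realType.
Implicit Types (f g h u v w : R -> R) (x y z a b c d s t p q K : R).
Implicit Types (L : (R -> R) -> R).

Lemma defect_ip v : continuous v ->
  defect (ip v) = integ (fun x => cos (sol v x)) 0 1.
Proof.
move=> cv; have c1 := arc_cont (energy_functional_ip cv); have c2 := sol_cont cv.
apply: eq_integ => //; [by cont|by cont|].
by move=> x x01; rewrite /arc ip_kernel.
Qed.

Lemma ip_cubic Phi : ip (fun x => -3 * Phi * x) (fun x => -3 * Phi * x) = 3 * Phi ^+ 2.
Proof.
have cid := @id_cont R.
rewrite (@ipZl _ (-3 * Phi) _ id)//; last by cont.
by rewrite (@ipZr _ (-3 * Phi) id id)// ip_id; lra.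
Qed.

Lemma sol_cubic Phi : sol (fun x => -3 * Phi * x) 1 = Phi.
Proof.
have cid := @id_cont R; rewrite sol_1; last by cont.
by rewrite (@ipZl _ (-3 * Phi) id id)// ip_id; lra.
Qed.

Lemma window_minimiser : exists2 Phi0, 1 <= Phi0 & forall p s, Phi0 <= p -> s ^+ 2 = 1 ->
  sin p = s -> exists kap u, let v := fun x => kap * sol u x in
    [/\ continuous u, forall x, 0 <= x <= 1 -> u x = sin (sol v x),
        p < sol v 1 < p + pi / 2, integ (fun x => cos (sol v x)) 0 1 = 0 &
        forall d' L', competitor p (p + pi / 2) d' L' -> ip v v <= d'].
Proof.
(* A cubic turning by at most [p + 2] has energy at most [3 (p + 2)^2], which is below
   [3 p^2 + 24 p] for [p >= 1]. *)
have C0 : 0 <= 24 :> R by [].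
have [Phi1 Phi11 sgn] := defect_sign C0.
exists (Phi1 + 2) => [|p s pPhi s2 sp]; first by lra.
have pi2 := pihalf_lt2 R; have pi1 := pihalf_ge1 R.
pose q := p + pi / 2.
have sq : cos q = - s by rewrite cosDpihalf sp.
pose vc Phi x := -3 * Phi * x.
have cvc Phi : continuous (vc Phi) by rewrite /vc; cont.
pose I Phi := integ (fun x => cos (sol (vc Phi) x)) 0 1.
have Ip : 0 < s * I p.
  apply: (sgn p) => //; [by lra|exact: sol_cubic|by rewrite ip_cubic; lra|by left].
have Iq : 0 < (- s) * I q.
  apply: (sgn q) => //; [by rewrite /q; lra|exact: sol_cubic|by rewrite ip_cubic; rewrite /q; lra|by rewrite sqrrN|by right].
have IC : continuous I.
  move=> P0; apply/continuous_absP => e e0; exists (e / 2); first by lra.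
  move=> P PP.
  have c1 := sol_cont (cvc P); have c0 := sol_cont (cvc P0).
  rewrite /I -integB; [|by cont..].
  apply: (@le_lt_trans _ _ (`|P - P0| * 1 * (1 - 0))); last by lra.
  apply: integ_abs_le => //; first by cont.
  move=> x x01; apply: (le_trans (cos_lip _ _)).
  rewrite -!ip_kernel//.
  have E Q : ip (vc Q) (kernel x) = Q * ip (vc 1) (kernel x).
    have ck := @kernel_cont R x; rewrite -ipZl//; congr (integ _ 0 1).
    by apply/funext => y; rewrite /vc; lra.
  rewrite E (E P0) -mulrBl normrM ler_wpM2l// ip_kernel//.
  have [x0 x1] := andP x01.
  have dS : der (sol (vc 1)) (sol1 (vc 1)) := der_sol (cvc 1).
  have dG : der (fun x => 3 / 2 * x - 2^-1 * x ^+ 3) (sol1 (vc 1)).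
    have d1 := der_sol1 (cvc 1).
    have d2 : der (fun x => 3 / 2 - 3 / 2 * x ^+ 2) (vc 1).
      by move=> y; isd_by; rewrite /vc; lra.
    have e1 y : sol1 (vc 1) y = 3 / 2 - 3 / 2 * y ^+ 2.
      by have := der_diff_cst d1 d2 y 1; rewrite sol1_1 expr1n; lra.
    by move=> y; rewrite e1; isd_by; lra.
  have := der_diff_cst dS dG x 0; rewrite sol_0 => e1.
  have -> : sol (vc 1) x = 3 / 2 * x - 2^-1 * x ^+ 3 by move: e1; rewrite expr0n /=; lra.
  rewrite ler_norml; have := sqr_ge0 (x - 1).
  have : 0 <= x * (1 - x ^+ 2) by rewrite mulr_ge0// subr_ge0 expr_le1.
  nra.
have [Phis Phisin Is] : exists2 P, P \in `[p, q] & I P = 0.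
  apply: (@IVT R I p q) => //; [by rewrite /q; lra|exact: continuous_subspaceT|].
  have /eqP : (s - 1) * (s + 1) = 0 by rewrite -(subr_sqr_1 s) s2 subrr.
  rewrite mulf_eq0 subr_eq0 addr_eq0 => /orP[] /eqP e; move: Ip Iq; rewrite e => *;
    rewrite ge_min le_max; apply/andP; split; apply/orP; (left; lra) || (right; lra).
move: Phisin; rewrite in_itv /= => /andP[Pp Pq].
have Pq' : Phis < q.
  rewrite lt_neqAle Pq andbT; apply/eqP => e; move: Iq; rewrite -e Is mulr0 ltxx//.
have comp0 : competitor p q (3 * Phis ^+ 2) (ip (vc Phis)).
  split; first by rewrite -ip_cubic; exact: (energy_functional_ip (cvc Phis)).
    by rewrite /arc ip_kernel ?lexx ?ler01// sol_cubic Pp.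
  by rewrite defect_ip.
have [M [L [cL minL]]] := competitor_min comp0.
have MP := minL _ _ comp0.
have [aL /andP[pL Lq] dL] := cL.
have lb := energy_functional_lb aL.
have cA := arc_cont aL.
(* The arc runs from 0 to at least [p > pi / 2], so strictly inside it takes the value [pi / 2],
   where the sine is 1. *)
have nf : exists2 x, 0 < x < 1 & sin (arc L x) != 0.
  have a0 := arc_0 aL.
  have [|||x x01 ex] := @IVT R (arc L) 0 1 (pi / 2).
  - exact: ler01.
  - exact: continuous_subspaceT.
  - rewrite a0; apply/andP; split; first by rewrite ge_min; apply/orP; left; lra.
    by rewrite le_max; apply/orP; right; lra.
  exists x; last by rewrite ex sin_pihalf oner_neq0.
  move: x01; rewrite in_itv /= !lt_neqAle => /andP[-> ->]; rewrite !andbT.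
  apply/andP; split; apply/eqP => e; first by move: ex; rewrite -e a0; lra.
  by move: ex; rewrite e; lra.
have [kap [nu [EL int]]] := euler_lagrange cL minL nf.
set u := (fun x : R => sin (arc L x)) in EL.
have cu : continuous u by rewrite /u; cont.
have csu := sol_cont cu.
pose v0 x := kap * sol u x + nu * x.
have cv0 : continuous v0 by rewrite /v0; cont.
have arcE x : 0 <= x <= 1 -> arc L x = sol v0 x.
  by move=> x01; rewrite /arc EL; [exact: ip_kernel|exact: kernel_cont].
have v01 : sol v0 1 = arc L 1 by rewrite arcE ?lexx ?ler01.
have defv0 : integ (fun x => cos (sol v0 x)) 0 1 = 0.
  rewrite -[RHS]dL /defect; have cs := sol_cont cv0.
  by apply: eq_integ => //; [by cont|by cont|move=> x x01; rewrite arcE].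
have vM : ip v0 v0 <= M by have [_ _ /(_ _ cv0)] := aL; rewrite EL//; lra.
(* At [q] the energy would be at least [3 q^2], more than the [3 Phis^2] of the closing cubic. *)
have Lq' : arc L 1 < q.
  rewrite lt_neqAle Lq andbT; apply/eqP => e; move: lb; rewrite e.
  have : 0 < (q - Phis) * (q + Phis) by rewrite mulr_gt0//; lra.
  by nra.
(* Thanks to the multiplier [nu], the second derivative [v0] is continuous even if the turning is
   [p]. Its energy is within [24 p] of [3 p^2], so the closing integral would have a strict sign. *)
have pL' : p < arc L 1.
  rewrite lt_neqAle pL andbT; apply/eqP => e.
  suff : 0 < s * integ (fun x => cos (sol v0 x)) 0 1 by rewrite defv0 mulr0 ltxx.
  apply: (sgn p) => //; [by lra|by rewrite v01| |by left].
  apply: (le_trans vM); apply: (le_trans MP).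
  have : Phis ^+ 2 <= (p + 2) ^+ 2 by rewrite ler_sqr ?nnegrE; move: Pp Pq pi2 pPhi Phi11; rewrite /q; clear; lra.
  by move: pPhi Phi11; clear; nra.
have nu0 : nu = 0 by apply: int; rewrite pL' Lq'.
have v0E : v0 = (fun x => kap * sol u x) by apply/funext => x; rewrite /v0 nu0 mul0r addr0.
exists kap, u; rewrite /= -v0E; split=> //.
- by move=> x x01; rewrite /u arcE.
- by rewrite v01 pL' Lq'.
- by move=> d' L' /minL; exact: le_trans.
Qed.

End WindowMinimiser.

(** * The profile and the reconstructed curve *)

Section TriangleWave.
Variable R : realType.
Implicit Types (x y : R) (m : int).

Definition wave_index x : int := Num.floor ((x + 1) / 4).

(* The 4-periodic function with [wave x = x] on [-1, 1] and [wave (2 - x) = wave x]. *)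
Definition wave x : R := 1 - `|x - 1 - 4 * (wave_index x)%:~R|.

Lemma wave_index_le x : `|x - 1 - 4 * (wave_index x)%:~R| <= 2.
Proof.
have := floor_itv ((x + 1) / 4); rewrite -/(wave_index x).
by rewrite intrD (mulr1z 1) => /andP[h1 h2]; rewrite ler_norml; lra.
Qed.

Lemma int_far m n : m != n -> 1 <= `|m%:~R - n%:~R| :> R.
Proof.
move=> mn; rewrite -intrB -intr_norm -[leLHS]/(1%:~R) ler_int.
by rewrite -gtz0_ge1 normr_gt0 subr_eq0.
Qed.

Lemma wave_index_far m x : m != wave_index x ->
  4 - `|x - 1 - 4 * (wave_index x)%:~R| <= `|x - 1 - 4 * m%:~R|.
Proof.
move=> mk; have := int_far mk; set a := m%:~R; set b := (wave_index x)%:~R => ab.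
have := ler_normB (x - 1 - 4 * b) (x - 1 - 4 * a).
have -> : x - 1 - 4 * b - (x - 1 - 4 * a) = 4 * (a - b) by ring.
by rewrite normrM (@ger0_norm _ 4)//; lra.
Qed.

(** [wave] is the maximum over [m] of the tents [1 - |x - 1 - 4 m|], which is why it is
    Lipschitz. *)
Lemma wave_ge m x : 1 - `|x - 1 - 4 * m%:~R| <= wave x.
Proof.
rewrite /wave; have [->//|mk] := eqVneq m (wave_index x).
by have := wave_index_far mk; have := wave_index_le x; lra.
Qed.

Lemma waveE m x : `|x - 1 - 4 * m%:~R| <= 2 -> wave x = 1 - `|x - 1 - 4 * m%:~R|.
Proof.
move=> h; rewrite /wave; have [->//|mk] := eqVneq m (wave_index x).
by have := wave_index_far mk; have := wave_index_le x; lra.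
Qed.

Lemma wave_lip x y : `|wave y - wave x| <= `|y - x|.
Proof.
have key a b : wave a - `|a - b| <= wave b.
  apply: le_trans (wave_ge (wave_index a) b); rewrite /wave.
  have := ler_normD (b - a) (a - 1 - 4 * (wave_index a)%:~R).
  have -> : b - a + (a - 1 - 4 * (wave_index a)%:~R) = b - 1 - 4 * (wave_index a)%:~R by ring.
  by rewrite (distrC b a); lra.
by rewrite ler_norml; have := key x y; have := key y x; rewrite (distrC x y); lra.
Qed.

Lemma wave_cont : continuous wave.
Proof.
move=> x; apply/continuous_absP => e e0; exists e => // y yx.
exact: le_lt_trans (wave_lip x y) yx.
Qed.

Lemma wave_id x : -1 <= x <= 1 -> wave x = x.
Proof.
move=> /andP[h1 h2]; have e : `|x - 1 - 4 * (0%:~R)| = 1 - x.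
  by rewrite ler0_norm; rewrite ?mulr0; lra.
by rewrite (@waveE 0) e; lra.
Qed.

Lemma wave_sym x : wave (2 - x) = wave x.
Proof.
have e : `|2 - x - 1 - 4 * (- wave_index x)%:~R| = `|x - 1 - 4 * (wave_index x)%:~R|.
  by rewrite -normrN; congr `| _ |; rewrite mulrNz; ring.
by rewrite (@waveE (- wave_index x)) e// wave_index_le.
Qed.

Lemma wave_cases x : exists (w : R) m, [/\ -2 <= w <= 2, x = 1 + w + 4 * m%:~R &
  wave x = 1 - `|w|].
Proof.
exists (x - 1 - 4 * (wave_index x)%:~R), (wave_index x); split=> //; last by ring.
by have := wave_index_le x; rewrite ler_norml.
Qed.

Lemma waveN x : wave (- x) = - wave x.
Proof.
have [w [m [/andP[w1 w2] xE ->]]] := wave_cases x.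
case: (ger0P w) => w0.
- have e : `|- x - 1 - 4 * (- m - 1)%:~R| = 2 - w.
    rewrite intrB mulrNz xE; have -> : - (1 + w + 4 * m%:~R) - 1 - 4 * (- m%:~R - 1%:~R) = 2 - w by ring.
    by rewrite ger0_norm//; lra.
  by rewrite (@waveE (- m - 1)) e; lra.
- have e : `|- x - 1 - 4 * (- m)%:~R| = w + 2.
    rewrite mulrNz xE; have -> : - (1 + w + 4 * m%:~R) - 1 - 4 * (- m%:~R) = - (w + 2) by ring.
    by rewrite normrN ger0_norm//; lra.
  by rewrite (@waveE (- m)) e; lra.
Qed.

Section Symmetric.
Variable h : R -> R.
Hypotheses (hN : forall x, h (- x) = - h x) (h2 : forall x, h (2 - x) = h x).

Lemma symmetric_period x : h (x + 4) = h x.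
Proof.
rewrite -h2; have -> : 2 - (x + 4) = - (2 - (- x)) by ring.
by rewrite hN h2 hN opprK.
Qed.

Lemma symmetric_periodz x m : h (x + 4 * m%:~R) = h x.
Proof.
have nat_case (n : nat) y : h (y + 4 * n%:R) = h y.
  elim: n => [|n IH]; first by rewrite mulr0 addr0.
  by rewrite -[n.+1%:R]natr1 mulrDr mulr1 addrA symmetric_period.
case: m => n; first exact: nat_case.
rewrite NegzE mulrNz -(nat_case n.+1 (x + _)); congr h.
by rewrite -pmulrn; ring.
Qed.

(** Oddness about 0 and evenness about 1 force the period 4, so the values on [-1, 1] determine the
    function. *)
Lemma symmetric_wave x : h x = h (wave x).
Proof.
have [w [m [_ -> ->]]] := wave_cases x; rewrite symmetric_periodz.
case: (ger0P w) => w0; last by congr h; lra.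
by rewrite -h2; congr h; lra.
Qed.

End Symmetric.

Lemma symmetric_extension (f : R -> R) : continuous f -> f 0 = 0 ->
  exists F : R -> R, [/\ continuous F, forall x, 0 <= x <= 1 -> F x = f x,
    forall x, F (- x) = - F x & forall x, F (2 - x) = F x].
Proof.
move=> cf f0.
(* [- Num.min (- z) 0] is the positive part of [z], so [fo] is [f] of the positive part minus [f] of
   the negative part: an odd function, equal to [f] on the right because [f 0 = 0]. *)
pose fo z := f (- Num.min (- z) 0) - f (- Num.min z 0).
exists (fun x => fo (wave x)); split.
- have cw := wave_cont.
  have c1 : continuous (fun x => - Num.min (- wave x) 0) by cont.
  have c2 : continuous (fun x => - Num.min (wave x) 0) by cont.
  by rewrite /fo; cont.
- move=> x /andP[x0 x1]; rewrite wave_id; last by lra.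
  rewrite /fo; have -> : - Num.min (- x) 0 = x by case: leP => ?; lra.
  have -> : - Num.min x 0 = 0 by case: leP => ?; lra.
  by rewrite f0 subr0.
- by move=> x; rewrite waveN /fo opprK; ring.
- by move=> x; rewrite wave_sym.
Qed.

End TriangleWave.

(** * Smoothness through chains of derivatives *)

Section Smooth.
Variable R : realType.
Implicit Types (f g : R -> R) (n k : nat).

(** The derivatives are exhibited as witnesses, so that a differential equation raises the
    regularity by induction on [n]. *)
Fixpoint Cn n f : Prop :=
  if n is n'.+1 then exists2 g, der f g & Cn n' g else continuous f.

Lemma Cn_continuous n f : Cn n f -> continuous f.
Proof. by case: n => // n [g /der_continuous]. Qed.

Lemma CnW n f : Cn n.+1 f -> Cn n f.
Proof.
elim: n f => [f|n IH f [g fg Cg]]; first exact: Cn_continuous.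
by exists g => //; exact: IH.
Qed.

Lemma Cn_le n k f : (k <= n)%N -> Cn n f -> Cn k f.
Proof.
elim: n => [|n IH]; first by rewrite leqn0 => /eqP ->.
by rewrite leq_eqVlt => /predU1P[->//|kn /CnW]; exact: IH.
Qed.

Lemma Cn_cst n (c : R) : Cn n (fun=> c).
Proof.
elim: n c => [c|n IH c]; first exact: cst_cont.
by exists (fun=> 0) => // x; exact: isd_cst.
Qed.

Lemma Cn_add n f g : Cn n f -> Cn n g -> Cn n (fun x => f x + g x).
Proof.
elim: n f g => [f g|n IH f g [f' df Cf] [g' dg Cg]]; first exact: add_cont.
exists (fun x => f' x + g' x); first by move=> x; exact: isd_add.
exact: IH.
Qed.

Lemma Cn_mul n f g : Cn n f -> Cn n g -> Cn n (fun x => f x * g x).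
Proof.
elim: n f g => [f g|n IH f g Cf Cg]; first exact: mul_cont.
have Cf1 := CnW Cf; have Cg1 := CnW Cg.
case: Cf => [f' df Cf]; case: Cg => [g' dg Cg].
exists (fun x => f' x * g x + f x * g' x); first by move=> x; exact: isd_mul.
by apply: Cn_add; exact: IH.
Qed.

Lemma Cn_opp n f : Cn n f -> Cn n (fun x => - f x).
Proof.
move=> Cf; have -> : (fun x => - f x) = (fun x => -1 * f x).
  by apply/funext => x; rewrite mulN1r.
by apply: Cn_mul => //; exact: Cn_cst.
Qed.

Lemma Cn_sin_cos n f : Cn n f -> Cn n (fun x => sin (f x)) /\ Cn n (fun x => cos (f x)).
Proof.
elim: n f => [f cf|n IH f Cf]; first by split; [exact: sin_cont|exact: cos_cont].
have [Cs Cc] := IH _ (CnW Cf); case: Cf => [f' df Cf]; split.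
- exists (fun x => cos (f x) * f' x); first by move=> x; repeat isd_step.
  exact: Cn_mul.
- exists (fun x => - sin (f x) * f' x); first by move=> x; repeat isd_step.
  by apply: Cn_mul => //; exact: Cn_opp.
Qed.

Lemma Cn_smooth f : (forall n, Cn n f) -> smooth f.
Proof.
move=> H k; have := H k.+1; elim: k f {H} => [f [g fg _] s|k IH f [g fg Cg]].
  by rewrite derive1n0; case: (fg s).
by rewrite derive1Sn (der_derive1 fg); exact: IH.
Qed.

Lemma smooth_der f : smooth f -> der f (derive1 f).
Proof. by move=> sf s; apply: derivable_isd; have := sf 0%N s; rewrite derive1n0. Qed.

Lemma smooth_derive1 f : smooth f -> smooth (derive1 f).
Proof. by move=> sf k s; rewrite -derive1Sn; exact: sf. Qed.

Lemma smooth_Cn f n : smooth f -> Cn n f.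
Proof.
elim: n f => [f sf|n IH f sf]; first exact: der_continuous (smooth_der sf).
by exists (derive1 f); [exact: smooth_der|apply/IH/smooth_derive1].
Qed.

Lemma smooth_cont f : smooth f -> continuous f.
Proof. by move=> /(smooth_Cn 0). Qed.

Lemma smooth_of_der f g : der f g -> smooth g -> smooth f.
Proof.
move=> fg sg; apply: Cn_smooth => n; apply: CnW; exists g => //.
exact: smooth_Cn.
Qed.

End Smooth.

(** * Extension of the minimiser to a smooth solution on the line *)

Section Profile.
Variable R : realType.
Implicit Types (f g phi : R -> R) (x p s d : R).

Lemma eq_sol phi psi x : continuous phi -> continuous psi ->
  (forall y, 0 <= y <= 1 -> phi y = psi y) -> 0 <= x <= 1 -> sol phi x = sol psi x.
Proof.
move=> cp cq pq x01; rewrite -!ip_kernel//; have ck := @kernel_cont R x.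
by apply: eq_integ => //; [by cont|by cont|move=> y /pq ->].
Qed.

(** Each failure of symmetry is a function with derivative 0 that vanishes at the fixed point of the
    reflection. *)
Lemma sol_symmetric phi : continuous phi -> (forall x, phi (- x) = - phi x) ->
  (forall x, phi (2 - x) = phi x) ->
  (forall x, sol phi (- x) = - sol phi x) /\ (forall x, sol phi (2 - x) = sol phi x).
Proof.
move=> cp pN p2; have d1 := der_sol1 cp; have d := der_sol cp.
have s12 x : sol1 phi (2 - x) = - sol1 phi x.
  have h : der (fun x => sol1 phi (2 - x) + sol1 phi x) (fun=> 0).
    by move=> y; isd_by; rewrite p2; ring.
  have := der_zero_cst x 1 h; have -> : 2 - 1 = 1 :> R by ring.
  by rewrite sol1_1; lra.
have s1N x : sol1 phi (- x) = sol1 phi x.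
  have h : der (fun x => sol1 phi (- x) - sol1 phi x) (fun=> 0).
    by move=> y; isd_by; rewrite pN; ring.
  by have := der_zero_cst x 0 h; rewrite oppr0; lra.
split=> x.
  have h : der (fun x => sol phi (- x) + sol phi x) (fun=> 0).
    by move=> y; isd_by; rewrite s1N; ring.
  by have := der_zero_cst x 0 h; rewrite oppr0 sol_0; lra.
have h : der (fun x => sol phi (2 - x) - sol phi x) (fun=> 0).
  by move=> y; isd_by; rewrite s12; ring.
have := der_zero_cst x 1 h; have -> : 2 - 1 = 1 :> R by ring.
by lra.
Qed.

Lemma Cn_sol n phi : Cn n phi -> Cn n.+2 (sol phi).
Proof.
move=> Cp; have cp := Cn_continuous Cp.
by exists (sol1 phi); [exact: der_sol|exists phi => //; exact: der_sol1].
Qed.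

(* A smooth solution of [F'''' = kap sin F] on the whole line whose restriction to
   [0, 1] minimises the bending energy among competitors turning in [p, p + pi/2]. *)
Record profile p (kap : R) F F1 F2 F3 : Prop := Profile {
  profile_smooth : smooth F;
  profile_d1 : der F F1;
  profile_d2 : der F1 F2;
  profile_d3 : der F2 F3;
  profile_d4 : der F3 (fun x => kap * sin (F x));
  profile_odd : forall x, F (- x) = - F x;
  profile_sym : forall x, F (2 - x) = F x;
  profile_turning : p < F 1 < p + pi / 2;
  profile_closing : integ (fun x => cos (F x)) 0 1 = 0;
  profile_F2_0 : F2 0 = 0;
  profile_F3_1 : F3 1 = 0;
  profile_min : forall d L, competitor p (p + pi / 2) d L -> ip F2 F2 <= d;
  profile_comp : competitor p (p + pi / 2) (ip F2 F2) (ip F2) }.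

(** The minimiser is extended by symmetry to a function [F] known only to be continuous. With
    [V = kap * sol (sin F)], the function [sol V] has the same symmetries and agrees with [F] on
    [0, 1], hence everywhere; the equation [F = sol V] then gains four derivatives at each round. *)
Lemma profile_exists : exists2 Phi0 : R, 1 <= Phi0 & forall p s, Phi0 <= p -> s ^+ 2 = 1 ->
  sin p = s -> exists kap F F1 F2 F3, profile p kap F F1 F2 F3.
Proof.
have [Phi0 Phi01 H] := window_minimiser R; exists Phi0 => // p s pP s2 sp.
have [kap [u]] := H p s pP s2 sp => {H}.
move vE : (fun x => kap * sol u x) => v [cu uE turn clos minv].
have csu := sol_cont cu; have cv : continuous v by rewrite -vE; cont.
have [F [cF Ff FN F2]] := symmetric_extension (sol_cont cv) (sol_0 v).
pose U x := sin (F x); have cU : continuous U by rewrite /U; cont.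
have [UN U2] : (forall x, U (- x) = - U x) /\ (forall x, U (2 - x) = U x).
  by split=> x; rewrite /U ?FN ?sinN// F2.
have csU := sol_cont cU; have [sN s2'] := sol_symmetric cU UN U2.
pose V x := kap * sol U x; have cV : continuous V by rewrite /V; cont.
have [VN V2] : (forall x, V (- x) = - V x) /\ (forall x, V (2 - x) = V x).
  by split=> x; rewrite /V ?sN ?s2'//; ring.
have [GN G2] := sol_symmetric cV VN V2.
have UE x : 0 <= x <= 1 -> U x = u x by move=> x01; rewrite /U Ff// uE.
have VE x : 0 <= x <= 1 -> V x = v x.
  by move=> x01; rewrite /V -vE; congr (_ * _); exact: eq_sol.
have FE : F = sol V.
  have on01 x : 0 <= x <= 1 -> F x = sol V x.
    by move=> x01; rewrite Ff//; symmetry; exact: eq_sol.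
  apply/funext => x; rewrite (symmetric_wave FN F2) (symmetric_wave GN G2).
  have : -1 <= wave x <= 1.
    by have [w [m [/andP[w1 w2] _ ->]]] := wave_cases x; case: (ger0P w) => *; lra.
  move: (wave x) => z /andP[z1 z2]; case: (leP 0 z) => z0; first by apply: on01; rewrite z0.
  by rewrite -[z]opprK FN GN on01//; lra.
have ipE : ip V V = ip v v.
  by apply: eq_integ => //; [by cont|by cont|move=> x x01; rewrite VE].
have dU := der_sol cU; have dU1 := der_sol1 cU.
exists kap, F, (sol1 V), V, (fun x => kap * sol1 U x).
have t1 : p < F 1 < p + pi / 2 by rewrite Ff ?lexx ?ler01.
have cl : integ (fun x => cos (F x)) 0 1 = 0.
  rewrite -[RHS]clos; have cs := sol_cont cv.
  by apply: eq_integ => //; [by cont|by cont|move=> x x01; rewrite Ff].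
split=> //.
- apply: Cn_smooth => n; elim: n => [//|n IH].
  suff : Cn n.+4 F by apply: Cn_le; rewrite -addn3 leq_addr.
  rewrite FE; apply/Cn_sol/Cn_mul; first exact: Cn_cst.
  by apply/Cn_sol; case: (Cn_sin_cos IH).
- by rewrite [X in der X _]FE; exact: der_sol.
- exact: der_sol1.
- by move=> x; rewrite /V; isd_by; ring.
- by move=> x; isd_by; rewrite /U; ring.
- by rewrite /V sol_0 mulr0.
- by rewrite sol1_1 mulr0.
- by move=> d L /minv; rewrite ipE.
- split; first exact: energy_functional_ip.
    rewrite /arc ip_kernel ?lexx ?ler01// -FE.
    by case/andP: t1 => *; rewrite !ltW.
  by rewrite defect_ip// -FE.
Qed.

End Profile.

Section LocalDerivatives.
Variable R : realType.

(** Agreement on the positive half-line is what holds for the doubled arc: for [s < 0] it integrates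
    over an empty interval. *)
Lemma eq_derive1n_pos (g h : R -> R) : (forall s, 0 < s -> g s = h s) -> smooth h ->
  forall k s, 0 < s -> derive1n k g s = derive1n k h s /\ derivable (derive1n k g) s 1.
Proof.
move=> gh sh.
have loc (g' h' : R -> R) : (forall s, 0 < s -> g' s = h' s) -> (forall s, derivable h' s 1) ->
    forall s, 0 < s -> isd g' s (derive1 h' s).
  move=> gh' dh s s0; apply: near_eq_is_derive (derivable_isd (dh s)).
  by apply: (nbhs_abs s0) => y; rewrite ltr_norml => ys; rewrite gh'//; lra.
elim=> [|k IH] s s0.
  by rewrite !derive1n0; split; [exact: gh|case: (loc _ _ gh (sh 0%N) s s0)].
have e t : 0 < t -> derive1n k.+1 g t = derive1n k.+1 h t.
  move=> t0; rewrite !derive1nS.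
  have H := loc _ _ (fun s s0 => (IH s s0).1) (sh k) t t0.
  by rewrite derive1E; case: H.
by split; [exact: e|case: (loc _ _ e (sh k.+1) s s0)].
Qed.

End LocalDerivatives.

(** * The closed curve integrated from the profile *)

Section ReconstructedCurve.
Variable R : realType.
Variables (p kap : R) (F F1 F2 F3 : R -> R).
Hypothesis prof : profile p kap F F1 F2 F3.
Variable l : R.
Hypothesis l0 : 0 < l.
Implicit Types (s t x y : R).

Definition angle s := pi / 2 + F (l^-1 * s).
Definition angle1 s := l^-1 * F1 (l^-1 * s).
Definition angle2 s := l^-1 ^+ 2 * F2 (l^-1 * s).
Definition angle3 s := l^-1 ^+ 3 * F3 (l^-1 * s).
Definition curve_x s := integ (fun t => cos (angle t)) 0 s.
Definition curve_y s := integ (fun t => sin (angle t)) 0 s.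

Let dF := profile_d1 prof.
Let dF1 := profile_d2 prof.
Let dF2 := profile_d3 prof.
Let dF3 := profile_d4 prof.
Let cF := der_continuous dF.
Let cF1 := der_continuous dF1.
Let cF2 := der_continuous dF2.
Let cF3 := der_continuous dF3.
Let FN := profile_odd prof.
Let Fsym := profile_sym prof.
Let ln0 : l != 0. Proof. by rewrite gt_eqF. Qed.

Lemma cos_angleE s : cos (angle s) = - sin (F (l^-1 * s)).
Proof. by rewrite /angle [_ + F _]addrC cosDpihalf. Qed.

Lemma sin_angleE s : sin (angle s) = cos (F (l^-1 * s)).
Proof. by rewrite /angle [_ + F _]addrC sinDpihalf. Qed.

Lemma der_angle : der angle angle1.
Proof. by have h := dF; move=> s; rewrite /angle; isd_by; rewrite /angle1; ring. Qed.

Lemma der_angle1 : der angle1 angle2.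
Proof. by have h := dF1; move=> s; rewrite /angle1; isd_by; rewrite /angle2; ring. Qed.

Lemma der_angle2 : der angle2 angle3.
Proof. by have h := dF2; move=> s; rewrite /angle2; isd_by; rewrite /angle3; ring. Qed.

Lemma der_angle3 : der angle3 (fun s => - (kap / l ^+ 4) * cos (angle s)).
Proof.
have h := dF3; move=> s; rewrite /angle3; isd_by.
by rewrite cos_angleE; field.
Qed.

Lemma angle_cont : continuous angle. Proof. exact: der_continuous der_angle. Qed.
Lemma angle2_cont : continuous angle2. Proof. exact: der_continuous der_angle2. Qed.
Lemma angle3_cont : continuous angle3. Proof. exact: der_continuous der_angle3. Qed.

Lemma angle_smooth : smooth angle.
Proof.
apply: Cn_smooth; elim=> [|n IH]; first exact: angle_cont.
apply: (@Cn_le _ n.+4); first by do 3!apply: leqW.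
exists angle1; first exact: der_angle.
exists angle2; first exact: der_angle1.
exists angle3; first exact: der_angle2.
exists (fun s => - (kap / l ^+ 4) * cos (angle s)); first exact: der_angle3.
by apply: Cn_mul; [exact: Cn_cst|case: (Cn_sin_cos IH)].
Qed.

Lemma smooth_sin_cos f : smooth f ->
  smooth (fun s : R => sin (f s)) /\ smooth (fun s : R => cos (f s)).
Proof.
by move=> sf; split; apply: Cn_smooth => n; have [] := Cn_sin_cos (smooth_Cn n sf).
Qed.

Lemma cosa_cont : continuous (fun s => cos (angle s)).
Proof. by have h := angle_cont; cont. Qed.

Lemma sina_cont : continuous (fun s => sin (angle s)).
Proof. by have h := angle_cont; cont. Qed.

Lemma der_curve_x : der curve_x (fun s => cos (angle s)).
Proof. exact: der_integ cosa_cont. Qed.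

Lemma der_curve_y : der curve_y (fun s => sin (angle s)).
Proof. exact: der_integ sina_cont. Qed.

Lemma angle_rev s : angle (l + s) = angle (l - s).
Proof.
rewrite /angle; congr (_ + _); rewrite -Fsym; congr F.
by field.
Qed.

Lemma angle_opp s : cos (angle (- s)) = - cos (angle s) /\ sin (angle (- s)) = sin (angle s).
Proof. by rewrite !cos_angleE !sin_angleE mulrN FN sinN cosN. Qed.

Lemma curve_y0 : curve_y 0 = 0. Proof. exact: integ_xx. Qed.

Lemma curve_xN s : curve_x (- s) = curve_x s.
Proof.
have d := der_curve_x.
have h : der (fun s => curve_x (- s) - curve_x s) (fun=> 0).
  by move=> t; isd_by; rewrite (angle_opp t).1; ring.
by have := der_zero_cst s 0 h; rewrite oppr0; lra.
Qed.

Lemma curve_yN s : curve_y (- s) = - curve_y s.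
Proof.
have d := der_curve_y.
have h : der (fun s => curve_y (- s) + curve_y s) (fun=> 0).
  by move=> t; isd_by; rewrite (angle_opp t).2; ring.
by have := der_zero_cst s 0 h; rewrite oppr0 curve_y0; lra.
Qed.

Lemma curve_y_mid : curve_y l = 0.
Proof.
have h := cF; have cc : continuous (fun x => cos (F x)) by cont.
have -> : curve_y l = integ (fun x => cos (F (l^-1 * x + 0))) 0 l.
  by congr (integ _ 0 l); apply/funext => x; rewrite sin_angleE addr0.
have lV : l^-1 != 0 by rewrite invr_eq0.
rewrite (@integ_affine R (fun x => cos (F x)) l^-1 0 0 l lV cc).
by rewrite mulr0 addr0 mulVf// addr0 (profile_closing prof) mulr0.
Qed.

Lemma curve_rev s : curve_x (l + s) = 2 * curve_x l - curve_x (l - s) /\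
  curve_y (l + s) = 2 * curve_y l - curve_y (l - s).
Proof.
have dx := der_curve_x; have dy := der_curve_y; split.
  have h : der (fun s => curve_x (l + s) + curve_x (l - s)) (fun=> 0).
    by move=> t; isd_by; rewrite angle_rev; ring.
  by have := der_zero_cst s 0 h; rewrite addr0 subr0; lra.
have h : der (fun s => curve_y (l + s) + curve_y (l - s)) (fun=> 0).
  by move=> t; isd_by; rewrite angle_rev; ring.
by have := der_zero_cst s 0 h; rewrite addr0 subr0; lra.
Qed.

(** The period is the composite of the symmetries about 0 and about the midpoint [l]. The same
    argument for [curve_y] leaves a drift of four times [curve_y l], which is where closing is
    used. *)
Lemma curve_x_period s : curve_x (s + 4 * l) = curve_x s.
Proof.
have [e _] := curve_rev (s + 3 * l); have [e' _] := curve_rev (- s - l).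
move: e e'; have -> : l + (s + 3 * l) = s + 4 * l by ring.
have -> : l - (s + 3 * l) = - (s + 2 * l) by ring.
have -> : l + (- s - l) = - s by ring.
have -> : l - (- s - l) = s + 2 * l by ring.
by rewrite !curve_xN; lra.
Qed.

Lemma curve_y_period s : curve_y (s + 4 * l) = curve_y s.
Proof.
have [_ e] := curve_rev (s + 3 * l); have [_ e'] := curve_rev (- s - l).
move: e e'; have -> : l + (s + 3 * l) = s + 4 * l by ring.
have -> : l - (s + 3 * l) = - (s + 2 * l) by ring.
have -> : l + (- s - l) = - s by ring.
have -> : l - (- s - l) = s + 2 * l by ring.
by rewrite !curve_yN curve_y_mid; lra.
Qed.

Lemma doubled_arcE s : 0 <= s -> doubled_arc angle s = (curve_x s, curve_y s).
Proof.
move=> s0; rewrite /doubled_arc.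
by rewrite (integ_Rint cosa_cont s0) (integ_Rint sina_cont s0).
Qed.

Lemma periodic_shift (f : R -> R) P (m : int) s : (forall s, f (s + P) = f s) ->
  f (s - P * m%:~R) = f s.
Proof.
move=> fP; have nat_case (n : nat) t : f (t + P * n%:R) = f t.
  elim: n => [|n IH]; first by rewrite mulr0 addr0.
  by rewrite -[n.+1%:R]natr1 mulrDr mulr1 addrA fP.
case: m => n; first by rewrite -[in RHS](subrK (P * n%:R) s) nat_case.
by rewrite NegzE mulrNz mulrN opprK; exact: nat_case.
Qed.

(** By parity and periodicity the reflected half is the continuation of the integral curve, so
    smoothness at the junctions comes for free. *)
Lemma reflection_closureE : reflection_closure l angle = (fun s => (curve_x s, curve_y s)).
Proof.
have hl := l0.
apply/funext => s; rewrite /reflection_closure /periodize.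
set m := Num.floor _; set r := s - _.
have l40 : 0 < 4 * l by lra.
have := floor_itv (s / (4 * l)); rewrite -/m => /andP[m1 m2].
have r0 : 0 <= r.
  by rewrite /r subr_ge0 mulrC -ler_pdivlMr.
have r4 : r < 4 * l.
  rewrite /r ltrBlDl -[X in _ < _ + X]mulr1 -mulrDr mulrC -ltr_pdivrMr//.
  by rewrite -(mulr1z 1) -intrD.
have ex : curve_x r = curve_x s by apply: periodic_shift; exact: curve_x_period.
have ey : curve_y r = curve_y s by apply: periodic_shift; exact: curve_y_period.
case: ifP => [_|_]; first by rewrite doubled_arcE// ex ey.
rewrite doubled_arcE; last by lra.
by rewrite /= addrC curve_x_period curve_y_period curve_xN curve_yN opprK ex ey.
Qed.

Let G := reflection_closure l angle.

Lemma xcG : xc G = curve_x. Proof. by rewrite /G reflection_closureE. Qed.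
Lemma ycG : yc G = curve_y. Proof. by rewrite /G reflection_closureE. Qed.

Lemma derive1_xcG : derive1 (xc G) = (fun s => cos (angle s)).
Proof. by rewrite xcG; exact: der_derive1 der_curve_x. Qed.

Lemma derive1_ycG : derive1 (yc G) = (fun s => sin (angle s)).
Proof. by rewrite ycG; exact: der_derive1 der_curve_y. Qed.

Lemma speedG s : speed G s = 1.
Proof. by rewrite /speed derive1_xcG derive1_ycG cos2Dsin2 sqrtr1. Qed.

Lemma curve_x_smooth : smooth curve_x.
Proof. by apply: smooth_of_der der_curve_x _; have [] := smooth_sin_cos angle_smooth. Qed.

Lemma curve_y_smooth : smooth curve_y.
Proof. by apply: smooth_of_der der_curve_y _; have [] := smooth_sin_cos angle_smooth. Qed.

Lemma closed_immersionG : smooth_closed_immersion (4 * l) G.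
Proof.
have hl := l0.
split; [by lra| |by move=> u; rewrite speedG oner_neq0].
split; [by rewrite xcG; exact: curve_x_smooth|by rewrite ycG; exact: curve_y_smooth|].
by move=> u; rewrite /G reflection_closureE curve_x_period curve_y_period.
Qed.

Lemma dsG f s : ds G f s = derive1 f s.
Proof. by rewrite /ds speedG divr1. Qed.

Lemma curvatureG : curvature G = angle1.
Proof.
apply/funext => s; rewrite /curvature !dsG.
have -> : ds G (yc G) = (fun s => sin (angle s)).
  by apply/funext => t; rewrite dsG derive1_ycG.
have -> : ds G (xc G) = (fun s => cos (angle s)).
  by apply/funext => t; rewrite dsG derive1_xcG.
have h := der_angle.
have dc : der (fun s => cos (angle s)) (fun s => - sin (angle s) * angle1 s).
  by move=> t; repeat isd_step.
have dS : der (fun s => sin (angle s)) (fun s => cos (angle s) * angle1 s).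
  by move=> t; repeat isd_step.
rewrite (der_derive1 dc) (der_derive1 dS) derive1_xcG derive1_ycG.
by rewrite -[RHS]mul1r -(cos2Dsin2 (angle s)); ring.
Qed.

Lemma J_G lam : J lam (4 * l) G =
  2^-1 * integ (fun s => angle2 s ^+ 2) 0 (4 * l) + lam * (4 * l).
Proof.
have hl := l0.
have h2 := angle2_cont; have l40 : 0 <= 4 * l by lra.
rewrite /J /curve_length; congr (_ * _ + lam * _).
  rewrite -integ_Rint//; last by cont.
  apply: eq_Rintegral => s _.
  by rewrite dsG curvatureG (der_derive1 der_angle1) speedG mulr1.
rewrite (_ : speed G = fun=> 1); last by apply/funext => s; rewrite speedG.
by rewrite integ_Rint ?integ_cst//; [lra|cont].
Qed.

Lemma F2_sym x : F2 (- x) = - F2 x /\ F2 (2 - x) = F2 x.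
Proof.
have h := dF; have h1 := dF1; have h2 := dF2.
have e1 y : F1 (- y) = F1 y.
  have d1 : der (fun x => F (- x)) (fun x => - F1 (- x)).
    by move=> z; isd_by; ring.
  have d2 : der (fun x => - F x) (fun x => - F1 x) by move=> z; isd_by.
  have e : (fun x => F (- x)) = (fun x => - F x) by apply/funext => z; exact: FN.
  rewrite e in d1; have /(congr1 (fun f => f y)) := der_uniq d1 d2.
  by move=> /= ?; lra.
have e2 y : F1 (2 - y) = - F1 y.
  have d1 : der (fun x => F (2 - x)) (fun x => - F1 (2 - x)).
    by move=> z; isd_by; ring.
  have e : (fun x => F (2 - x)) = F by apply/funext => z; exact: Fsym.
  rewrite e in d1; have /(congr1 (fun f => f y)) := der_uniq d1 h.
  by move=> /= ?; lra.
split.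
  have d1 : der (fun x => F1 (- x)) (fun x => - F2 (- x)).
    by move=> z; isd_by; ring.
  have e : (fun x => F1 (- x)) = F1 by apply/funext => z; exact: e1.
  rewrite e in d1; have /(congr1 (fun f => f x)) := der_uniq d1 h1.
  by move=> /= ?; lra.
have d1 : der (fun x => F1 (2 - x)) (fun x => - F2 (2 - x)).
  by move=> z; isd_by; ring.
have d2 : der (fun x => - F1 x) (fun x => - F2 x) by move=> z; isd_by.
have e : (fun x => F1 (2 - x)) = (fun x => - F1 x) by apply/funext => z; exact: e2.
rewrite e in d1; have /(congr1 (fun f => f x)) := der_uniq d1 d2.
by move=> /= ?; lra.
Qed.

(** The four quarter arcs carry equal energy because [F2] is odd about 0 and even about 1, and
    rescaling contributes [l^-3]. *)
Lemma bending_angle : integ (fun s => angle2 s ^+ 2) 0 (2 * l) = 2 * ip F2 F2 / l ^+ 3 /\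
  integ (fun s => angle2 s ^+ 2) 0 (4 * l) = 4 * ip F2 F2 / l ^+ 3.
Proof.
have h2 := angle2_cont; have hF2 := cF2.
have c2 : continuous (fun x => F2 x ^+ 2) by cont.
have lV : l^-1 != 0 by rewrite invr_eq0.
have scale a b : integ (fun s => angle2 s ^+ 2) (l * a) (l * b) = integ (fun x => F2 x ^+ 2) a b / l ^+ 3.
  have -> : (fun s => angle2 s ^+ 2) = (fun s => l ^- 4 * F2 (l^-1 * s + 0) ^+ 2).
    by apply/funext => s; rewrite /angle2 addr0; field.
  have c0 : continuous (fun s => F2 (l^-1 * s + 0)) by cont.
  rewrite integZ; last by cont.
  rewrite (@integ_affine R (fun x => F2 x ^+ 2) l^-1 0 _ _ lV c2) !addr0 !mulKf// invrK.
  by field.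
have mir b : integ (fun x => F2 x ^+ 2) (2 - b) (2 - 0) = integ (fun x => F2 x ^+ 2) 0 b.
  have n1 : (-1 : R) != 0 by rewrite oppr_eq0 oner_eq0.
  have := @integ_affine R (fun x => F2 x ^+ 2) (-1) 2 0 b n1 c2.
  have -> : (fun x => F2 (-1 * x + 2) ^+ 2) = (fun x => F2 x ^+ 2).
    by apply/funext => x; rewrite mulN1r addrC (F2_sym x).2.
  move=> ->; rewrite invrN1 mulN1r -integ_swap.
  by congr (integ _ _ _); ring.
have I2 : integ (fun x => F2 x ^+ 2) 0 2 = 2 * ip F2 F2.
  have ipE : ip F2 F2 = integ (fun x => F2 x ^+ 2) 0 1.
    by congr (integ _ 0 1); apply/funext => x; rewrite expr2.
  have := mir 1; rewrite subr0 (integ_cat _ 0 1 2) ipE.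
  have -> : 2 - 1 = 1 :> R by ring.
  by lra.
have I4 : integ (fun x => F2 x ^+ 2) 0 4 = 4 * ip F2 F2.
  have n1 : (-1 : R) != 0 by rewrite oppr_eq0 oner_eq0.
  have e1 : integ (fun x => F2 x ^+ 2) (-2) 0 = 2 * ip F2 F2.
    have := @integ_affine R (fun x => F2 x ^+ 2) (-1) 0 0 2 n1 c2.
    have -> : (fun x => F2 (-1 * x + 0) ^+ 2) = (fun x => F2 x ^+ 2).
      by apply/funext => x; rewrite mulN1r addr0 (F2_sym x).1 sqrrN.
    rewrite I2 => ->; rewrite invrN1 mulN1r -integ_swap.
    by congr (integ _ _ _); ring.
  have := mir 4; rewrite subr0 => e; rewrite -e (integ_cat _ (2 - 4) 0 2) I2.
  have -> : 2 - 4 = - 2 :> R by ring.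
  by rewrite e1; ring.
by split; [rewrite -I2 -scale|rewrite -I4 -scale]; rewrite mulr0 mulrC.
Qed.

Lemma doubled_arc_smooth_near : smooth_near l (xc (doubled_arc angle)) /\
  smooth_near l (yc (doubled_arc angle)).
Proof.
have hl := l0.
have ex s : 0 < s -> xc (doubled_arc angle) s = curve_x s.
  by move=> s0; rewrite /xc doubled_arcE ?ltW.
have ey s : 0 < s -> yc (doubled_arc angle) s = curve_y s.
  by move=> s0; rewrite /yc doubled_arcE ?ltW.
split; apply: (nbhs_abs l0) => s; rewrite ltr_norml => sl k.
  by apply: (eq_derive1n_pos ex curve_x_smooth _ _).2; lra.
by apply: (eq_derive1n_pos ey curve_y_smooth _ _).2; lra.
Qed.

Lemma angle_transversality : midpoint_transversality l angle.
Proof.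
split; first by apply: nearW => s k _; exact: angle_smooth.
have -> : derive1n 3 angle = angle3.
  by rewrite !derive1nS derive1n0 (der_derive1 der_angle) (der_derive1 der_angle1)
    (der_derive1 der_angle2).
have <- : angle3 l = 0 by rewrite /angle3 mulVf// (profile_F3_1 prof) mulr0.
by apply: cvg_at_left_filter; exact: angle3_cont.
Qed.

(** The difference [d] of the two lifts has cosine 1 and starts at 0. If it moved, it would take a
    value [z] or [- z] with [0 < z <= 1], where the sine does not vanish although cosine 1 forces it
    to. *)
Lemma tangent_lift_angle Theta : tangent_lift `[0, 4 * l] G Theta -> Theta 0 = pi / 2 ->
  forall s, 0 <= s <= 4 * l -> Theta s = angle s.
Proof.
have hl := l0.
move=> [cT HT] T0.
have F0 : F 0 = 0 by have := FN 0; rewrite oppr0; lra.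
have l40 : 0 < 4 * l by lra.
pose d s := Theta s - angle s.
have cd : {within `[0, 4 * l], continuous d}.
  move=> s; apply: cvgB; first exact: cT.
  exact: (continuous_subspaceT angle_cont).
have d0 : d 0 = 0 by rewrite /d T0 /angle mulr0 F0; lra.
have dc s : 0 <= s <= 4 * l -> cos (d s) = 1.
  move=> s01; have [|h1 h2] := HT s; first by rewrite /= in_itv.
  rewrite /d cosB -h1 -h2 !dsG derive1_xcG derive1_ycG -!expr2; exact: cos2Dsin2.
suff H s : 0 <= s <= 4 * l -> d s = 0 by move=> s s01; have := H s s01; rewrite /d; lra.
move=> /andP[s0 s4]; apply: contrapT => /eqP ds0.
have {}cd : {within `[0, s], continuous d}.
  by apply: continuous_subspaceW cd => t /=; rewrite !in_itv /= => /andP[-> ts]; lra.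
pose z := Num.min 1 `|d s|.
have z0 : 0 < z by rewrite lt_min ltr01 normr_gt0 ds0.
have z1 : z <= 1 by rewrite ge_min lexx.
have zd : z <= `|d s| by rewrite ge_min lexx orbT.
have [sg sg1 sgd] : exists2 sg : R, sg ^+ 2 = 1 & 0 <= sg * z <= d s \/ d s <= sg * z <= 0.
  case: (ger0P (d s)) zd => h zd.
    by exists 1; [rewrite expr1n|left; lra].
  by exists (-1); [rewrite sqrrN expr1n|right; lra].
have [t ts dt] : exists2 t, t \in `[0, s] & d t = sg * z.
  apply: IVT => //; rewrite d0 ge_min le_max.
  by case: sgd => /andP[-> ->]; rewrite ?orbT.
have : cos (d t) = 1.
  by apply: dc; move: ts; rewrite in_itv /= => /andP[-> ts]; lra.
rewrite dt => c1.
have : sin z = 0.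
  have : sin (sg * z) = 0 by apply: cos1sin0; rewrite c1 normr1.
  have /eqP : (sg - 1) * (sg + 1) = 0 by rewrite -(subr_sqr_1 sg) sg1 subrr.
  rewrite mulf_eq0 subr_eq0 addr_eq0 => /orP[] /eqP ->; rewrite ?mul1r//.
  by rewrite mulN1r sinN; lra.
have : 0 < sin z by apply: sin2_gt0; lra.
by move=> + e; rewrite e ltxx.
Qed.

End ReconstructedCurve.

(** * Weak derivatives and admissible competitors *)

Section Bump.
Variable R : realType.
Implicit Types (f g : R -> R) (x y z t c d e : R) (P Q : {poly R}).

Lemma isd_quadratic f c : (forall h, `|f h| <= c * h ^+ 2) -> isd f 0 0.
Proof.
move=> fc.
have f0 : f 0 = 0 by apply/eqP; rewrite -normr_le0; have := fc 0; rewrite expr0n mulr0.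
apply/is_derive1_caratheodory; exists (fun z => z^-1 * f z); split.
- move=> z; have [->|z0] := eqVneq z 0; first by rewrite subrr subrr mulr0.
  by rewrite f0 !subr0 mulrC mulrA mulfV ?mul1r.
- apply/continuous_absP => e e0; rewrite f0 mulr0.
  have c1 : 0 < `|c| + 1 by have := normr_ge0 c; lra.
  exists (e / (`|c| + 1)) => [|y]; first exact: divr_gt0.
  rewrite !subr0 ltr_pdivlMr// => ye.
  have [->|y0] := eqVneq y 0; first by rewrite f0 mulr0 normr0.
  have yp : 0 < `|y| by rewrite normr_gt0.
  apply: le_lt_trans ye; rewrite normrM normfV -(ler_pM2l yp) mulrA mulfV ?gt_eqF// mul1r.
  apply: (le_trans (fc y)).
  have -> : `|y| * (`|y| * (`|c| + 1)) = (`|c| + 1) * `|y| ^+ 2 by ring.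
  rewrite real_normK ?num_real//.
  by apply: ler_wpM2r; [exact: sqr_ge0|have := ler_norm c; lra].
- by rewrite f0 mulr0.
Qed.

Lemma poly_le_exp P t : 0 < t -> exists C, forall z, 0 <= z -> `|P.[z]| <= C * expR (t * z).
Proof.
elim/poly_ind: P t => [|P c IH] t t0.
  by exists 0 => z _; rewrite horner0 normr0 mul0r.
have t2 : 0 < t / 2 by lra.
have [C HC] := IH _ t2.
exists (`|C| * (2 / t) + `|c|) => z z0.
rewrite hornerMXaddC; apply: (le_trans (ler_normD _ _)); rewrite mulrDl; apply: lerD.
  have -> : t * z = t / 2 * z + t / 2 * z by lra.
  rewrite expRD normrM.
  have h1 : `|P.[z]| <= `|C| * expR (t / 2 * z).
    apply: (le_trans (HC z z0)); apply: ler_wpM2r; [exact: expR_ge0|exact: ler_norm].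
  have h2 : `|z| <= 2 / t * expR (t / 2 * z).
    rewrite ger0_norm// -ler_pdivrMl ?divr_gt0// invf_div.
    by apply: le_trans (expR_ge1Dx _); lra.
  have -> : `|C| * (2 / t) * (expR (t / 2 * z) * expR (t / 2 * z)) =
    (`|C| * expR (t / 2 * z)) * (2 / t * expR (t / 2 * z)) by ring.
  exact: ler_pM.
rewrite ler_peMr//; apply: le_trans (expR_ge1Dx _).
by have := mulr_ge0 (ltW t0) z0; lra.
Qed.

(** Polynomials in [1 / x] times [exp (- 1 / x)]: a family stable under differentiation, with [P]
    becoming [X^2 (P - P')], so smoothness at 0 is a single induction. *)
Definition flat P x := if 0 < x then P.[x^-1] * expR (- x^-1) else 0.

Lemma flat_pos P x : 0 < x -> flat P x = P.[x^-1] * expR (- x^-1).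
Proof. by rewrite /flat => ->. Qed.

Lemma flat_neg P x : x <= 0 -> flat P x = 0.
Proof. by rewrite /flat ltNge => ->. Qed.

Lemma der_flat P : der (flat P) (flat ('X^2 * (P - P^`()))).
Proof.
move=> x; case: (ltgtP x 0) => x0.
- rewrite flat_neg; last exact: ltW.
  apply: (near_eq_is_derive _ (isd_cst 0 x)); have x0' : 0 < - x by lra.
  by apply: (nbhs_abs x0') => y; rewrite ltr_norml => h; rewrite flat_neg//; lra.
- rewrite flat_pos//.
  apply: (@near_eq_is_derive _ _ _ (fun x => P.[x^-1] * expR (- x^-1))).
    by apply: (nbhs_abs x0) => y; rewrite ltr_norml => h; rewrite flat_pos//; lra.
  have xn0 : x != 0 by rewrite gt_eqF.
  have di : isd (fun y => y^-1) x (- x ^- 2 * 1) by apply: isd_inv => //; exact: isd_id.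
  have dp : isd (fun y => P.[y^-1]) x (P^`().[x^-1] * (- x ^- 2 * 1)).
    by apply: (@isd_comp _ (horner P) (fun y => y^-1)) => //; exact: is_derive_poly.
  have de : isd (fun y => expR (- y^-1)) x (expR (- x^-1) * - (- x ^- 2 * 1)).
    by apply: (@isd_comp _ expR (fun y => - y^-1)); [exact: is_derive_expR|exact: isd_opp].
  apply: (isd_eq (isd_mul dp de)).
  by rewrite hornerM hornerXn hornerD hornerN exprVn; ring.
- rewrite x0 [X in isd _ _ X]flat_neg//.
  (* The exponential dominates [P] times [X^2], so the function is bounded by a multiple of [h^2]
     and has derivative 0 at 0. *)
  have [C HC] := @poly_le_exp (P * 'X^2) 1 ltr01.
  apply: (@isd_quadratic _ `|C|) => h; case: (ltP 0 h) => h0; last first.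
    by rewrite flat_neg// normr0 mulr_ge0 ?sqr_ge0.
  have hV : 0 <= h^-1 by rewrite invr_ge0 ltW.
  have := HC _ hV; rewrite hornerM hornerXn mul1r normrM.
  rewrite (ger0_norm (sqr_ge0 h^-1)) exprVn ler_pdivrMr ?exprn_gt0// flat_pos// => H.
  rewrite normrM (ger0_norm (expR_ge0 _)) expRN ler_pdivrMr ?expR_gt0//.
  apply: (le_trans H); rewrite mulrAC; apply: ler_wpM2r; first exact: expR_ge0.
  by apply: ler_wpM2r; [exact: sqr_ge0|exact: ler_norm].
Qed.

Lemma flat_Cn n P : Cn n (flat P).
Proof.
elim: n P => [P|n IH P]; first exact: der_continuous (der_flat P).
by exists (flat ('X^2 * (P - P^`()))); [exact: der_flat|exact: IH].
Qed.

Lemma Cn_affine n f c d : Cn n f -> Cn n (fun x => f (c * x + d)).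
Proof.
elim: n f => [f cf|n IH f [g fg Cg]].
  by apply: comp_cont => //; cont.
exists (fun x => g (c * x + d) * c); first by move=> x; isd_by; ring.
by apply: Cn_mul; [exact: IH|exact: Cn_cst].
Qed.

Lemma bump_exists : exists b : R -> R, [/\ smooth b, forall x, 0 <= b x,
  forall x, 1 <= `|x| -> b x = 0 & integ b (-1) 1 = 1].
Proof.
pose psi := flat 1.
have psi_ge0 x : 0 <= psi x.
  rewrite /psi /flat; case: ifP => // _.
  by rewrite hornerC mul1r expR_ge0.
pose b0 x := psi (-1 * x + 1) * psi (1 * x + 1).
have b0_Cn n : Cn n b0 by apply: Cn_mul; apply: Cn_affine; exact: flat_Cn.
have cb0 : continuous b0 := Cn_continuous (b0_Cn 0%N).
have b0_ge0 x : 0 <= b0 x by rewrite mulr_ge0.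
have b0_out x : 1 <= `|x| -> b0 x = 0.
  rewrite ler_normr => /orP[] h; rewrite /b0.
    by rewrite /psi flat_neg ?mul0r//; lra.
  by rewrite /psi (@flat_neg _ (1 * x + 1)) ?mulr0//; lra.
pose m := integ b0 (-1) 1.
have N11 : -1 <= 1 :> R by lra.
have N11' : -1 < 1 :> R by lra.
have m_ge0 : 0 <= m by apply: integ_ge0 => // x _; exact: b0_ge0.
have m0 : 0 < m.
  rewrite lt_neqAle m_ge0 andbT; apply/eqP => /esym m_eq0.
  have b00 : b0 0 = 0.
    by apply: (integ_eq0 cb0 N11' _ m_eq0) => [x _|]; [exact: b0_ge0|lra].
  have : 0 < b0 0.
    rewrite /b0 !mulr0 !add0r /psi flat_pos// hornerC mul1r.
    by apply: mulr_gt0; exact: expR_gt0.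
  by rewrite b00 ltxx.
exists (fun x => m^-1 * b0 x); split.
- by apply: Cn_smooth => n; apply: Cn_mul => //; exact: Cn_cst.
- by move=> x; rewrite mulr_ge0// invr_ge0 ltW.
- by move=> x /b0_out ->; rewrite mulr0.
- by rewrite integZ// mulVf// gt_eqF.
Qed.

End Bump.

(** * Pairing with square-integrable functions *)

Section SquareIntegrable.
Variable R : realType.
Local Notation mu := (@lebesgue_measure R).
Implicit Types (f g u v phi : R -> R) (a b c x s : R).

Lemma cont_integrable_oo f a b : continuous f -> mu.-integrable `]a, b[ (EFin \o f).
Proof.
move=> cf; apply: integrableS (cont_integrable a b cf) => //.
exact: subset_itv_oo_cc.
Qed.

Lemma Rintegral_oo f a b : continuous f -> a <= b ->
  Rintegral mu `]a, b[ f = integ f a b.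
Proof.
move=> cf ab; rewrite -integ_Rint//.
have i2 : mu.-integrable `]a, b] (EFin \o f).
  by apply: integrableS (cont_integrable a b cf) => //; exact: subset_itv_oc_cc.
by rewrite (Rintegral_itv_bndo_bndc (cont_integrable_oo a b cf)) (Rintegral_itv_obnd_cbnd i2).
Qed.

Lemma L2_integrable a b u : L2 a b u ->
  measurable_fun `]a, b[ u /\ mu.-integrable `]a, b[ (EFin \o (fun s => u s ^+ 2)).
Proof.
move=> uL; split.
  apply/measurable_restrictT => //.
  by move: uL; rewrite /L2 inE => /andP[/[!inE]].
have H : mu.-integrable `]a, b[ (EFin \o (fun s => (u \_ `]a, b[) s ^+ 2)).
  exact: (integrableS measurableT _ _ (Lfun2_integrable_sqr uL)).
by apply: eq_integrable H => // x xab; rewrite /= patchE xab.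
Qed.

Lemma cont_L2 a b u : continuous u -> L2 a b u.
Proof.
move=> cu; have mu0 : measurable_fun [set: R] (u \_ `]a, b[).
  apply/(measurable_restrictT _ _).1 => //.
  exact: measurable_funTS (continuous_measurable_fun cu).
rewrite /L2 inE; apply/andP; split; first by rewrite inE.
rewrite inE /= /finite_norm unlock poweR_lty//.
have ci : mu.-integrable `]a, b[ (EFin \o (fun s => u s ^+ 2)).
  by apply: cont_integrable_oo; cont.
have /integrableP[_] := ci; apply: le_lt_trans.
rewrite [leRHS]integral_mkcond le_eqVlt; apply/orP; left; apply/eqP.
apply: eq_integral => x _; rewrite /= !patchE; case: ifP => _ /=.
  by rewrite powR_mulrn// normrX.
by rewrite normr0 powR0// normr0.
Qed.

Lemma integrable_ooD a b f g : mu.-integrable `]a, b[ (EFin \o f) ->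
  mu.-integrable `]a, b[ (EFin \o g) ->
  mu.-integrable `]a, b[ (EFin \o (fun s => f s + g s)).
Proof. by move=> i j; apply: eq_integrable (integrableD _ i j). Qed.

Lemma integrable_ooZ a b c f : mu.-integrable `]a, b[ (EFin \o f) ->
  mu.-integrable `]a, b[ (EFin \o (fun s => c * f s)).
Proof. by move=> i; apply: eq_integrable (integrableZl _ c i). Qed.

Section Fixed.
Variables (a b : R) (v : R -> R).
Hypothesis mv : measurable_fun `]a, b[ v.
Hypothesis v2 : mu.-integrable `]a, b[ (EFin \o (fun s => v s ^+ 2)).

Lemma sq_integrable_mul phi : continuous phi ->
  mu.-integrable `]a, b[ (EFin \o (fun s => v s * phi s)).
Proof.
move=> cp; have cp2 : continuous (fun s => phi s ^+ 2) by cont.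
have i1 := integrable_ooD v2 (cont_integrable_oo a b cp2).
apply: le_integrable i1 => //.
  apply/measurable_EFinP; apply: measurable_funM => //.
  exact: measurable_funTS (continuous_measurable_fun cp).
move=> x _ /=; rewrite lee_fin normrM [leRHS]ger0_norm; last by rewrite addr_ge0 ?sqr_ge0.
have := sqr_ge0 (`|v x| - `|phi x|); have := sqr_ge0 (v x); have := sqr_ge0 (phi x).
by rewrite -[phi x ^+ 2]real_normK ?num_real// -[v x ^+ 2]real_normK ?num_real//; nra.
Qed.

Lemma sq_integrable : mu.-integrable `]a, b[ (EFin \o v).
Proof.
have := sq_integrable_mul (@cst_cont R 1); apply: eq_integrable => // x _ /=.
by rewrite mulr1.
Qed.

Lemma sq_integrable_norm : mu.-integrable `]a, b[ (EFin \o (fun s => `|v s|)).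
Proof. exact: integrable_norm sq_integrable. Qed.

Definition pair phi := Rintegral mu `]a, b[ (fun s => v s * phi s).

Lemma pairD phi psi : continuous phi -> continuous psi ->
  pair (fun s => phi s + psi s) = pair phi + pair psi.
Proof.
move=> cp cq; rewrite /pair -RintegralD//; try exact: sq_integrable_mul.
by apply: eq_Rintegral => x _; rewrite mulrDr.
Qed.

Lemma pairZ c phi : continuous phi -> pair (fun s => c * phi s) = c * pair phi.
Proof.
move=> cp; rewrite /pair -RintegralZl//; try exact: sq_integrable_mul.
by apply: eq_Rintegral => x _; rewrite mulrCA.
Qed.

Lemma pair_abs phi c : continuous phi -> (forall x, a < x < b -> `|phi x| <= c) ->
  `|pair phi| <= c * Rintegral mu `]a, b[ (fun s => `|v s|).
Proof.
move=> cp pc; have i := sq_integrable_mul cp.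
apply: (le_trans (le_normr_Rintegral _ i)) => //.
rewrite -RintegralZl//; last exact: sq_integrable_norm.
apply: le_Rintegral => //.
- exact: (integrable_norm i).
- exact: (integrable_ooZ c sq_integrable_norm).
- by move=> x /=; rewrite in_itv /= => /pc h; rewrite normrM mulrC ler_wpM2r.
Qed.

(** The expression is the integral of [(c v - phi)^2]; the factor [c] will carry the rescaling of a
    second derivative. *)
Lemma pair_sq_ge0 c phi : continuous phi -> a <= b ->
  0 <= c ^+ 2 * Rintegral mu `]a, b[ (fun s => v s ^+ 2) - 2 * c * pair phi
    + integ (fun s => phi s ^+ 2) a b.
Proof.
move=> cp ab; have cp2 : continuous (fun s => phi s ^+ 2) by cont.
have i1 := sq_integrable_mul cp; have i2 := cont_integrable_oo a b cp2.
have j1 := integrable_ooZ (c ^+ 2) v2; have j2 := integrable_ooZ (- (2 * c)) i1.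
have j3 := integrable_ooD j1 j2.
have -> : c ^+ 2 * Rintegral mu `]a, b[ (fun s => v s ^+ 2) - 2 * c * pair phi
    + integ (fun s => phi s ^+ 2) a b =
  Rintegral mu `]a, b[ (fun s => c ^+ 2 * v s ^+ 2 + - (2 * c) * (v s * phi s) + phi s ^+ 2).
  rewrite -(Rintegral_oo cp2 ab) (RintegralD _ j3 i2)// (RintegralD _ j1 j2)//.
  by rewrite (RintegralZl _ _ v2)// (RintegralZl _ _ i1)// /pair mulNr.
apply: Rintegral_ge0 => x _.
have -> : c ^+ 2 * v x ^+ 2 + - (2 * c) * (v x * phi x) + phi x ^+ 2 = (c * v x - phi x) ^+ 2 by ring.
exact: sqr_ge0.
Qed.

End Fixed.

End SquareIntegrable.

(** * Smoothed Dirac masses, steps and ramps *)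

Section Mollifier.
Variable R : realType.
Local Notation mu := (@lebesgue_measure R).
Implicit Types (f g u v phi : R -> R) (x y s n e l p : R).
Variable b : R -> R.
Hypotheses (bsm : smooth b) (b_ge0 : forall x, 0 <= b x)
  (b_out : forall x, 1 <= `|x| -> b x = 0) (b_mass : integ b (-1) 1 = 1).

Let cb : continuous b. Proof. exact: smooth_cont. Qed.

(** First and second primitives of the bump: smooth versions of the unit step and of the positive
    part. *)
Definition ramp1 x := integ b (-1) x.
Definition ramp x := integ ramp1 (-1) x.
Definition pos_part x := 2^-1 * (x + `|x|).

Lemma der_ramp1 : der ramp1 b. Proof. exact: der_integ. Qed.
Lemma ramp1_cont : continuous ramp1. Proof. exact: der_continuous der_ramp1. Qed.
Lemma der_ramp : der ramp ramp1. Proof. exact: der_integ ramp1_cont. Qed.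

Lemma ramp1_smooth : smooth ramp1. Proof. exact: smooth_of_der der_ramp1 bsm. Qed.

Lemma integ_b_out x y : x <= y -> (y <= -1) \/ (1 <= x) -> integ b x y = 0.
Proof.
move=> xy H; rewrite -(mul0r (y - x)) -integ_cst; apply: eq_integ => //; first exact: cst_cont.
move=> z /andP[xz zy]; apply: b_out; case: H => H.
  by rewrite ler0_norm; lra.
by rewrite ger0_norm; lra.
Qed.

Lemma ramp1_left x : x <= -1 -> ramp1 x = 0.
Proof. by move=> x1; rewrite /ramp1 integ_swap integ_b_out ?oppr0//; left. Qed.

Lemma ramp1_right x : 1 <= x -> ramp1 x = 1.
Proof.
by move=> x1; rewrite /ramp1 (integ_cat _ _ 1) b_mass integ_b_out ?addr0//; right.
Qed.

Lemma ramp1_mono x y : x <= y -> ramp1 x <= ramp1 y.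
Proof.
by move=> xy; rewrite /ramp1 (integ_cat b (-1) x y) lerDl integ_ge0.
Qed.

Lemma ramp1_01 x : 0 <= ramp1 x <= 1.
Proof.
apply/andP; split.
  case: (leP x (-1)) => [/ramp1_left->//|h].
  by rewrite -(@ramp1_left (-1)) ?lexx// ramp1_mono// ltW.
case: (leP 1 x) => [/ramp1_right->//|h].
by rewrite -(@ramp1_right 1) ?lexx// ramp1_mono// ltW.
Qed.

Lemma ramp_left x : x <= -1 -> ramp x = 0.
Proof.
move=> x1; rewrite /ramp integ_swap -[in RHS]oppr0; congr (- _).
rewrite -(mul0r (-1 - x)) -integ_cst; have h := ramp1_cont.
apply: eq_integ => //; first exact: cst_cont.
by move=> z /andP[_ z1]; exact: ramp1_left.
Qed.

Lemma ramp_right x : 1 <= x -> ramp x = ramp 1 + (x - 1).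
Proof.
move=> x1; rewrite /ramp (integ_cat _ _ 1); congr (_ + _).
rewrite -[RHS]mul1r -integ_cst; have h := ramp1_cont.
apply: eq_integ => //; first exact: cst_cont.
by move=> z /andP[z1 _]; exact: ramp1_right.
Qed.

Lemma ramp_pos_part x : `|ramp x - pos_part x| <= 2.
Proof.
have h := ramp1_cont.
have bd y : -1 <= y <= 1 -> 0 <= ramp y <= 2.
  move=> /andP[y1 y2]; apply/andP; split.
    by apply: integ_ge0 => // z _; case/andP: (ramp1_01 z).
  have -> : 2 = 1 * (1 - -1) :> R by ring.
  apply: (@le_trans _ _ (1 * (y - -1))); last by lra.
  rewrite -integ_cst; apply: le_integ => //; first exact: cst_cont.
  by move=> z _; case/andP: (ramp1_01 z).
rewrite /pos_part; case: (leP x (-1)) => x1.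
  by rewrite ramp_left// (@ler0_norm _ x); [rewrite subrr mulr0 subrr normr0|lra].
case: (leP 1 x) => x2.
  have i1 : -1 <= 1 :> R by lra.
  have := bd 1; rewrite lexx i1 => /(_ isT)/andP[? ?].
  by rewrite ramp_right// (@ger0_norm _ x); [rewrite ler_norml; lra|lra].
have ix : -1 <= x <= 1 by lra.
have /andP[? ?] := bd x ix.
by rewrite ler_norml; case: (ger0P x) => ?; lra.
Qed.

(** A smoothed Dirac mass at [n] of width [e], followed by its first and second primitives. *)
Definition mol e n s := e^-1 * b (e^-1 * (s - n)).
Definition mol1 e n s := ramp1 (e^-1 * (s - n)).
Definition mol2 e n s := e * ramp (e^-1 * (s - n)).

Lemma mol_cont e n : continuous (mol e n).
Proof.
have h : continuous (fun s => b (e^-1 * (s - n))) by apply: comp_cont => //; cont.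
by rewrite /mol; cont.
Qed.

Lemma der_mol1 e n : der (mol1 e n) (mol e n).
Proof. by have h := der_ramp1; move=> s; rewrite /mol1; isd_by; rewrite /mol; ring. Qed.

Lemma der_mol2 e n : 0 < e -> der (mol2 e n) (mol1 e n).
Proof.
move=> e0; have h := der_ramp; move=> s; rewrite /mol2; isd_by; rewrite /mol1.
by field; rewrite gt_eqF.
Qed.

Lemma mol1_smooth e n : smooth (mol1 e n).
Proof.
apply: Cn_smooth => k; rewrite /mol1.
have -> : (fun s => ramp1 (e^-1 * (s - n))) = (fun s => ramp1 (e^-1 * s + - (e^-1 * n))).
  by apply/funext => s; rewrite mulrBr.
exact/Cn_affine/smooth_Cn/ramp1_smooth.
Qed.

Lemma mol2_smooth e n : 0 < e -> smooth (mol2 e n).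
Proof. by move=> e0; exact: (smooth_of_der (@der_mol2 e n e0) (@mol1_smooth e n)). Qed.

Lemma mol1_left e n s : 0 < e -> s <= n - e -> mol1 e n s = 0.
Proof.
by move=> e0 h; apply: ramp1_left; rewrite ler_pdivrMl//; lra.
Qed.

Lemma mol1_right e n s : 0 < e -> n + e <= s -> mol1 e n s = 1.
Proof.
by move=> e0 h; apply: ramp1_right; rewrite ler_pdivlMl//; lra.
Qed.

Lemma mol2_left e n s : 0 < e -> s <= n - e -> mol2 e n s = 0.
Proof.
by move=> e0 h; rewrite /mol2 ramp_left ?mulr0//; rewrite ler_pdivrMl//; lra.
Qed.

Lemma mol2_right e n s : 0 < e -> n + e <= s -> mol2 e n s = s - n + e * (ramp 1 - 1).
Proof.
move=> e0 h; rewrite /mol2 ramp_right; last by rewrite ler_pdivlMl//; lra.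
by field; rewrite gt_eqF.
Qed.

Lemma mol2_pos_part e n s : 0 < e -> `|mol2 e n s - pos_part (s - n)| <= 2 * e.
Proof.
move=> e0; have -> : mol2 e n s - pos_part (s - n) =
    e * (ramp (e^-1 * (s - n)) - pos_part (e^-1 * (s - n))).
  rewrite mulrBr; congr (_ - _); rewrite /pos_part normrM gtr0_norm ?invr_gt0//.
  by field; rewrite gt_eqF.
by rewrite normrM gtr0_norm// mulrC ler_pM2r// ramp_pos_part.
Qed.

Lemma mol_eval g e n c y h : continuous g -> 0 < e -> e <= n <= c - e ->
  (forall s, `|s - n| <= e -> `|g s - y| <= h) ->
  `|integ (fun s => g s * mol e n s) 0 c - y| <= h.
Proof.
move=> cg e0 /andP[en nc] gy; have en0 : e^-1 != 0 by rewrite invr_eq0 gt_eqF.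
have cm := @mol_cont e n.
have cgb : continuous (fun t => g (e * t + n) * b t).
  by apply: mul_cont => //; apply: comp_cont => //; cont.
have -> : integ (fun s => g s * mol e n s) 0 c = integ (fun t => g (e * t + n) * b t) (-1) 1.
  have := @integ_affine R (fun t => e^-1 * (g (e * t + n) * b t)) e^-1 (- (e^-1 * n)) 0 c en0.
  have -> : (fun x => e^-1 * (g (e * (e^-1 * x + - (e^-1 * n)) + n) * b (e^-1 * x + - (e^-1 * n)))) =
      (fun s => g s * mol e n s).
    apply/funext => x; rewrite /mol mulrCA -mulrBr.
    have -> // : e * (e^-1 * (x - n)) + n = x by field; rewrite gt_eqF.
  move=> -> //; last by cont.
  rewrite integZ// invrK mulrA mulfV ?gt_eqF// mul1r.
  set L := e^-1 * 0 + _; set U := e^-1 * c + _.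
  have L1 : L <= -1 by rewrite /L mulr0 add0r lerN2 ler_pdivlMl//; lra.
  have U1 : 1 <= U by rewrite /U -mulrBr ler_pdivlMl//; lra.
  rewrite (integ_cat _ L (-1) U) (integ_cat _ (-1) 1 U).
  have z1 : integ (fun t => g (e * t + n) * b t) L (-1) = 0.
    rewrite -(mul0r (-1 - L)) -integ_cst; apply: eq_integ => //; first exact: cst_cont.
    by move=> t /andP[_ t1]; rewrite b_out ?mulr0// ler0_norm; lra.
  have z2 : integ (fun t => g (e * t + n) * b t) 1 U = 0.
    rewrite -(mul0r (U - 1)) -integ_cst; apply: eq_integ => //; first exact: cst_cont.
    by move=> t /andP[t1 _]; rewrite b_out ?mulr0// ger0_norm; lra.
  by rewrite z1 z2; lra.
have cge : continuous (fun t => g (e * t + n)) by apply: comp_cont => //; cont.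
have N11 : -1 <= 1 :> R by lra.
have yE c0 : c0 = integ (fun t => c0 * b t) (-1) 1 by rewrite integZ// b_mass mulr1.
rewrite [X in _ - X]yE -integB; [|by cont..].
apply: (le_trans (integ_abs _ N11)); first by cont.
rewrite [leRHS]yE; apply: le_integ => //; [by cont|by cont|].
move=> t /andP[t1 t2]; rewrite -mulrBl normrM (ger0_norm (b_ge0 t)) ler_wpM2r//.
by apply: gy; rewrite addrK normrM (gtr0_norm e0) ler_piMr ?(ltW e0)// ler_norml t1 t2.
Qed.

End Mollifier.

(** * Point values from weak second derivatives *)

Section TrapezoidPairing.
Variable R : realType.
Local Notation mu := (@lebesgue_measure R).
Implicit Types (f g u v phi : R -> R) (x y s n e l p : R).

Lemma test_functionW a b phi c d : smooth phi -> a < c -> d < b ->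
  (forall s, s <= c -> phi s = 0) -> (forall s, d <= s -> phi s = 0) ->
  test_function a b phi.
Proof.
move=> sm ac db H1 H2; split=> //; exists c, d; split=> // x.
rewrite in_itv /= negb_and -!ltNge => /orP[] h; [apply: H1|apply: H2]; exact: ltW.
Qed.

(* The second distributional derivative of the trapezoid is a combination of four Dirac masses. *)
Definition trapezoid l p s : R :=
  pos_part s - pos_part (s - p) - pos_part (s - (2 * l - p)) + pos_part (s - 2 * l).

Lemma pos_part_lip x y : `|pos_part x - pos_part y| <= `|x - y|.
Proof.
have := ler_dist_dist x y; rewrite /pos_part => h.
have -> : 2^-1 * (x + `|x|) - 2^-1 * (y + `|y|) = 2^-1 * ((x - y) + (`|x| - `|y|)) by ring.
rewrite normrM (@ger0_norm _ 2^-1) ?invr_ge0//.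
by have := ler_normD (x - y) (`|x| - `|y|); lra.
Qed.

Lemma pos_part_cont : continuous (@pos_part R).
Proof. by rewrite /pos_part; cont. Qed.

Lemma trapezoid_cont l p : continuous (trapezoid l p).
Proof.
have h := pos_part_cont.
have h1 c : continuous (fun s => pos_part (s - c)) by apply: comp_cont => //; cont.
by rewrite /trapezoid; cont; exact: h1.
Qed.

(** The trapezoid is not a test function, so it is replaced by a combination [chi] of smoothed
    ramps. The weak identity for [chi] yields four local means of [g], and both sides converge as
    the width [e] shrinks. *)
Lemma trapezoid_pairing l p g v : 0 < p <= l -> continuous g ->
  measurable_fun `]0, (2 * l)[ v ->
  mu.-integrable `]0, (2 * l)[ (EFin \o (fun s => v s ^+ 2)) ->
  is_weak_derivative 2 0 (2 * l) g v ->
  pair 0 (2 * l) v (trapezoid l p) = g 0 - g p - g (2 * l - p) + g (2 * l).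
Proof.
move=> /andP[p0 pl] cg mv v2 wd.
have [b [bsm b_ge0 b_out b_mass]] := bump_exists R.
have ct := @trapezoid_cont l p.
set W := Rintegral mu `]0, (2 * l)[ (fun s => `|v s|).
have W0 : 0 <= W by apply: Rintegral_ge0 => x _.
set T := g 0 - g p - _ + _.
apply/eqP; rewrite -subr_eq0 -normr_le0.
suff H h : 0 < h -> `|pair 0 (2 * l) v (trapezoid l p) - T| <= h.
  by apply/ler_addgt0Pr => h; rewrite add0r; exact: H.
move=> h0; have near_pt c : exists2 d, 0 < d & forall s, `|s - c| <= d -> `|g s - g c| <= h / 8.
  have h8 : 0 < h / 8 by lra.
  have /continuous_absP/(_ _ h8)[d d0 Hd] := cg c.
  exists (d / 2) => [|s sc]; first by lra.
  by apply/ltW/Hd; lra.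
have [d1 d10 g1] := near_pt 0; have [d2 d20 g2] := near_pt p.
have [d3 d30 g3] := near_pt (2 * l - p); have [d4 d40 g4] := near_pt (2 * l).
(* The factor 3 accommodates means of radius [e] about the outer kinks, themselves displaced by
   [2 e]. The errors are [12 e W <= 3/8 h] and four times [h / 8]. *)
have [e [e0 [e1 e2 e3 e4] e5 e7]] : exists e, [/\ 0 < e,
    [/\ 3 * e <= d1, 3 * e <= d2, 3 * e <= d3 & 3 * e <= d4], 2 * e <= p & 32 * e * W <= h].
  have hW : 0 < h / (32 * (W + 1)) by apply: divr_gt0 => //; lra.
  exists (Num.min (Num.min (Num.min (d1 / 3) (d2 / 3)) (Num.min (d3 / 3) (d4 / 3)))
    (Num.min (p / 2) (h / (32 * (W + 1))))).
  set e := Num.min _ _.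
  have three d : e <= d / 3 -> 3 * e <= d by rewrite ler_pdivlMr// mulrC.
  split; first by rewrite !lt_min hW !divr_gt0.
  - by split; apply: three; rewrite /e !ge_min lexx ?orbT.
  - by rewrite mulrC -ler_pdivlMr// /e !ge_min lexx ?orbT.
  - have : e <= h / (32 * (W + 1)) by rewrite /e !ge_min lexx ?orbT.
    rewrite ler_pdivlMr; last by lra.
    apply: le_trans; have -> : e * (32 * (W + 1)) = 32 * e * W + 32 * e by ring.
    by rewrite lerDl mulr_ge0// ltW// !lt_min hW !divr_gt0.
clear near_pt.
(* The outer kinks are moved inwards to [2 e] and [2 l - 2 e], so that [chi] vanishes near both
   ends; to the right of all kinks the linear parts and the offsets cancel. *)
pose chi s := mol2 b e (2 * e) s - mol2 b e p s - mol2 b e (2 * l - p) s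
  + mol2 b e (2 * l - 2 * e) s.
pose chi2 s := mol b e (2 * e) s - mol b e p s - mol b e (2 * l - p) s
  + mol b e (2 * l - 2 * e) s.
have cm n := @mol_cont R b bsm e n.
have cm2 n : continuous (mol2 b e n) := smooth_cont (@mol2_smooth R b bsm e n e0).
have cchi : continuous chi.
  by rewrite /chi; apply: add_cont => //; apply: add_cont; [apply: add_cont => //|]; exact/opp_cont.
have dchi : derive1n 2 chi = chi2.
  have D2 n := @der_mol2 R b bsm e n e0; have D1 n := @der_mol1 R b bsm e n.
  have A1 := D2 (2 * e); have A2 := D2 p; have A3 := D2 (2 * l - p); have A4 := D2 (2 * l - 2 * e).
  have B1 := D1 (2 * e); have B2 := D1 p; have B3 := D1 (2 * l - p); have B4 := D1 (2 * l - 2 * e).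
  have d_1 : der chi (fun s => mol1 b e (2 * e) s - mol1 b e p s - mol1 b e (2 * l - p) s
      + mol1 b e (2 * l - 2 * e) s).
    by move=> s; rewrite /chi; repeat isd_step.
  have d_2 : der (fun s => mol1 b e (2 * e) s - mol1 b e p s - mol1 b e (2 * l - p) s
      + mol1 b e (2 * l - 2 * e) s) chi2.
    by move=> s; repeat isd_step.
  by rewrite !derive1nS derive1n0 (der_derive1 d_1) (der_derive1 d_2).
have tchi : test_function 0 (2 * l) chi.
  apply: (@test_functionW 0 (2 * l) chi e (2 * l - e)); [|exact: e0|by move: e0; clear; lra| |].
  - apply: Cn_smooth => k; have S n := smooth_Cn k (@mol2_smooth R b bsm e n e0).
    by apply: Cn_add => //; apply: Cn_add; [apply: Cn_add => //|]; exact: Cn_opp.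
  - move=> s se; have H n : 2 * e <= n -> mol2 b e n s = 0.
      by move=> hn; apply: mol2_left => //; move: se hn; clear; lra.
    by rewrite /chi !H; move: e0 e5 pl se; clear; lra.
  - move=> s se; have H n : n <= 2 * l - 2 * e -> mol2 b e n s = s - n + e * (ramp b 1 - 1).
      by move=> hn; apply: mol2_right => //; move: se hn; clear; lra.
    by rewrite /chi !H; move: e0 e5 pl se; clear; lra.
have := wd chi tchi; rewrite dchi sqrrN expr1n mul1r.
rewrite -/(pair 0 (2 * l) v chi).
have cgchi n : continuous (fun s => g s * mol b e n s) by apply: mul_cont.
have cgc : continuous (fun s => g s * chi2 s).
  apply: mul_cont => //; rewrite /chi2.
  by apply: add_cont => //; apply: add_cont; [apply: add_cont => //|]; exact/opp_cont.
have l2 : 0 <= 2 * l by lra.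
rewrite (Rintegral_oo cgc l2).
have -> : integ (fun s => g s * chi2 s) 0 (2 * l) =
   integ (fun s => g s * mol b e (2 * e) s) 0 (2 * l) - integ (fun s => g s * mol b e p s) 0 (2 * l)
   - integ (fun s => g s * mol b e (2 * l - p) s) 0 (2 * l)
   + integ (fun s => g s * mol b e (2 * l - 2 * e) s) 0 (2 * l).
  have c1 := add_cont (cgchi (2 * e)) (opp_cont (cgchi p)).
  have c2 := add_cont c1 (opp_cont (cgchi (2 * l - p))).
  rewrite -integB// -integB// -integD//.
  by congr (integ _ 0 _); apply/funext => s; rewrite /chi2; ring.
have m1 : `|integ (fun s => g s * mol b e (2 * e) s) 0 (2 * l) - g 0| <= h / 8.
  apply: mol_eval => //; first by move: e0 e5 pl; clear; lra.
  by move=> s; rewrite ler_norml => hs; apply: g1; rewrite subr0 ler_norml; move: hs e0 e1; clear; lra.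
have m2 : `|integ (fun s => g s * mol b e p s) 0 (2 * l) - g p| <= h / 8.
  apply: mol_eval => //; first by move: e0 e5 pl; clear; lra.
  by move=> s hs; apply: g2; move: hs e0 e2; clear; lra.
have m3 : `|integ (fun s => g s * mol b e (2 * l - p) s) 0 (2 * l) - g (2 * l - p)| <= h / 8.
  apply: mol_eval => //; first by move: e0 e5 pl; clear; lra.
  by move=> s hs; apply: g3; move: hs e0 e3; clear; lra.
have m4 : `|integ (fun s => g s * mol b e (2 * l - 2 * e) s) 0 (2 * l) - g (2 * l)| <= h / 8.
  apply: mol_eval => //; first by move: e0 e5 pl; clear; lra.
  by move=> s; rewrite ler_norml => hs; apply: g4; rewrite ler_norml; move: hs e0 e4; clear; lra.
move=> eqn.
have dif : `|pair 0 (2 * l) v (fun s => chi s + -1 * trapezoid l p s)| <= 12 * e * W.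
  apply: (pair_abs mv v2); first by cont.
  move=> s _; rewrite /chi /trapezoid.
  have q1 := @mol2_pos_part R b bsm b_ge0 b_out b_mass e (2 * e) s e0.
  have q2 := @mol2_pos_part R b bsm b_ge0 b_out b_mass e p s e0.
  have q3 := @mol2_pos_part R b bsm b_ge0 b_out b_mass e (2 * l - p) s e0.
  have q4 := @mol2_pos_part R b bsm b_ge0 b_out b_mass e (2 * l - 2 * e) s e0.
  have q5 := pos_part_lip (s - 2 * e) s.
  have q6 := pos_part_lip (s - (2 * l - 2 * e)) (s - 2 * l).
  have r1 : `|s - 2 * e - s| <= 2 * e by rewrite ler_norml; move: e0; clear; lra.
  have r2 : `|s - (2 * l - 2 * e) - (s - 2 * l)| <= 2 * e by rewrite ler_norml; move: e0; clear; lra.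
  move: q1 q2 q3 q4 (le_trans q5 r1) (le_trans q6 r2); rewrite !ler_norml; move: e0; clear; lra.
have ctN : continuous (fun s => -1 * trapezoid l p s) by cont.
move: dif; rewrite (pairD mv v2)// (pairZ mv v2)//.
move: eqn m1 m2 m3 m4; rewrite /T.
set A := integ _ _ _; set B := integ _ _ _; set C := integ _ _ _; set D := integ _ _ _.
set P := pair _ _ _ chi; set Q := pair _ _ _ _.
by rewrite !ler_norml; move: e7; clear; lra.
Qed.

End TrapezoidPairing.

(** * Uniqueness of weak derivatives *)

Section WeakDerivatives.
Variable R : realType.
Local Notation mu := (@lebesgue_measure R).
Implicit Types (f g u v w z phi : R -> R) (a b c x y s e : R).

Lemma test_function_derive1 a b phi : test_function a b phi ->
  test_function a b (derive1 phi).
Proof.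
move=> [sm [c [d [ac db p0]]]]; split; first exact: smooth_derive1.
exists c, d; split=> // x xcd; rewrite derive1E.
have H : isd phi x 0.
  apply: near_eq_is_derive (isd_cst 0 x).
  move: xcd; rewrite in_itv /= negb_and -!ltNge => /orP[] h.
    have e0 : 0 < c - x by lra.
    apply: (nbhs_abs e0) => y; rewrite ltr_norml => hy; rewrite p0//.
    by rewrite in_itv /= negb_and -!ltNge; apply/orP; left; lra.
  have e0 : 0 < x - d by lra.
  apply: (nbhs_abs e0) => y; rewrite ltr_norml => hy; rewrite p0//.
  by rewrite in_itv /= negb_and -!ltNge; apply/orP; right; lra.
by case: H.
Qed.

Lemma test_function_derive1n k a b phi : test_function a b phi ->
  test_function a b (derive1n k phi).
Proof.
by move=> tp; elim: k => [|k IH]; rewrite ?derive1n0// derive1nS; exact: test_function_derive1.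
Qed.

Lemma test_function_boundary a b phi : test_function a b phi -> phi a = 0 /\ phi b = 0.
Proof.
move=> [_ [c [d [ac db p0]]]]; split; apply: p0; rewrite in_itv /= negb_and -!ltNge.
  by rewrite ac.
by rewrite db orbT.
Qed.

Lemma smooth_weak_derivative k a b f : a <= b -> smooth f ->
  is_weak_derivative k a b f (derive1n k f).
Proof.
move=> ab; elim: k f => [f sf phi _|k IH f sf phi tp].
  by rewrite !derive1n0 expr0 mul1r.
have tk := test_function_derive1n k tp; have [tka tkb] := test_function_boundary tk.
have d1 := smooth_der sf; have d2 := smooth_der tk.1.
have cf := smooth_cont sf; have cf1 := smooth_cont (smooth_derive1 sf).
have cp := smooth_cont tk.1; have cp1 := smooth_cont (smooth_derive1 tk.1).
have c1 : continuous (fun s => f s * derive1n k.+1 phi s).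
  by rewrite derive1nS; cont.
have c2 : continuous (fun s => derive1 f s * derive1n k phi s) by cont.
have := IH (derive1 f) (smooth_derive1 sf) phi tp.
rewrite (derive1Sn f) exprS -mulrA => <-.
rewrite (Rintegral_oo c1 ab) (Rintegral_oo c2 ab) derive1nS.
by rewrite (integ_by_parts _ _ d1 d2)// tka tkb; lra.
Qed.

Section Null.
Variables (l : R) (z : R -> R).
Local Notation D := (`]0, l[%classic : set R).
Hypothesis mz : measurable_fun D z.
Hypothesis z2 : mu.-integrable D (EFin \o (fun s => z s ^+ 2)).
Hypothesis z_null : forall phi, test_function 0 l phi -> pair 0 l z phi = 0.

Lemma null_step x y : 0 < x -> x < y -> y < l ->
  Rintegral mu `]x, y] z = 0.
Proof.
move=> x0 xy yl.
have [b [bsm b_ge0 b_out b_mass]] := bump_exists R.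
pose r := (l - y) / 4; have r0 : 0 < r by rewrite /r; lra.
pose e n := r / n.+1%:R.
have e0 n : 0 < e n by rewrite divr_gt0// ltr0n.
have er n : e n <= r by rewrite ler_pdivrMr ?ltr0n// ler_peMr ?ler1n// ltW.
(* Steps centred [e n] to the right of [x] and of [y] vanish up to these points, so the limit is
   exactly the indicator of []x, y]]; dominated convergence then transfers the vanishing pairing. *)
pose chi n s := mol1 b (e n) (x + e n) s - mol1 b (e n) (y + e n) s.
have sm1 n c : smooth (mol1 b (e n) c) := @mol1_smooth R b bsm (e n) c.
have m01 n c s : 0 <= mol1 b (e n) c s <= 1.
  by rewrite /mol1 ramp1_01.
have left0 n c s : s <= c -> mol1 b (e n) (c + e n) s = 0.
  by move=> sc; rewrite mol1_left//; lra.
have right1 n c s : c + 2 * e n <= s -> mol1 b (e n) (c + e n) s = 1.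
  by move=> sc; rewrite mol1_right//; lra.
have schi n : smooth (chi n).
  apply: Cn_smooth => k.
  exact: Cn_add (smooth_Cn k (sm1 n (x + e n))) (Cn_opp (smooth_Cn k (sm1 n (y + e n)))).
have cchi n : continuous (chi n) := smooth_cont (schi n).
have tchi n : test_function 0 l (chi n).
  have er' := er n; apply: (test_functionW (c := x) (d := y + 2 * r) (schi n)) => //.
  - by rewrite /r; lra.
  - by move=> s sx; rewrite /chi !left0 ?subrr//; lra.
  - by move=> s sy; rewrite /chi !right1 ?subrr//; lra.
have iz := sq_integrable mz z2.
have izc n := sq_integrable_mul mz z2 (cchi n).
pose ind s := z s * (x < s <= y)%R%:R.
have lim s : chi n s @[n --> \oo] --> ((x < s <= y)%R%:R : R).
  have rn : (r / n.+1%:R) @[n --> \oo] --> (0 : R).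
    rewrite -[X in _ --> X](mulr0 r); apply: cvgM; first exact: cvg_cst.
    exact: cvg_harmonic.
  have big c : c < s -> \forall n \near \oo, mol1 b (e n) (c + e n) s = 1.
    move=> cs; have sc : 0 < (s - c) / 2 by lra.
    have /cvgrPdist_lt/(_ _ sc) := rn.
    apply: filterS => n; rewrite sub0r normrN => /ltr_normlW h.
    by move: h; rewrite -/(e n) => h; apply: right1; move: (e n) h => q h; lra.
  have small c : s <= c -> \forall n \near \oo, mol1 b (e n) (c + e n) s = 0.
    by move=> sc; apply: nearW => n; exact: left0.
  have fin A : (\forall n \near \oo, chi n s = A) -> chi n s @[n --> \oo] --> (A : R).
    by move=> h; apply: cvg_near_cst.
  apply: fin; case: (ltP x s) => xs.
    case: (leP s y) => sy /=.
      apply: filterS2 (big _ xs) (small _ sy) => n h1 h2.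
      by rewrite /chi h1 h2 subr0.
    apply: filterS2 (big _ xs) (big _ sy) => n h1 h2.
    by rewrite /chi h1 h2 subrr.
  apply: nearW => n; rewrite /chi !left0 ?subrr//; lra.
have := @dominated_convergence _ _ R mu D (measurable_itv _)
  (fun n => EFin \o (fun s => z s * chi n s)) (EFin \o ind) (EFin \o (fun s => `|z s|)).
case.
- by move=> n; exact: measurable_int (izc n).
- apply/measurable_EFinP/measurable_funM => //.
  have -> : (fun s : R => (x < s <= y)%R%:R : R) = \1_(`]x, y]).
    apply/funext => s; rewrite indicE; congr (_%:R); congr (nat_of_bool _).
    by apply/idP/idP; rewrite inE /= in_itv.
  exact: measurable_indic.
- apply: aeW => s _; apply: cvg_EFin; first by apply: nearW.
  apply: cvgM; first exact: cvg_cst.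
  exact: lim.
- exact: sq_integrable_norm.
- apply: aeW => s n _ /=; rewrite lee_fin normrM ler_piMr//.
  have /andP[? ?] := m01 n (x + e n) s; have /andP[? ?] := m01 n (y + e n) s.
  by rewrite ler_norml /chi; lra.
move=> iind _ cv.
have zero : (fun n => \int[mu]_(s in D) (z s * chi n s)%:E)%E = (fun=> 0%E).
  apply/funext => n; have := z_null (tchi n); rewrite /pair /Rintegral => h.
  by rewrite -[LHS]fineK; [rewrite h|exact: integrable_fin_num (izc n)].
have e1 : (\int[mu]_(s in D) (ind s)%:E)%E = 0%E.
  move: cv; rewrite /= zero => cv.
  by apply: (cvg_unique _ cv (cvg_cst _)); exact: ereal_hausdorff.
have e2 : Rintegral mu D ind = Rintegral mu `]x, y] z.
  have -> : `]x, y]%classic = D `&` `]x, y].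
    apply/seteqP; split=> s /=; rewrite !in_itv /=; last by case.
    by move=> /andP[h1 h2]; split; apply/andP; split=> //; lra.
  rewrite Rintegral_mkcondr; apply: eq_Rintegral => s _.
  rewrite /ind patchE; case: ifPn => [|]; rewrite ?inE /= ?notin_setE /= in_itv /= => h.
    by rewrite h mulr1.
  by move/negP/negbTE: h => ->; rewrite mulr0.
by rewrite -e2 /Rintegral e1.
Qed.

(** By [null_step] the indefinite integral of [z] is constant on the interval, while Lebesgue
    differentiation gives it the derivative [z] almost everywhere. *)
Lemma null_ae : {ae mu, forall s, D s -> z s = 0}.
Proof.
have iz := sq_integrable mz z2.
pose f := z \_ D.
have lf : locally_integrable [set: R] f by exact: integrable_locally.
have ifT : mu.-integrable setT (EFin \o f).
  by rewrite /f -restrict_EFin; apply/integrable_restrict => //=; rewrite setTI.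
have ify y : mu.-integrable `]-oo, y] (EFin \o f) by exact: integrableS ifT.
have := FTC1Ny ify lf; apply: filterS; first exact: (ae_filter_ringOfSetsType mu).
move=> s [dF Fs] /= sD.
have -> : z s = f s by rewrite /f patchE mem_set.
rewrite -Fs derive1E.
pose F x := Rintegral mu [set` `]-oo, x]] f.
move: sD; rewrite in_itv /= => /andP[s0 sl].
have Fc y : 0 < y < l -> F y = F s.
  have key x y' : 0 < x -> x < y' -> y' < l -> F y' = F x.
    move=> x0 xy yl; apply/eqP; rewrite -subr_eq0; apply/eqP.
    rewrite /F (Rintegral_itvB (ify y')) ?bnd_simp//; last exact: ltW.
    rewrite -[RHS](null_step x0 xy yl); apply: eq_Rintegral => t.
    rewrite inE /= in_itv /= => /andP[h1 h2].
    rewrite /f patchE mem_set//= in_itv /=; apply/andP; split; lra.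
  move=> /andP[y0 yl]; case: (ltgtP y s) => [ys|sy|->//].
    by rewrite (key y s).
  by rewrite (key s y).
have H : isd F s 0.
  apply: near_eq_is_derive (isd_cst (F s) s).
  have e0 : 0 < Num.min s (l - s) by rewrite lt_min s0 subr_gt0.
  apply: (nbhs_abs e0) => y; rewrite ltr_norml => h; apply/esym/Fc; move: h.
  by case: (leP s (l - s)) => *; lra.
by case: H.
Qed.

End Null.

(** [weak_derivative] is an arbitrary choice; two choices agree almost everywhere, so the energy can
    be computed with any weak derivative at hand. *)
Lemma weak_derivative_energy k (l : R) f v w :
  L2 0 l v -> L2 0 l w -> is_weak_derivative k 0 l f v -> is_weak_derivative k 0 l f w ->
  Rintegral mu `]0, l[ (fun s => v s ^+ 2) = Rintegral mu `]0, l[ (fun s => w s ^+ 2).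
Proof.
move=> /L2_integrable[mv v2] /L2_integrable[mw w2] wv ww.
pose z s := v s - w s.
have mz : measurable_fun `]0, l[ z by exact: measurable_funB.
have z2 : mu.-integrable `]0, l[ (EFin \o (fun s => z s ^+ 2)).
  have i := integrable_ooD (integrable_ooZ 2 v2) (integrable_ooZ 2 w2).
  apply: le_integrable i => //; first by apply/measurable_EFinP/measurable_funX.
  move=> s _ /=; rewrite lee_fin ger0_norm ?sqr_ge0// [leRHS]ger0_norm.
    by have := sqr_ge0 (v s + w s); rewrite /z; nra.
  by rewrite addr_ge0// mulr_ge0// sqr_ge0.
have zn phi : test_function 0 l phi -> pair 0 l z phi = 0.
  move=> tp; have cp := smooth_cont tp.1.
  have -> : pair 0 l z phi = pair 0 l v phi - pair 0 l w phi.
    rewrite /pair -RintegralB//; [|exact: sq_integrable_mul|exact: sq_integrable_mul].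
    by apply: eq_Rintegral => s _; rewrite /z mulrBl.
  have := wv phi tp; rewrite (ww phi tp) -/(pair 0 l v phi) -/(pair 0 l w phi).
  have s0 : (-1) ^+ k != 0 :> R by rewrite signr_eq0.
  by move/(mulfI s0) => ->; rewrite subrr.
have ae := null_ae mz z2 zn.
congr fine; apply: ae_eq_integral => //.
- exact: measurable_int v2.
- exact: measurable_int w2.
move: ae; apply: filterS; first exact: (ae_filter_ringOfSetsType mu).
move=> s h Ds /=.
by have := h Ds; rewrite /z => /subr0_eq ->.
Qed.

End WeakDerivatives.

(** * Admissible angles as competitors *)

Section Admissible.
Variable R : realType.
Local Notation mu := (@lebesgue_measure R).
Implicit Types (f g u v w phi th : R -> R) (a b c x y s t l p q Phi lam : R).

(** The inner map clamps [s] to [0, c]: an angle constrained only on its interval becomes a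
    continuous function on the line. *)
Lemma within_clamp_cont f c : 0 <= c -> {within `[0, c], continuous f} ->
  continuous (fun s => f (- Num.min (- Num.min c s) 0)).
Proof.
move=> c0 /subspace_continuousP cf s.
pose k s := - Num.min (- Num.min c s) 0.
have ck : continuous k by rewrite /k; cont.
have k01 y : 0 <= k y <= c.
  by rewrite /k; case: (leP c y) => ?; [case: (leP (- c) 0)|case: (leP (- y) 0)] => ?; apply/andP; split; lra.
have ks : `[0, c]%classic (k s) by rewrite /= in_itv /=; exact: k01.
apply/continuous_absP => e e0.
have /cvgrPdist_lt/(_ e e0) := cf (k s) ks.
rewrite near_withinE => /nbhs_absP[d d0 Hd].
have /continuous_absP/(_ d d0)[d' d'0 Hd'] := ck s.
exists d' => // y /Hd' ys.
by rewrite distrC; apply: Hd => //=; rewrite in_itv /=; exact: k01.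
Qed.

Lemma weak_derivativeP k l u : sobolev k 0 l u ->
  L2 0 l (weak_derivative k 0 l u) /\ is_weak_derivative k 0 l u (weak_derivative k 0 l u).
Proof.
move=> [_ H]; have [g gL gw] := H k (leqnn k).
exact: (@getPex _ [set g | L2 0 l g /\ is_weak_derivative k 0 l u g]) (ex_intro _ g (conj gL gw)).
Qed.

Lemma sobolev_smooth m l f : 0 <= l -> smooth f -> sobolev m 0 l f.
Proof.
move=> l0 sf; split; first exact/cont_L2/smooth_cont.
move=> k _; exists (derive1n k f); last exact: smooth_weak_derivative.
by apply/cont_L2/smooth_cont => j s; have := sf (j + k)%N s; rewrite /derive1n iterD.
Qed.

(* Folds the doubled arc onto the half arc, rescaled to [0, 1]. *)
Definition fold l s : R := 1 - `|1 - l^-1 * s|.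

Lemma fold_cont l : continuous (fold l).
Proof. by rewrite /fold; cont. Qed.

Lemma integ_fold l h : 0 < l -> continuous h ->
  integ (fun s => h (fold l s)) 0 (2 * l) = 2 * l * integ h 0 1.
Proof.
move=> l0 ch; have lV : l^-1 != 0 by rewrite invr_eq0 gt_eqF.
have cw : continuous (fun t => h (1 - `|1 - t|)) by apply: comp_cont => //; cont.
have := @integ_affine R (fun t => h (1 - `|1 - t|)) l^-1 0 0 (2 * l) lV cw.
have -> : (fun x => h (1 - `|1 - (l^-1 * x + 0)|)) = (fun s => h (fold l s)).
  by apply/funext => s; rewrite addr0.
move=> ->; rewrite invrK mulr0 addr0.
have -> : l^-1 * (2 * l) + 0 = 2 by field; rewrite gt_eqF.
rewrite (integ_cat _ 0 1 2).
have -> : integ (fun t => h (1 - `|1 - t|)) 0 1 = integ h 0 1.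
  apply: eq_integ => // t /andP[t0 t1]; rewrite ger0_norm; last by lra.
  by congr h; ring.
have -> : integ (fun t => h (1 - `|1 - t|)) 1 2 = integ h 0 1.
  have c2 : continuous (fun t => h (-1 * t + 2)) by apply: comp_cont => //; cont.
  have n1 : (-1 : R) != 0 by rewrite oppr_eq0 oner_eq0.
  have e := @integ_affine R h (-1) 2 1 2 n1 ch.
  rewrite (@eq_integ _ _ (fun t => h (-1 * t + 2)) 1 2)//; last 2 first.
  - by rewrite ler1n.
  - move=> t /andP[t1 t2]; rewrite ler0_norm; last by lra.
    by congr h; ring.
  rewrite e invrN1 mulN1r -integ_swap; congr (integ h _ _); ring.
ring.
Qed.

Section OneArc.
Variables (Phi l : R) (th : R -> R).
Hypothesis adm : admissible Phi l th.

Let l0 : 0 < l. Proof. by case: adm. Qed.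
Let v := weak_derivative 2 0 (2 * l) th.
Let vL : L2 0 (2 * l) v.
Proof. by case: adm => _ [/weak_derivativeP[]]. Qed.
Let vw : is_weak_derivative 2 0 (2 * l) th v.
Proof. by case: adm => _ [/weak_derivativeP[]]. Qed.
Let mv : measurable_fun `]0, (2 * l)[ v. Proof. by case: (L2_integrable vL). Qed.
Let v2 : mu.-integrable `]0, (2 * l)[ (EFin \o (fun s => v s ^+ 2)).
Proof. by case: (L2_integrable vL). Qed.

Let g s := th (- Num.min (- Num.min (2 * l) s) 0).
Let l20 : 0 <= 2 * l. Proof. by rewrite mulr_ge0// ltW. Qed.
Let cg : continuous g.
Proof. by case: adm => _ [_ cth] _ _ _; exact: within_clamp_cont. Qed.

Let gE s : 0 <= s <= 2 * l -> g s = th s.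
Proof.
move=> /andP[s0 s2]; rewrite /g; congr th.
case: (leP (2 * l) s) => ?; [case: (leP (- (2 * l)) 0)|case: (leP (- s) 0)] => ?; lra.
Qed.

Let gw : is_weak_derivative 2 0 (2 * l) g v.
Proof.
move=> phi tp; rewrite -(vw tp); apply: eq_Rintegral => s.
by rewrite inE /= in_itv /= => /andP[h1 h2]; rewrite gE// !ltW.
Qed.

(** Evenness is given almost everywhere; as [d] is continuous and nonnegative, its vanishing
    integral gives it everywhere. *)
Let g_even s : 0 <= s <= l -> g (l + s) = g (l - s).
Proof.
have hl := l0.
pose d s : R := `|g (l + s) - g (l - s)|.
have c1 : continuous (fun s => g (l + s)) by apply: comp_cont => //; cont.
have c2 : continuous (fun s => g (l - s)) by apply: comp_cont => //; cont.
have cd : continuous d by rewrite /d; cont.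
suff d0 : integ d 0 l = 0.
  move=> /(integ_eq0 cd l0 (fun s _ => normr_ge0 _) d0)/eqP.
  by rewrite normr_eq0 subr_eq0 => /eqP.
rewrite -(Rintegral_oo cd (ltW l0)) /Rintegral.
suff -> : (\int[mu]_(x in [set` `]0%R, l[%R]) (d x)%:E)%E = (\int[mu]_(x in [set` `]0%R, l[%R]) 0)%E.
  by rewrite integral0.
apply: ae_eq_integral => //.
  exact: measurable_int (cont_integrable_oo 0 l cd).
case: adm => _ _ _ ev _; move: ev; apply: filterS; first exact: (ae_filter_ringOfSetsType mu).
move=> t H /= tl; have := tl; rewrite in_itv /= => /andP[t0 tl'].
by rewrite /d !gE ?(H tl) ?subrr ?normr0//; lra.
Qed.

(** Both halves of the doubled arc are folded onto [0, 1] and averaged. With [s = l x] the factor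
    [l / 2] produces the [l^2] of the second derivative of the rescaled angle. *)
Let L phi := l / 2 * pair 0 (2 * l) v (fun s => phi (fold l s)).

Lemma admissible_energy_functional :
  energy_functional (l ^+ 3 / 2 * Rintegral mu `]0, (2 * l)[ (fun s => v s ^+ 2)) L.
Proof.
have cf phi : continuous phi -> continuous (fun s => phi (fold l s)).
  by move=> cp; apply: comp_cont => //; exact: fold_cont.
split=> [phi psi cp cq|c phi cp|phi cp]; rewrite /L.
- by rewrite (pairD mv v2 (cf _ cp) (cf _ cq)) mulrDr.
- by rewrite (pairZ mv v2 c (cf _ cp)) mulrCA.
have c2 : continuous (fun x => phi x ^+ 2) by cont.
have := @pair_sq_ge0 R 0 (2 * l) v mv v2 (l ^+ 2) _ (cf _ cp) l20.
rewrite (integ_fold l0 c2); set A := Rintegral _ _ _; set B := pair _ _ _ _.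
have -> : integ (fun x => phi x ^+ 2) 0 1 = ip phi phi.
  by congr (integ _ 0 1); apply/funext => x; rewrite expr2.
set C := ip _ _ => H.
have l2 : 0 < 2 * l by rewrite mulr_gt0// l0.
rewrite -subr_ge0 -(pmulr_rge0 _ l2); move: H; congr (0 <= _).
by field.
Qed.

(** The folded Green function is [- l^-1] times a trapezoid, so the pairing reads off the angle at
    0, at [l x], at its mirror point and at [2 l]. The end values add up to pi and evenness merges
    the other two. *)
Lemma admissible_arc x : 0 <= x <= 1 -> arc L x = g (l * x) - pi / 2.
Proof.
have hl := l0; have aL := admissible_energy_functional.
have [_ _ [th0 _ th2] _ _] := adm.
move=> /andP[]; rewrite le_eqVlt => /predU1P[<- _|x0 x1].
  by rewrite (arc_0 aL) mulr0 gE ?th0 ?subrr// lexx l20.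
have lx : 0 < l * x <= l by rewrite mulr_gt0// ler_piMr// ltW.
have tp := trapezoid_pairing lx cg mv v2 gw.
have ct := @trapezoid_cont R l (l * x).
have -> : arc L x = l / 2 * pair 0 (2 * l) v (fun s => - l^-1 * trapezoid l (l * x) s).
  rewrite /arc /L; congr (_ * _); apply: eq_Rintegral => s.
  rewrite inE /= in_itv /= => /andP[s0 s2]; congr (_ * _).
  pose t := l^-1 * s; have st : s = l * t by rewrite /t mulrA mulfV ?mul1r// gt_eqF.
  have t0 : 0 < t by rewrite mulr_gt0// invr_gt0.
  have t2 : t < 2 by rewrite /t mulrC ltr_pdivrMr.
  have pp c : pos_part (l * c) = l * pos_part c.
    by rewrite /pos_part normrM (gtr0_norm l0); ring.
  have -> : trapezoid l (l * x) s = l * (pos_part t - pos_part (t - x)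
      - pos_part (t - (2 - x)) + pos_part (t - 2)).
    rewrite /trapezoid st.
    have -> : l * t - l * x = l * (t - x) by ring.
    have -> : l * t - (2 * l - l * x) = l * (t - (2 - x)) by ring.
    have -> : l * t - 2 * l = l * (t - 2) by ring.
    by rewrite !pp; ring.
  rewrite mulrA mulNr mulVf ?gt_eqF// mulN1r /kernel /fold -/t /pos_part; congr (- _).
  rewrite (gtr0_norm t0) (@ltr0_norm _ (t - 2)); last by lra.
  case: (ger0P (t - x)) => h1; case: (ger0P (t - (2 - x))) => h2;
    case: (ger0P (1 - t)) => h3; case: leP => h4; lra.
rewrite (pairZ mv v2 _ ct) tp.
have -> : g (2 * l - l * x) = g (l * x).
  have -> : 2 * l - l * x = l + (l - l * x) by ring.
  rewrite g_even; first by congr g; ring.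
  by case/andP: lx => *; lra.
rewrite (gE (s := 0)) ?lexx ?l20// (gE (s := 2 * l)) ?lexx ?l20// th0 th2.
by field; rewrite gt_eqF.
Qed.

Lemma admissible_competitor p q : p <= Phi <= q ->
  competitor p q (l ^+ 3 / 2 * Rintegral mu `]0, (2 * l)[ (fun s => v s ^+ 2)) L.
Proof.
have hl := l0; have [_ _ [_ thl _] _ clos] := adm.
move=> pq; have aL := admissible_energy_functional; split=> //.
  rewrite admissible_arc ?ler01 ?lexx// mulr1 gE; last by apply/andP; split; lra.
  by rewrite thl addrC addKr.
have ca := arc_cont aL.
have cs : continuous (fun s => sin (g s)) by cont.
have csl : continuous (fun s => sin (g (l * s + 0))).
  by apply: (@comp_cont R (fun s => sin (g s))) => //; cont.
rewrite /defect (@eq_integ _ _ (fun x => sin (g (l * x + 0))) 0 1)//; last 2 first.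
- by cont.
- by move=> x x01; rewrite admissible_arc// cosBpihalf addr0.
rewrite (@integ_affine R (fun s => sin (g s)) l 0 0 1)//; last by rewrite gt_eqF.
rewrite mulr0 mulr1 !addr0 -(integ_Rint cs (ltW l0)).
have -> : Rintegral mu `[0, l] (fun s => sin (g s)) = 0; last by rewrite mulr0.
rewrite -[RHS]clos; apply: eq_Rintegral => s; rewrite inE /= in_itv /= => /andP[s0 sl].
by rewrite gE//; apply/andP; split; lra.
Qed.

End OneArc.

End Admissible.

(** * Minimality in the window class *)

Section Minimality.
Variable R : realType.
Variables (p kap : R) (F F1 F2 F3 : R -> R).
Hypothesis prof : profile p kap F F1 F2 F3.
Variable l : R.
Hypothesis l0 : 0 < l.
Local Notation mu := (@lebesgue_measure R).
Local Notation ang := (angle F l).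

Lemma angle_mid : ang l - pi / 2 = F 1.
Proof. by rewrite /angle mulVf ?gt_eqF// addrC addKr. Qed.

Lemma angle_admissible : admissible (F 1) l ang.
Proof.
have hl := l0; have F0 : F 0 = 0 by have := profile_odd prof 0; rewrite oppr0; lra.
have a0 : ang 0 = pi / 2 by rewrite /angle mulr0 F0 addr0.
have ca : continuous ang := angle_cont prof (l := l).
split=> //.
- split; first by apply: sobolev_smooth (angle_smooth prof l0); lra.
  exact: continuous_subspaceT.
- split=> //; first by rewrite -angle_mid addrC subrK.
  by have := angle_rev prof l0 l; rewrite subrr a0 => <-; congr ang; ring.
- by apply: aeW => s _; exact: (angle_rev prof l0).
- by rewrite (integ_Rint (sina_cont prof (l := l)) (ltW l0)); exact: (curve_y_mid prof l0).
Qed.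

Lemma doubled_energy_angle lam :
  doubled_energy lam l ang = ip F2 F2 / l ^+ 3 + 2 * lam * l.
Proof.
have hl := l0; have l2 : 0 <= 2 * l by lra.
have [_ [sob _] _ _ _] := angle_admissible.
have [vL vw] := weak_derivativeP sob.
have ca2 : continuous (angle2 F2 l) := angle2_cont prof (l := l).
have e2 : derive1n 2 ang = angle2 F2 l.
  by rewrite !derive1nS derive1n0 (der_derive1 (der_angle prof l))
    (der_derive1 (der_angle1 prof l)).
have wL : L2 0 (2 * l) (derive1n 2 ang) by rewrite e2; exact: cont_L2.
have ww : is_weak_derivative 2 0 (2 * l) ang (derive1n 2 ang).
  by apply: smooth_weak_derivative  => //; apply: (angle_smooth prof l0).
rewrite /doubled_energy (weak_derivative_energy vL wL vw ww) e2 Rintegral_oo//; last by cont.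
rewrite (bending_angle prof l0).1; congr (_ + _); field.
by rewrite gt_eqF.
Qed.

(** Every admissible pair of half-length [x] has energy at least [D / x^3 + 2 lam x], where [D] is
    the least bending. The chosen [l] is the critical point of this function of [x], and the excess
    over its value there carries the explicit factor [(x - l)^2]. *)
Lemma angle_minimiser lam : 0 < lam -> 2 * lam * l ^+ 4 = 3 * ip F2 F2 ->
  is_minimiser_on lam `[p, p + pi / 2] l ang.
Proof.
move=> lam0 eqM; have hl := l0; have /andP[t1 t2] := profile_turning prof; split.
  by exists (F 1); [rewrite /= in_itv /=; apply/andP; split; exact: ltW|exact: angle_admissible].
move=> x th [Phi]; rewrite /= in_itv /= => Ip adm.
have x0 : 0 < x by case: adm.
have /(profile_min prof) := admissible_competitor adm Ip.
rewrite doubled_energy_angle /doubled_energy.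
set W := Rintegral _ _ _ => MW.
have lamn : lam != 0 by rewrite gt_eqF.
apply: (@le_trans _ _ (ip F2 F2 / x ^+ 3 + 2 * lam * x)); last first.
  rewrite lerD2r ler_pdivrMr ?exprn_gt0//; apply: le_trans MW _.
  by rewrite le_eqVlt; apply/orP; left; apply/eqP; field.
have -> : ip F2 F2 = 2 * lam * l ^+ 4 / 3 by rewrite eqM; field.
rewrite -subr_ge0.
have -> : 2 * lam * l ^+ 4 / 3 / x ^+ 3 + 2 * lam * x -
  (2 * lam * l ^+ 4 / 3 / l ^+ 3 + 2 * lam * l) =
  2 * lam / 3 / x ^+ 3 * ((x - l) ^+ 2 * (3 * x ^+ 2 + 2 * x * l + l ^+ 2)).
  by field; rewrite !gt_eqF.
apply: mulr_ge0; first by rewrite ltW// !divr_gt0 ?mulr_gt0 ?exprn_gt0.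
by apply: mulr_ge0; [exact: sqr_ge0|rewrite ltW// !addr_gt0 ?mulr_gt0 ?exprn_gt0].
Qed.

Lemma J_angle lam : 2 * lam * l ^+ 4 = 3 * ip F2 F2 ->
  J lam (4 * l) (reflection_closure l ang) = 16 / 3 * lam * l.
Proof.
move=> eqM; rewrite (J_G prof l0) (bending_angle prof l0).2.
have -> : ip F2 F2 = 2 * lam * l ^+ 4 / 3 by rewrite eqM; field.
by field; rewrite gt_eqF.
Qed.

End Minimality.

(** * The first variation *)

Section Expansions.
Variable R : realType.
Implicit Types (f g : R -> R -> R) (a b : R -> R) (P K d e u : R).

(** First-order expansion in [e] with quadratic remainder, uniform for [u] in [0, P]. Such
    expansions are stable under products and, near 1, under square roots and inverses, and they
    integrate in [u]; they stand in for differentiation under the integral sign. *)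
Definition expands_by P K d f (f0 f1 : R -> R) : Prop :=
  forall u, 0 <= u <= P -> [/\ `|f0 u| <= K, `|f1 u| <= K &
    forall e, `|e| < d -> `|f e u - f0 u - e * f1 u| <= K * e ^+ 2].

Definition expands P f (f0 f1 : R -> R) : Prop :=
  exists K d, [/\ 0 < d, d <= 1 & expands_by P K d f f0 f1].

Lemma isd_quadratic_near (f0 : R -> R) c d : 0 < d -> (forall h : R, `|h| < d -> `|f0 h| <= c * h ^+ 2) ->
  isd f0 0 0.
Proof.
move=> d0 H; pose g h := if `|h| < d then f0 h else 0.
apply: (@near_eq_is_derive _ _ _ g); last first.
  apply: (@isd_quadratic _ g `|c|) => h; rewrite /g; case: ifP => hd; last first.
    by rewrite normr0 mulr_ge0 ?sqr_ge0.
  by apply: le_trans (H h hd) _; rewrite ler_wpM2r ?sqr_ge0// ler_norm.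
by apply: (nbhs_abs d0) => y; rewrite subr0 /g => ->.
Qed.

Lemma expands_by_le P K K' d d' f (f0 f1 : R -> R) : K <= K' -> d' <= d ->
  expands_by P K d f f0 f1 -> expands_by P K' d' f f0 f1.
Proof.
move=> KK dd H u uP; have [h1 h2 h3] := H u uP; split; [lra|lra|].
move=> e ed; apply: (@le_trans _ _ (K * e ^+ 2)); first by apply: h3; lra.
by rewrite ler_wpM2r// sqr_ge0.
Qed.

Lemma expands_common P f (f0 f1 : R -> R) g (g0 g1 : R -> R) : expands P f f0 f1 -> expands P g g0 g1 ->
  exists K d, [/\ 0 < d, d <= 1, 0 <= K & expands_by P K d f f0 f1 /\ expands_by P K d g g0 g1].
Proof.
move=> [K [d [d0 d1 H]]] [K' [d' [d'0 d'1 H']]].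
exists (Num.max 0 (Num.max K K')), (Num.min d d'); split.
- by rewrite lt_min d0.
- by rewrite ge_min d1.
- by rewrite le_max lexx.
split; [apply: (expands_by_le _ _ H)|apply: (expands_by_le _ _ H')].
- by rewrite !le_max lexx orbT.
- by rewrite ge_min lexx.
- by rewrite !le_max lexx !orbT.
- by rewrite ge_min lexx orbT.
Qed.

Lemma expands_affine P a b : 0 <= P -> continuous a -> continuous b ->
  expands P (fun e u => a u + e * b u) a b.
Proof.
move=> P0 ca cb; have [A _ Ab] := cont_bounded P0 ca; have [B _ Bb] := cont_bounded P0 cb.
exists (Num.max 0 (Num.max A B)), 1; split=> // u uP; split.
- by rewrite !le_max Ab ?orbT.
- by rewrite !le_max Bb ?orbT.
move=> e _; have -> : a u + e * b u - a u - e * b u = 0 by ring.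
rewrite normr0 mulr_ge0 ?sqr_ge0//.
by rewrite le_max lexx.
Qed.

Lemma expands_cst P c : 0 <= P -> expands P (fun _ _ => c) (fun _ => c) (fun _ => 0).
Proof.
move=> P0; have [K [d [d0 d1 H]]] := expands_affine P0 (@cst_cont R c) (@cst_cont R 0).
exists K, d; split=> // u uP; have [h1 h2 h3] := H u uP; split=> // e ed.
by have := h3 e ed; rewrite mulr0 addr0.
Qed.

Lemma expands_add P f (f0 f1 : R -> R) g (g0 g1 : R -> R) : expands P f f0 f1 -> expands P g g0 g1 ->
  expands P (fun e u => f e u + g e u) (fun u => f0 u + g0 u) (fun u => f1 u + g1 u).
Proof.
move=> ef eg; have [K [d [d0 d1 K0 [H H']]]] := expands_common ef eg.
exists (2 * K), d; split=> // u uP.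
have [h1 h2 h3] := H u uP; have [h1' h2' h3'] := H' u uP; split.
- by apply: le_trans (ler_normD _ _) _; lra.
- by apply: le_trans (ler_normD _ _) _; lra.
move=> e ed; have -> : f e u + g e u - (f0 u + g0 u) - e * (f1 u + g1 u) =
  (f e u - f0 u - e * f1 u) + (g e u - g0 u - e * g1 u) by ring.
by apply: le_trans (ler_normD _ _) _; have := h3 e ed; have := h3' e ed; lra.
Qed.

Lemma expands_mul P f (f0 f1 : R -> R) g (g0 g1 : R -> R) : expands P f f0 f1 -> expands P g g0 g1 ->
  expands P (fun e u => f e u * g e u) (fun u => f0 u * g0 u)
    (fun u => f1 u * g0 u + f0 u * g1 u).
Proof.
move=> ef eg; have [K [d [d0 d1 K0 [H H']]]] := expands_common ef eg.
exists (6 * K ^+ 2), d; split=> // u uP.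
have [h1 h2 h3] := H u uP; have [h1' h2' h3'] := H' u uP.
have K2 : 0 <= K ^+ 2 by exact: sqr_ge0.
have mul_le (x y : R) : `|x| <= K -> `|y| <= K -> `|x * y| <= K ^+ 2.
  by move=> ? ?; rewrite normrM expr2 ler_pM.
split.
- by apply: le_trans (mul_le _ _ h1 h1') _; lra.
- by apply: le_trans (ler_normD _ _) _; have := mul_le _ _ h2 h1'; have := mul_le _ _ h1 h2'; lra.
move=> e ed; have e1 : `|e| <= 1 by lra.
have E := h3 e ed; have E' := h3' e ed.
have e2 : 0 <= e ^+ 2 <= 1.
  by rewrite sqr_ge0 -[e ^+ 2]ger0_norm ?sqr_ge0// normrX expr_le1.
have gb : `|g e u| <= 3 * K.
  have -> : g e u = (g e u - g0 u - e * g1 u) + (g0 u + e * g1 u) by ring.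
  apply: le_trans (ler_normD _ _) _; have := ler_normD (g0 u) (e * g1 u).
  have : `|e * g1 u| <= K by rewrite normrM -[leRHS]mul1r ler_pM.
  have : K * e ^+ 2 <= K by rewrite -[leRHS]mulr1 ler_wpM2l//; case/andP: e2.
  by lra.
have fb : `|f0 u + e * f1 u| <= 2 * K.
  have := ler_normD (f0 u) (e * f1 u).
  have : `|e * f1 u| <= K by rewrite normrM -[leRHS]mul1r ler_pM.
  by lra.
(* The remainder of [f] meets all of [g], of size [3 K]; the affine part of [f], of size [2 K],
   meets the remainder of [g]; with the product of the slopes this gives 3 + 2 + 1 = 6. *)
have -> : f e u * g e u - f0 u * g0 u - e * (f1 u * g0 u + f0 u * g1 u) =
  (f e u - f0 u - e * f1 u) * g e u + (f0 u + e * f1 u) * (g e u - g0 u - e * g1 u)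
  + f1 u * g1 u * e ^+ 2 by ring.
apply: le_trans (ler_normD _ _) _; apply: (@le_trans _ _ ((K * e ^+ 2) * (3 * K) + (2 * K) * (K * e ^+ 2) + K ^+ 2 * e ^+ 2)); last first.
  by rewrite le_eqVlt; apply/orP; left; apply/eqP; ring.
apply: lerD; first (apply: le_trans (ler_normD _ _) _; apply: lerD).
- by rewrite normrM ler_pM.
- by rewrite normrM ler_pM.
by rewrite normrM [`|e ^+ 2|]ger0_norm ?sqr_ge0// ler_wpM2r ?sqr_ge0// mul_le.
Qed.

Lemma expands_exp P f (f0 f1 : R -> R) n : expands P f f0 f1 ->
  expands P (fun e u => f e u ^+ n.+1) (fun u => f0 u ^+ n.+1)
    (fun u => n.+1%:R * (f0 u ^+ n * f1 u)).
Proof.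
move=> ef; elim: n => [|n IH].
  move: ef; rewrite /expands /expands_by => -[K [d [d0 d1 H]]]; exists K, d; split=> // u uP.
  by have := H u uP; rewrite expr0 !mul1r.
have [K [d [d0 d1 H]]] := expands_mul ef IH; exists K, d; split=> // u uP.
have [h1 h2 h3] := H u uP.
have eq1 : f1 u * f0 u ^+ n.+1 + f0 u * (n.+1%:R * (f0 u ^+ n * f1 u)) =
  n.+2%:R * (f0 u ^+ n.+1 * f1 u) by rewrite -[n.+2%:R]natr1 exprS; ring.
by rewrite -!eq1 exprS; split=> // e ed; rewrite exprS; exact: h3.
Qed.

Lemma expands_eq P f (f0 f1 h0 h1 : R -> R) : expands P f f0 f1 ->
  (forall u, f0 u = h0 u) -> (forall u, f1 u = h1 u) -> expands P f h0 h1.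
Proof. by move=> H /funext <- /funext <-. Qed.

(** Shrinking [d] keeps the values within 1/2 of 1, away from the singularity at 0 of the square
    root and of the inverse. *)
Lemma expands_near1 P f (f1 : R -> R) : expands P f (fun=> 1) f1 ->
  exists K d, [/\ 0 < d, d <= 1, 0 <= K, expands_by P K d f (fun=> 1) f1 &
    forall e u, 0 <= u <= P -> `|e| < d ->
      `|f e u - 1| <= 2^-1 /\ (f e u - 1) ^+ 2 <= 4 * K ^+ 2 * e ^+ 2].
Proof.
move=> ef; have [K [d [d0 d1 K0 [H _]]]] := expands_common ef ef.
have K4 : 0 < (4 * (K + 1))^-1 by rewrite invr_gt0; lra.
exists K, (Num.min d (4 * (K + 1))^-1); split.
- by rewrite lt_min d0.
- by rewrite ge_min d1.
- by [].
- by apply: expands_by_le H => //; rewrite ge_min lexx.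
move=> e u uP; rewrite lt_min => /andP[ed eK].
have [_ h2 h3] := H u uP; have E := h3 e ed.
have b : `|f e u - 1| <= 2 * K * `|e|.
  have -> : f e u - 1 = (f e u - 1 - e * f1 u) + e * f1 u by ring.
  apply: le_trans (ler_normD _ _) _; rewrite normrM.
  have : `|e| * `|f1 u| <= K * `|e| by rewrite mulrC ler_wpM2r.
  have : K * e ^+ 2 <= K * `|e|.
    rewrite ler_wpM2l// -real_normK ?num_real// expr2 -[leRHS]mul1r ler_wpM2r//.
    exact/ltW/(lt_le_trans ed).
  by lra.
split.
  apply: le_trans b _; have : `|e| * (4 * (K + 1)) < 1.
    by rewrite -ltr_pdivlMr ?div1r//; lra.
  have := normr_ge0 e; nra.
rewrite -real_normK ?num_real// -[e ^+ 2]real_normK ?num_real//.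
have -> : 4 * K ^+ 2 * `|e| ^+ 2 = (2 * K * `|e|) ^+ 2 by ring.
by rewrite !expr2 ler_pM.
Qed.

Lemma expands_sqrt P f (f1 : R -> R) : expands P f (fun=> 1) f1 ->
  expands P (fun e u => Num.sqrt (f e u)) (fun=> 1) (fun u => 2^-1 * f1 u).
Proof.
move=> ef; have [K [d [d0 d1 K0 H N]]] := expands_near1 ef.
exists (K + 2 * K ^+ 2), d; split=> // u uP.
have [h1 h2 h3] := H u uP; have K2 := sqr_ge0 K; split; [lra| |].
  by rewrite normrM ger0_norm ?invr_ge0//; have := normr_ge0 (f1 u); lra.
move=> e ed; have [n1 n2] := N e u uP ed; have E := h3 e ed.
have q0 : 0 <= f e u by move: n1; rewrite ler_norml => /andP[]; lra.
move: (sqrtr_ge0 (f e u)) (sqr_sqrtr q0); set r := Num.sqrt _ => r0 rq.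
(* [r - 1] is half of [r^2 - 1] minus half of [(r - 1)^2], and the latter is of second order. *)
have -> : r - 1 - e * (2^-1 * f1 u) = 2^-1 * (f e u - 1 - e * f1 u) - 2^-1 * (r - 1) ^+ 2.
  by rewrite -rq; field.
have r1 : (r - 1) ^+ 2 <= 4 * K ^+ 2 * e ^+ 2.
  apply: le_trans n2; rewrite -rq; have -> : (r ^+ 2 - 1) ^+ 2 = (r + 1) ^+ 2 * (r - 1) ^+ 2 by ring.
  by rewrite ler_peMl ?sqr_ge0// expr_ge1//; lra.
have r2 := sqr_ge0 (r - 1).
apply: le_trans (ler_normB _ _) _.
have -> : `|2^-1 * (r - 1) ^+ 2| = 2^-1 * (r - 1) ^+ 2 by rewrite ger0_norm// mulr_ge0.
rewrite normrM ger0_norm ?invr_ge0//.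
move: E r1; set x := e ^+ 2; have : 0 <= K * x by rewrite mulr_ge0// sqr_ge0.
by lra.
Qed.

Lemma expands_inv P f (f1 : R -> R) : expands P f (fun=> 1) f1 ->
  expands P (fun e u => (f e u)^-1) (fun=> 1) (fun u => - f1 u).
Proof.
move=> ef; have [K [d [d0 d1 K0 H N]]] := expands_near1 ef.
exists (K + 8 * K ^+ 2), d; split=> // u uP.
have [h1 h2 h3] := H u uP; have K2 := sqr_ge0 K; split; [lra|by rewrite normrN; lra|].
move=> e ed; have [n1 n2] := N e u uP ed; have E := h3 e ed.
move: n1 n2 E; set r := f e u => n1 n2 E.
have rl : 2^-1 <= r by move: n1; rewrite ler_norml => /andP[]; lra.
have r0 : 0 < r by lra.
have -> : r^-1 - 1 - e * - f1 u = (r - 1) ^+ 2 * r^-1 - (r - 1 - e * f1 u).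
  by field; rewrite gt_eqF.
have rv : r^-1 <= 2 by rewrite invf_ple ?posrE.
apply: le_trans (ler_normB _ _) _; rewrite normrM ger0_norm ?sqr_ge0//.
rewrite (ger0_norm (ltW _)) ?invr_gt0//.
have : (r - 1) ^+ 2 * r^-1 <= (4 * K ^+ 2 * e ^+ 2) * 2 by rewrite ler_pM ?sqr_ge0 ?invr_ge0// ltW.
by move: E; lra.
Qed.

Lemma expands_integ P f (f0 f1 : R -> R) d : 0 <= P -> 0 < d ->
  (forall e, `|e| < d -> continuous (f e)) -> continuous f0 -> continuous f1 ->
  expands P f f0 f1 -> isd (fun e => integ (f e) 0 P) 0 (integ f1 0 P).
Proof.
move=> P0 d0 cf cf0 cf1 [K [d' [d'0 d'1 H]]].
pose D e := integ (f e) 0 P - integ f0 0 P - e * integ f1 0 P.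
have D0 : isd D 0 0.
  have dd : 0 < Num.min d d' by rewrite lt_min d0.
  apply: (isd_quadratic_near (c := K * P) dd) => e; rewrite lt_min => /andP[ed ed'].
  have cfe := cf e ed.
  rewrite /D -integZ// -integB// -integB//; [|by cont|by cont].
  rewrite [_ * e ^+ 2]mulrAC -[P in _ * P]subr0; apply: integ_abs_le => //; first by cont.
  by move=> u uP; have [_ _] := H u uP; exact.
have -> : (fun e => integ (f e) 0 P) = (fun e => D e + (integ f0 0 P + e * integ f1 0 P)).
  by apply/funext => e; rewrite /D; ring.
by isd_by; ring.
Qed.

End Expansions.

Section Periodic.
Variable R : realType.
Implicit Types (f g : R -> R) (P : R).

Lemma der_period f g P : der f g -> (forall u, f (u + P) = f u) -> forall u, g (u + P) = g u.
Proof.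
move=> fg fP u; have d1 : der (fun u => f (u + P)) (fun u => g (u + P)).
  by move=> t; isd_by; ring.
move: d1; have -> : (fun u => f (u + P)) = f by apply/funext.
by move=> /(der_uniq fg)/(congr1 (@^~ u)).
Qed.

Lemma period_bounded f P : 0 < P -> continuous f -> (forall u, f (u + P) = f u) ->
  exists2 k, 0 < k & forall u, `|f u| <= k.
Proof.
move=> P0 cf fP; have [k k0 H] := cont_bounded (ltW P0) cf; exists k => // u.
rewrite -(periodic_shift (Num.floor (u / P)) u fP); apply: H.
have /andP[h1 h2] := floor_itv (u / P).
rewrite subr_ge0 mulrC -ler_pdivlMr// h1 /= lerBlDl -[X in _ <= _ + X]mul1r -mulrDl.
rewrite -ler_pdivrMr// ltW//; move: h2; by rewrite intrD.
Qed.

Lemma expands_sub Q (f g : R -> R -> R) (f0 f1 g0 g1 : R -> R) : 0 <= Q ->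
  expands Q f f0 f1 -> expands Q g g0 g1 ->
  expands Q (fun e u => f e u - g e u) (fun u => f0 u - g0 u) (fun u => f1 u - g1 u).
Proof.
move=> Q0 ef eg.
have -> : (fun e u => f e u - g e u) = (fun e u => f e u + (-1) * g e u).
  by apply/funext => e; apply/funext => u; rewrite mulN1r.
apply: expands_eq (expands_add ef (expands_mul (expands_cst (-1) Q0) eg)) _ _ => u; ring.
Qed.

End Periodic.

(** * The energy density in an arbitrary parametrisation *)

Section CurvatureEnergy.
Variable R : realType.
Variables (c : R -> R * R) (A B A1 B1 A2 B2 : R -> R).
Hypothesis dx : der (xc c) A.
Hypothesis dy : der (yc c) B.
Hypothesis dA : der A A1.
Hypothesis dB : der B B1.
Hypothesis dA1 : der A1 A2.
Hypothesis dB1 : der B1 B2.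
Hypothesis q0 : forall u, 0 < A u ^+ 2 + B u ^+ 2.

Definition cross (a b a' b' : R -> R) u := a u * b' u - b u * a' u.
Definition dot (a b a' b' : R -> R) u := a u * a' u + b u * b' u.
Definition norm2 (a b : R -> R) u := Num.sqrt (a u ^+ 2 + b u ^+ 2).
(** The curvature is [N / r^3] and its parameter derivative is this numerator over [r^5]. Hence
    [k_s^2 ds] is the square of the numerator over [r^11], and only the speed [r] enters
    non-polynomially. *)
Definition bending_num u := cross A B A2 B2 u * (A u ^+ 2 + B u ^+ 2)
  - 3 * (cross A B A1 B1 u * dot A B A1 B1 u).

Local Notation r := (norm2 A B).
Local Notation N := (cross A B A1 B1).
Local Notation Q1 := (dot A B A1 B1).

Let r0 u : 0 < r u. Proof. by rewrite /norm2 sqrtr_gt0. Qed.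
Let rn u : r u != 0. Proof. by rewrite gt_eqF. Qed.
Let rq u : A u ^+ 2 + B u ^+ 2 = r u ^+ 2. Proof. by rewrite /norm2 sqr_sqrtr// ltW. Qed.

Let dN : der N (cross A B A2 B2).
Proof.
have h := dA; have h' := dB; have h1 := dA1; have h2 := dB1.
by move=> u; rewrite /cross; isd_by; ring.
Qed.

Let dr : der r (fun u => Q1 u / r u).
Proof.
have h := dA; have h' := dB.
have dq : der (fun u => A u ^+ 2 + B u ^+ 2) (fun u => 2 * Q1 u).
  by move=> u; isd_by; rewrite /dot; ring.
move=> u; have H := @isd_comp R (@Num.sqrt R) (fun u => A u ^+ 2 + B u ^+ 2) u _ _ (isd_sqrt (q0 u)) (dq u).
by apply: isd_eq H _; rewrite -/(norm2 A B u); field.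
Qed.

Lemma speed_norm2 u : speed c u = r u.
Proof. by rewrite /speed (der_derive1 dx) (der_derive1 dy). Qed.

Let ds_der f g u : der f g -> ds c f u = g u / r u.
Proof. by move=> fg; rewrite /ds speed_norm2 (der_derive1 fg). Qed.

Let quotient f g : der f g -> der (fun u => f u * (r u)^-1)
  (fun u => g u / r u - f u * Q1 u / r u ^+ 3).
Proof.
move=> fg u; have h := isd_inv (rn u) (dr u).
by isd_by; field; exact: rn.
Qed.

Lemma curvature_cross : curvature c = fun u => N u / r u ^+ 3.
Proof.
apply/funext => u; rewrite /curvature.
have -> : ds c (xc c) = (fun u => A u * (r u)^-1).
  by apply/funext => t; rewrite (ds_der t dx).
have -> : ds c (yc c) = (fun u => B u * (r u)^-1).
  by apply/funext => t; rewrite (ds_der t dy).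
rewrite (ds_der u (quotient dA)) (ds_der u (quotient dB)) /cross.
by field; exact: rn.
Qed.

Lemma bending_density u : ds c (curvature c) u ^+ 2 * speed c u = bending_num u ^+ 2 * (r u)^-1 ^+ 11.
Proof.
have h := isd_inv (rn u) (dr u); have h' := dN.
have dk : isd (fun u => N u * (r u)^-1 ^+ 3) u (bending_num u / r u ^+ 5).
  by isd_by; rewrite /bending_num (rq u); field; exact: rn.
rewrite curvature_cross /ds speed_norm2.
have -> : derive1 (fun u => N u / r u ^+ 3) u = bending_num u / r u ^+ 5.
  have -> : (fun u => N u / r u ^+ 3) = (fun u => N u * (r u)^-1 ^+ 3).
    by apply/funext => t; rewrite exprVn.
  by rewrite derive1E; case: dk.
by field; exact: rn.
Qed.

Lemma energy_cont lam : continuous A2 -> continuous B2 ->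
  continuous (fun u => 2^-1 * (bending_num u ^+ 2 * (r u)^-1 ^+ 11) + lam * r u).
Proof.
move=> cA2 cB2.
have cr : continuous r := der_continuous dr.
have ci : continuous (fun u => (r u)^-1) by exact: inv_cont.
have h1 := der_continuous dA; have h2 := der_continuous dB.
have h3 := der_continuous dA1; have h4 := der_continuous dB1.
have cZ : continuous bending_num by rewrite /bending_num /cross /dot; cont.
by cont.
Qed.

Lemma J_integ lam P : 0 <= P -> continuous A2 -> continuous B2 ->
  J lam P c = integ (fun u => 2^-1 * (bending_num u ^+ 2 * (r u)^-1 ^+ 11) + lam * r u) 0 P.
Proof.
move=> P0 cA2 cB2.
have cr : continuous r := der_continuous dr.
have ci : continuous (fun u => (r u)^-1) by exact: inv_cont.
have h1 := der_continuous dA; have h2 := der_continuous dB.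
have h3 := der_continuous dA1; have h4 := der_continuous dB1.
have cZ : continuous bending_num by rewrite /bending_num /cross /dot; cont.
have ck : continuous (fun u => bending_num u ^+ 2 * (r u)^-1 ^+ 11) by cont.
rewrite /J /curve_length integD; [|by cont|by cont].
rewrite (integZ _ _ _ ck) (integZ _ _ _ cr).
congr (_ * _ + _ * _); rewrite -integ_Rint//; apply: eq_Rintegral => u _.
  exact: bending_density.
exact: speed_norm2.
Qed.

End CurvatureEnergy.

(** * Expansion of the energy density along a variation *)

Section EnergyExpansion.
Variable R : realType.
Variables (C S t1 t2 X1 X2 X3 Y1 Y2 Y3 : R -> R) (lam P : R).
Hypothesis P0 : 0 <= P.
Hypothesis cC : continuous C.
Hypothesis cS : continuous S.
Hypothesis ct1 : continuous t1.
Hypothesis ct2 : continuous t2.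
Hypothesis cX1 : continuous X1.
Hypothesis cX2 : continuous X2.
Hypothesis cX3 : continuous X3.
Hypothesis cY1 : continuous Y1.
Hypothesis cY2 : continuous Y2.
Hypothesis cY3 : continuous Y3.
Hypothesis CS : forall u, C u ^+ 2 + S u ^+ 2 = 1.

(* Successive derivatives of the coordinates of the curve with velocity [(C, S)] and signed
   curvature [t1], varied by [e] times the field with derivative [(X1, Y1)]. *)
Definition vel_x (e u : R) : R := C u + e * X1 u.
Definition vel_y (e u : R) : R := S u + e * Y1 u.
Definition acc_x (e u : R) : R := - S u * t1 u + e * X2 u.
Definition acc_y (e u : R) : R := C u * t1 u + e * Y2 u.
Definition jerk_x (e u : R) : R := - C u * t1 u ^+ 2 - S u * t2 u + e * X3 u.
Definition jerk_y (e u : R) : R := - S u * t1 u ^+ 2 + C u * t2 u + e * Y3 u.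

Definition density e u :=
  2^-1 * (bending_num (vel_x e) (vel_y e) (acc_x e) (acc_y e) (jerk_x e) (jerk_y e) u ^+ 2 *
    (norm2 (vel_x e) (vel_y e) u)^-1 ^+ 11) + lam * norm2 (vel_x e) (vel_y e) u.

(** [stretch], [stretch1] and [twist] are the coefficients of [e] in the speed, in the scalar
    product of velocity and acceleration, and in the cross product of velocity and jerk. *)
Definition stretch u := C u * X1 u + S u * Y1 u.
Definition stretch1 u := X1 u * (- S u * t1 u) + C u * X2 u + (Y1 u * (C u * t1 u) + S u * Y2 u).
Definition twist u := X1 u * (- S u * t1 u ^+ 2 + C u * t2 u) + C u * Y3 u
  - (Y1 u * (- C u * t1 u ^+ 2 - S u * t2 u) + S u * X3 u).
Definition density1 u := t2 u * (twist u + 2 * t2 u * stretch u - 3 * t1 u * stretch1 u)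
  - 11 / 2 * t2 u ^+ 2 * stretch u + lam * stretch u.

(** At [e = 0] the speed is 1 and the acceleration is normal, so the root and the inverse are
    expanded about 1 and the scalar product starts at first order. *)
Lemma expands_density : expands P density (fun u => 2^-1 * t2 u ^+ 2 + lam) density1.
Proof.
have hS := cS; have hC := cC; have h1 := ct1; have h2 := ct2.
have eA : expands P vel_x C X1 by exact: expands_affine.
have eB : expands P vel_y S Y1 by exact: expands_affine.
have eA1 : expands P acc_x (fun u => - S u * t1 u) X2 by apply: expands_affine => //; cont.
have eB1 : expands P acc_y (fun u => C u * t1 u) Y2 by apply: expands_affine => //; cont.
have eA2 : expands P jerk_x (fun u => - C u * t1 u ^+ 2 - S u * t2 u) X3.
  by apply: expands_affine => //; cont.
have eB2 : expands P jerk_y (fun u => - S u * t1 u ^+ 2 + C u * t2 u) Y3.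
  by apply: expands_affine => //; cont.
have eq : expands P (fun e u => vel_x e u ^+ 2 + vel_y e u ^+ 2) (fun=> 1) (fun u => 2 * stretch u).
  apply: (expands_eq (expands_add (expands_exp 1 eA) (expands_exp 1 eB))) => u; first exact: CS.
  by rewrite /stretch; ring.
have er : expands P (fun e => norm2 (vel_x e) (vel_y e)) (fun=> 1) stretch.
  by apply: (expands_eq (expands_sqrt eq)) => // u; field.
have eN : expands P (fun e => cross (vel_x e) (vel_y e) (acc_x e) (acc_y e)) t1
    (fun u => X1 u * (C u * t1 u) + C u * Y2 u - (Y1 u * (- S u * t1 u) + S u * X2 u)).
  apply: (expands_eq (expands_sub P0 (expands_mul eA eB1) (expands_mul eB eA1))) => // u.
  by rewrite -[RHS]mul1r -(CS u); ring.
have eN1 : expands P (fun e => cross (vel_x e) (vel_y e) (jerk_x e) (jerk_y e)) t2 twist.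
  apply: (expands_eq (expands_sub P0 (expands_mul eA eB2) (expands_mul eB eA2))) => // u.
  by rewrite -[RHS]mul1r -(CS u); ring.
have eQ : expands P (fun e => dot (vel_x e) (vel_y e) (acc_x e) (acc_y e)) (fun=> 0) stretch1.
  apply: (expands_eq (expands_add (expands_mul eA eA1) (expands_mul eB eB1))) => // u.
  by ring.
have eZ : expands P
    (fun e => bending_num (vel_x e) (vel_y e) (acc_x e) (acc_y e) (jerk_x e) (jerk_y e)) t2
    (fun u => twist u + 2 * t2 u * stretch u - 3 * t1 u * stretch1 u).
  apply: (expands_eq (expands_sub P0 (expands_mul eN1 eq)
    (expands_mul (expands_cst 3 P0) (expands_mul eN eQ)))) => // u; ring.
apply: (expands_eq (expands_add
  (expands_mul (expands_cst 2^-1 P0) (expands_mul (expands_exp 1 eZ) (expands_exp 10 (expands_inv er))))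
  (expands_mul (expands_cst lam P0) er))) => u; first by rewrite expr1n !mulr1.
by rewrite /density1 !expr1n expr1; field.
Qed.

End EnergyExpansion.

(** * Vanishing of the first variation *)

Section FirstVariation.
Variable R : realType.
Variables (lam P m : R) (G V : R -> R * R) (th th1 th2 th3 : R -> R).
Hypothesis P0 : 0 < P.
Hypothesis dGx : der (xc G) (fun u => cos (th u)).
Hypothesis dGy : der (yc G) (fun u => sin (th u)).
Hypothesis dth : der th th1.
Hypothesis dth1 : der th1 th2.
Hypothesis dth2 : der th2 th3.
Hypothesis dth3 : der th3 (fun u => m * cos (th u)).
Hypothesis first_integral : forall u, th1 u * th3 u - th2 u ^+ 2 / 2 + lam = m * sin (th u).
Hypothesis cos_per : forall u, cos (th (u + P)) = cos (th u).
Hypothesis sin_per : forall u, sin (th (u + P)) = sin (th u).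
Hypothesis th1_per : forall u, th1 (u + P) = th1 u.
Hypothesis th2_per : forall u, th2 (u + P) = th2 u.
Hypothesis th3_per : forall u, th3 (u + P) = th3 u.

Lemma density1_integral (X X1 X2 X3 Y Y1 Y2 Y3 : R -> R) :
  der X X1 -> der X1 X2 -> der X2 X3 -> der Y Y1 -> der Y1 Y2 -> der Y2 Y3 ->
  continuous X3 -> continuous Y3 ->
  (forall u, X (u + P) = X u) -> (forall u, Y (u + P) = Y u) ->
  integ (density1 (fun u => cos (th u)) (fun u => sin (th u)) th1 th2 X1 X2 X3 Y1 Y2 Y3 lam) 0 P = 0.
Proof.
move=> dX dX1 dX2 dY dY1 dY2 cX3 cY3 pX pY.
have pX1 := der_period dX pX; have pX2 := der_period dX1 pX1.
have pY1 := der_period dY pY; have pY2 := der_period dY1 pY1.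
pose T u := cos (th u) * X1 u + sin (th u) * Y1 u.
(* An explicit periodic primitive of the varied density: the boundary terms of the integrations by
   parts together with [m * Y]. *)
pose B u := th2 u * (cos (th u) * Y2 u - sin (th u) * X2 u - th1 u * T u)
  - th3 u * (cos (th u) * Y1 u - sin (th u) * X1 u) - th1 u * th2 u * T u + m * Y u.
have h1 := dth; have h2 := dth1; have h3 := dth2; have h4 := dth3.
have dB : der B (density1 (fun u => cos (th u)) (fun u => sin (th u)) th1 th2 X1 X2 X3 Y1 Y2 Y3 lam).
  move=> u; rewrite /B /T; isd_by.
  have FI := first_integral u; have CS := cos2Dsin2 (th u).
  rewrite /density1 /twist /stretch /stretch1.
  set c := cos _ in FI CS *; set s := sin _ in FI CS *.
  (* With [lam] replaced through the first integral, the identity becomes polynomial up to the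
     relation [c^2 + s^2 = 1]. *)
  have -> : lam = m * s - th1 u * th3 u + th2 u ^+ 2 / 2 by rewrite -FI; ring.
  apply/eqP; rewrite -subr_eq0; apply/eqP.
  rewrite (_ : _ - _ = m * Y1 u * (1 - (c ^+ 2 + s ^+ 2))); first by rewrite CS subrr mulr0.
  by field.
rewrite (integ_FTC _ _ dB).
  rewrite -{1}[P]add0r /B /T !(pX1, pX2, pY, pY1, pY2, th1_per, th2_per, th3_per, cos_per, sin_per).
  by rewrite subrr.
have c0 := der_continuous dth; have c1 := der_continuous dth1; have c2 := der_continuous dth2.
have d1 := der_continuous dX1; have d2 := der_continuous dX2.
have d3 := der_continuous dY1; have d4 := der_continuous dY2.
by rewrite /density1 /twist /stretch /stretch1; cont.
Qed.

Lemma first_variation_derivatives (X1 X2 X3 Y1 Y2 Y3 : R -> R) :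
  der (xc V) X1 -> der X1 X2 -> der X2 X3 -> der (yc V) Y1 -> der Y1 Y2 -> der Y2 Y3 ->
  continuous X3 -> continuous Y3 -> periodic V P -> is_first_variation lam P G V 0.
Proof.
move=> dX dX1 dX2 dY dY1 dY2 cX3 cY3 pV.
have pX u : xc V (u + P) = xc V u by rewrite /xc pV.
have pY u : yc V (u + P) = yc V u by rewrite /yc pV.
have c1 := der_continuous dth1; have c2 := der_continuous dth2.
have cX1 := der_continuous dX1; have cX2 := der_continuous dX2.
have cY1 := der_continuous dY1; have cY2 := der_continuous dY2.
have ct := der_continuous dth.
pose C u := cos (th u); pose S u := sin (th u).
have cC : continuous C by rewrite /C; cont.
have cS : continuous S by rewrite /S; cont.
have CS u : C u ^+ 2 + S u ^+ 2 = 1 by exact: cos2Dsin2.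
have dC : der C (fun u => - S u * th1 u) by have h := dth; move=> u; rewrite /C; isd_by.
have dS : der S (fun u => C u * th1 u) by have h := dth; move=> u; rewrite /S; isd_by.
have [K K0 HK] := period_bounded P0 cX1 (der_period dX pX).
have [L L0 HL] := period_bounded P0 cY1 (der_period dY pY).
(* For smaller [e] the term of the squared speed linear in [e] exceeds -1, so the varied curve is
   still immersed and the density formula for [J] applies. *)
have d0 : 0 < (2 * (K + L))^-1 by rewrite invr_gt0; lra.
have reg e u : `|e| < (2 * (K + L))^-1 -> 0 < vel_x C X1 e u ^+ 2 + vel_y S Y1 e u ^+ 2.
  move=> ed; have {}ed : `|e| * (2 * (K + L)) < 1 by rewrite -ltr_pdivlMr ?div1r//; lra.
  have -> : vel_x C X1 e u ^+ 2 + vel_y S Y1 e u ^+ 2 =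
      1 + 2 * (e * (C u * X1 u + S u * Y1 u)) + ((e * X1 u) ^+ 2 + (e * Y1 u) ^+ 2).
    by rewrite -[X in _ = X + _ + _](CS u) /vel_x /vel_y; ring.
  have C1 : `|C u| <= 1 by rewrite ler_norml cos_geN1 cos_le1.
  have S1 : `|S u| <= 1 by rewrite ler_norml sin_geN1 sin_le1.
  have b : `|e * (C u * X1 u + S u * Y1 u)| <= `|e| * (K + L).
    rewrite normrM ler_wpM2l//; apply: le_trans (ler_normD _ _) _; rewrite !normrM.
    by apply: lerD; rewrite -[leRHS]mul1r ler_pM.
  have := ler_norm (- (e * (C u * X1 u + S u * Y1 u))); rewrite normrN.
  have := sqr_ge0 (e * X1 u); have := sqr_ge0 (e * Y1 u); lra.
pose D := density C S th1 th2 X1 X2 X3 Y1 Y2 Y3 lam.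
have ders e : [/\ der (vel_x C X1 e) (acc_x S th1 X2 e), der (vel_y S Y1 e) (acc_y C th1 Y2 e),
    der (acc_x S th1 X2 e) (jerk_x C S th1 th2 X3 e) &
    der (acc_y C th1 Y2 e) (jerk_y C S th1 th2 Y3 e)].
  have h1 := dth1.
  split=> u; rewrite /vel_x /vel_y /acc_x /acc_y /jerk_x /jerk_y; isd_by; ring.
have cj e : continuous (jerk_x C S th1 th2 X3 e) by rewrite /jerk_x; cont.
have cj' e : continuous (jerk_y C S th1 th2 Y3 e) by rewrite /jerk_y; cont.
have JE e : `|e| < (2 * (K + L))^-1 -> J lam P (vary G V e) = integ (D e) 0 P.
  move=> ed; have [h1 h2 h3 h4] := ders e.
  apply: (J_integ (c := vary G V e) _ _ h1 h2 h3 h4) => //; last exact: ltW.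
  - by have hx := dGx; move=> t; rewrite /xc /vary /= -/(xc G _) -/(xc V _); isd_by;
      rewrite /vel_x /C /=; ring.
  - by have hy := dGy; move=> t; rewrite /yc /vary /= -/(yc G _) -/(yc V _); isd_by;
      rewrite /vel_y /S /=; ring.
  - by move=> u; exact: reg.
have exD : expands P D (fun u => 2^-1 * th2 u ^+ 2 + lam) (density1 C S th1 th2 X1 X2 X3 Y1 Y2 Y3 lam).
  exact: (expands_density _ (ltW P0)).
rewrite /is_first_variation -[X in is_derive _ _ _ X](density1_integral dX dX1 dX2 dY dY1 dY2 cX3 cY3 pX pY).
apply: (@near_eq_is_derive _ _ _ (fun e => integ (D e) 0 P)); last first.
  apply: (@expands_integ R P D _ _ _ (ltW P0) d0 _ _ _ exD); last 2 first.
  - by cont.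
  - by rewrite /density1 /twist /stretch /stretch1; cont.
  move=> e ed; have [h1 h2 h3 h4] := ders e; rewrite /D /density.
  by apply: (energy_cont h1 h2 h3 h4) => // u; exact: reg.
by apply: (nbhs_abs d0) => e; rewrite subr0 => /JE.
Qed.

Lemma first_variation_zero : smooth_closed P V -> is_first_variation lam P G V 0.
Proof.
move=> [sX sY pV].
have sX1 := smooth_derive1 sX; have sX2 := smooth_derive1 sX1; have sX3 := smooth_derive1 sX2.
have sY1 := smooth_derive1 sY; have sY2 := smooth_derive1 sY1; have sY3 := smooth_derive1 sY2.
exact: first_variation_derivatives (smooth_der sX) (smooth_der sX1) (smooth_der sX2)
  (smooth_der sY) (smooth_der sY1) (smooth_der sY2) (smooth_cont sX3) (smooth_cont sY3) pV.
Qed.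

End FirstVariation.

(** * Congruence, criticality and the family of closed curves *)

Section Congruence.
Variable R : realType.
Implicit Types (x y : R -> R) (c : R -> R * R) (P Q : R).

(* Differentiating the squared distance to a fixed point of the curve twice at that point
   recovers the squared speed. *)
Lemma isometric_speed x x1 x2 y y1 y2 (z z1 z2 w w1 w2 : R -> R) :
  der x x1 -> der x1 x2 -> der y y1 -> der y1 y2 ->
  der z z1 -> der z1 z2 -> der w w1 -> der w1 w2 ->
  (forall u v, (x v - x u) ^+ 2 + (y v - y u) ^+ 2 = (z v - z u) ^+ 2 + (w v - w u) ^+ 2) ->
  forall u, x1 u ^+ 2 + y1 u ^+ 2 = z1 u ^+ 2 + w1 u ^+ 2.
Proof.
have twice (f f1 f2 g g1 g2 : R -> R) (u : R) : der f f1 -> der f1 f2 -> der g g1 -> der g1 g2 ->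
    exists2 h, der (fun v => (f v - f u) ^+ 2 + (g v - g u) ^+ 2) h &
      isd h u (2 * (f1 u ^+ 2 + g1 u ^+ 2)).
  move=> df df1 dg dg1; exists (fun v => 2 * ((f v - f u) * f1 v + (g v - g u) * g1 v)).
    by move=> v; isd_by; ring.
  by isd_by; ring.
move=> dx dx1 dy dy1 dz dz1 dw dw1 e u.
have [h dh hu] := twice _ _ _ _ _ _ u dx dx1 dy dy1.
have [k dk ku] := twice _ _ _ _ _ _ u dz dz1 dw dw1.
have ef : (fun v => (x v - x u) ^+ 2 + (y v - y u) ^+ 2) =
    (fun v => (z v - z u) ^+ 2 + (w v - w u) ^+ 2) by apply/funext => v.
rewrite ef in dh; have hk := der_uniq dh dk; rewrite hk in hu.
have := isd_uniq hu ku; lra.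
Qed.

(** Distances determine the speed, so the derivative of [phi] has square 1; it is then constant,
    [phi] is affine of slope 1 or -1, and the shift relation reads [P = Q]. *)
Lemma congruent_period P Q c c' : smooth_closed_immersion P c -> smooth_closed_immersion Q c' ->
  (forall u, speed c u = 1) -> (forall u, speed c' u = 1) -> congruent P c Q c' -> P = Q.
Proof.
move=> [P0 [sx sy _] _] [Q0 [sz sw _] _] c1 c'1 [F [phi [isoF [sphi _ per] E]]].
have unit_speed (k : R -> R * R) u : speed k u = 1 ->
    derive1 (xc k) u ^+ 2 + derive1 (yc k) u ^+ 2 = 1.
  move=> k1; rewrite -[LHS]sqr_sqrtr ?addr_ge0 ?sqr_ge0//.
  by rewrite -/(speed k u) k1 expr1n.
have dx := smooth_der sx; have dx1 := smooth_der (smooth_derive1 sx).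
have dy := smooth_der sy; have dy1 := smooth_der (smooth_derive1 sy).
have dz := smooth_der sz; have dz1 := smooth_der (smooth_derive1 sz).
have dw := smooth_der sw; have dw1 := smooth_der (smooth_derive1 sw).
have dp := smooth_der sphi; have dp1 := smooth_der (smooth_derive1 sphi).
have lift (f f1 f2 : R -> R) : der f f1 -> der f1 f2 ->
    der (fun t => f (phi t)) (fun t => f1 (phi t) * derive1 phi t) /\
    der (fun t => f1 (phi t) * derive1 phi t)
      (fun t => f2 (phi t) * derive1 phi t ^+ 2 + f1 (phi t) * derive1 (derive1 phi) t).
  move=> df df1; split=> t; isd_by; ring.
have [dZ dZ1] := lift _ _ _ dz dz1; have [dW dW1] := lift _ _ _ dw dw1.
have dist u v : (xc c v - xc c u) ^+ 2 + (yc c v - yc c u) ^+ 2 =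
    (xc c' (phi v) - xc c' (phi u)) ^+ 2 + (yc c' (phi v) - yc c' (phi u)) ^+ 2.
  have := isoF (c v) (c u); rewrite -!E /euclidean_dist => /eqP.
  by rewrite eqr_sqrt ?addr_ge0 ?sqr_ge0// eq_sym => /eqP.
have p2 u : derive1 phi u ^+ 2 = 1.
  have := isometric_speed dx dx1 dy dy1 dZ dZ1 dW dW1 dist u.
  rewrite (unit_speed _ _ (c1 u)) => ->.
  by rewrite -[LHS]mul1r -(unit_speed _ _ (c'1 (phi u))); ring.
have p20 u : derive1 (derive1 phi) u = 0.
  have d : der (fun u => derive1 phi u ^+ 2) (fun u => 2 * derive1 phi u * derive1 (derive1 phi) u).
    by move=> t; isd_by; ring.
  have e : (fun u => derive1 phi u ^+ 2) = (fun=> 1) by apply/funext.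
  rewrite e in d; have := isd_uniq (d u) (isd_cst 1 u) => /eqP.
  rewrite !mulf_eq0 pnatr_eq0 /= => /orP[/eqP h|/eqP//].
  by have := p2 u; rewrite h expr0n => /eqP; rewrite eq_sym oner_eq0.
have pc u : derive1 phi u = derive1 phi 0.
  by apply: der_zero_cst; apply: der_eq dp1 p20.
have pl u : phi u = phi 0 + derive1 phi 0 * u.
  have d : der (fun u => phi u - derive1 phi 0 * u) (fun=> 0).
    by move=> t; isd_by; rewrite pc; ring.
  have := der_zero_cst u 0 d; rewrite mulr0 subr0; lra.
have PQ : (derive1 phi 0 * P) ^+ 2 = Q ^+ 2.
  by case: per => /(_ 0); rewrite add0r pl => h; [|rewrite -[RHS]sqrrN]; congr (_ ^+ 2); lra.
move: PQ; rewrite exprMn p2 mul1r => /eqP; rewrite eqrXn2 ?(ltW P0) ?(ltW Q0)// => /eqP.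
by [].
Qed.

End Congruence.

(** * First integral and criticality *)

Section Criticality.
Variable R : realType.
Variables (p kap : R) (F F1 F2 F3 : R -> R).
Hypothesis prof : profile p kap F F1 F2 F3.
Variables (lam l : R).
Hypothesis l0 : 0 < l.
Hypothesis scale : 2 * lam * l ^+ 4 = 3 * ip F2 F2.
Local Notation ang := (angle F l).

Let dF := profile_d1 prof.
Let dF1 := profile_d2 prof.
Let dF2 := profile_d3 prof.
Let dF3 := profile_d4 prof.

Lemma profile_0 : F 0 = 0.
Proof. by have := profile_odd prof 0; rewrite oppr0; lra. Qed.

Lemma profile_F1_1 : F1 1 = 0.
Proof.
have h := dF; have d1 : der (fun x => F (2 - x)) (fun x => - F1 (2 - x)).
  by move=> z; isd_by; ring.
have e : (fun x => F (2 - x)) = F by apply/funext => z; exact: (profile_sym prof).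
rewrite e in d1; have /(congr1 (fun f => f 1)) := der_uniq d1 h.
have -> : 2 - 1 = 1 :> R by ring.
by lra.
Qed.

Lemma profile_lb : 3 * F 1 ^+ 2 <= ip F2 F2.
Proof.
have [eL _ _] := profile_comp prof; have := energy_functional_lb eL.
have cF2 := der_continuous dF2; have cF1 := der_continuous dF1.
rewrite /arc ip_kernel ?ler01 ?lexx// sol_1//; suff -> : - ip F2 id = F 1 by [].
have h := dF; have h1 := dF1; have cid := @id_cont R.
have d : der (fun x => x * F1 x - F x) (fun x => F2 x * x) by move=> x; isd_by; ring.
rewrite /ip (integ_FTC _ _ d) ?profile_F1_1 ?profile_0; last by cont.
by ring.
Qed.

(** The left side is conserved. Averaging it over [0, 1] gives its value: by parts [F1 F3] becomes
    [- F2^2], since [F1 1 = 0] and [F2 0 = 0], and closing removes the cosine. *)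
Lemma profile_first_integral x : F1 x * F3 x - F2 x ^+ 2 / 2 + kap * cos (F x) = - (3 / 2 * ip F2 F2).
Proof.
have h := dF; have h1 := dF1; have h2 := dF2; have h3 := dF3.
have cF := der_continuous dF; have cF2 := der_continuous dF2; have cF1 := der_continuous dF1.
have cF3 := der_continuous dF3.
pose E x := F1 x * F3 x - F2 x ^+ 2 / 2 + kap * cos (F x).
have dE : der E (fun=> 0) by move=> t; rewrite /E; isd_by; field.
have cE : continuous E by rewrite /E; cont.
have d : der (fun x => F1 x * F2 x) (fun x => F1 x * F3 x + F2 x * F2 x).
  by move=> t; isd_by; ring.
have i1 : integ (fun x => F1 x * F3 x + F2 x * F2 x) 0 1 = 0.
  rewrite (integ_FTC _ _ d) ?profile_F1_1 ?(profile_F2_0 prof); last by cont.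
  by ring.
have : integ E 0 1 = - (3 / 2 * ip F2 F2).
  have -> : E = (fun x => F1 x * F3 x + F2 x * F2 x - 3 / 2 * (F2 x * F2 x) + kap * cos (F x)).
    by apply/funext => t; rewrite /E; field.
  have c1 : continuous (fun x => F1 x * F3 x + F2 x * F2 x) by cont.
  have c2 : continuous (fun x => F2 x * F2 x) by cont.
  have c3 : continuous (fun x => cos (F x)) by cont.
  rewrite integD; [|by cont|by cont]; rewrite integB//; last by cont.
  rewrite (integZ _ _ _ c2) (integZ _ _ _ c3) i1 (profile_closing prof) /ip.
  by ring.
rewrite -/(E x) => <-.
have -> : E = (fun=> E x) by apply/funext => t; exact: der_zero_cst dE.
by rewrite integ_cst; ring.
Qed.

(** The relation between [l] and [lam] identifies the conserved value, divided by [l^4], with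
    [- lam]. *)
Lemma angle_first_integral u : angle1 F1 l u * angle3 F3 l u - angle2 F2 l u ^+ 2 / 2 + lam =
  - (kap / l ^+ 4) * sin (ang u).
Proof.
have -> : lam = 3 / 2 * ip F2 F2 / l ^+ 4.
  have -> : ip F2 F2 = 2 * lam * l ^+ 4 / 3 by rewrite scale; field.
  by field; rewrite gt_eqF.
rewrite sin_angleE /angle1 /angle2 /angle3.
have := profile_first_integral (l^-1 * u); set x := l^-1 * u => e.
have -> : 3 / 2 * ip F2 F2 = - (F1 x * F3 x - F2 x ^+ 2 / 2 + kap * cos (F x)).
  by rewrite e opprK.
by field; rewrite gt_eqF.
Qed.

Lemma angle_period u : ang (u + 4 * l) = ang u.
Proof.
have F2p x : F (x + 2) = - F x.
  by rewrite -(profile_odd prof) -(profile_sym prof (- x)); congr F; ring.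
have -> : ang (u + 4 * l) = pi / 2 + F (l^-1 * u + 2 + 2).
  by rewrite /angle; congr (_ + F _); field; rewrite gt_eqF.
by rewrite !F2p opprK.
Qed.

Lemma critical_G V : smooth_closed (4 * l) V ->
  is_first_variation lam (4 * l) (reflection_closure l ang) V 0.
Proof.
have hl := l0.
have p1 := der_period (der_angle prof l) angle_period.
have p2 := der_period (der_angle1 prof l) p1.
have p3 := der_period (der_angle2 prof l) p2.
apply: (@first_variation_zero R lam (4 * l) (- (kap / l ^+ 4)) _ V ang (angle1 F1 l) (angle2 F2 l)
  (angle3 F3 l)) => //.
- by lra.
- by rewrite (xcG prof l0); exact: (der_curve_x prof l).
- by rewrite (ycG prof l0); exact: (der_curve_y prof l).
- exact: der_angle prof l.
- exact: der_angle1 prof l.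
- exact: der_angle2 prof l.
- by move=> u; exact: (der_angle3 prof l0 u).
- by move=> u; exact: (angle_first_integral u).
- by move=> u; rewrite angle_period.
- by move=> u; rewrite angle_period.
Qed.

End Criticality.

(** * Scaling, energy bound and the curves of the family *)

Section ClosedCurves.
Variable R : realType.
Implicit Types (lam p q l x : R).

Definition lower_end (n j : nat) : R := 2 * pi * n%:R + rho R j - pi / 4.

Lemma window_lower n j : window (pi / 4) n j = `[lower_end n j, lower_end n j + pi / 2]%classic.
Proof.
have -> : lower_end n j + pi / 2 = 2 * pi * n%:R + rho R j + pi / 4 by rewrite /lower_end; field.
by [].
Qed.

Lemma lower_end_ge n j : n%:R <= lower_end n j.
Proof.
have p2 : 2 <= pi := pi_ge2 R.
have n0 : 0 <= n%:R :> R by [].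
by rewrite /lower_end /rho; case: ifP => _; nra.
Qed.

Lemma sin_lower_end n j : sin (lower_end n j) = if j == 1%N then 1 else -1.
Proof.
have per (k : nat) x : sin (x + 2 * pi * k%:R) = sin x.
  elim: k => [|k IH]; first by rewrite mulr0 addr0.
  rewrite -[RHS]IH.
  have -> : x + 2 * pi * k.+1%:R = x + 2 * pi * k%:R + pi + pi by rewrite -natr1; ring.
  by rewrite !sinDpi opprK.
have -> : lower_end n j = rho R j - pi / 4 + 2 * pi * n%:R by rewrite /lower_end; ring.
rewrite per /rho; case: ifP => _.
  have -> : 3 * pi / 4 - pi / 4 = pi / 2 :> R by field.
  exact: sin_pihalf.
have -> : 7 * pi / 4 - pi / 4 = pi / 2 + pi :> R by field.
by rewrite sinDpi sin_pihalf.
Qed.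

Lemma scale_exists lam M : 0 < lam -> 0 < M -> exists2 l, 0 < l & 2 * lam * l ^+ 4 = 3 * M.
Proof.
move=> lam0 M0; have c0 : 0 < 3 * M / (2 * lam) by rewrite divr_gt0 ?mulr_gt0.
exists (Num.sqrt (Num.sqrt (3 * M / (2 * lam)))); first by rewrite !sqrtr_gt0.
rewrite (exprM _ 2 2) sqr_sqrtr ?sqrtr_ge0// sqr_sqrtr ?(ltW c0)//.
by field; rewrite gt_eqF.
Qed.

Definition optimal_arc lam p l F := exists kap F1 F2 F3,
  [/\ profile p kap F F1 F2 F3, 0 < l & 2 * lam * l ^+ 4 = 3 * ip F2 F2].

Lemma optimal_arcs lam : 0 < lam -> exists (N0 : nat) (ell : nat -> nat -> R) (F : nat -> nat -> R -> R),
  forall n j, (N0 <= n)%N -> [/\ 1 <= lower_end n j & optimal_arc lam (lower_end n j) (ell n j) (F n j)].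
Proof.
move=> lam0; have [Phi0 Phi01 H] := profile_exists R.
pose N0 := (Num.truncn Phi0).+1.
have N0P n j : (N0 <= n)%N -> Phi0 <= lower_end n j.
  move=> nN; apply: le_trans (lower_end_ge n j); apply: (@le_trans _ _ N0%:R); last by rewrite ler_nat.
  by apply/ltW; rewrite /N0; exact: truncnS_gt.
have E (x : nat * nat) : exists y : R * (R -> R), (N0 <= x.1)%N ->
    [/\ 1 <= lower_end x.1 x.2 & optimal_arc lam (lower_end x.1 x.2) y.1 y.2].
  (* Below [N0] nothing is claimed and the pair is a default. *)
  case: x => n j /=; have [nN|nN] := leqP N0 n; last by exists (0, fun=> 0).
  have pP := N0P n j nN.
  have s2 : (if j == 1%N then 1 else -1 : R) ^+ 2 = 1 by case: ifP; rewrite ?sqrrN expr1n.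
  have [kap [F [F1 [F2 [F3 prof]]]]] := H _ _ pP s2 (sin_lower_end n j).
  have M0 : 0 < ip F2 F2.
    apply: lt_le_trans (profile_lb prof); have /andP[t _] := profile_turning prof.
    by rewrite mulr_gt0// exprn_gt0//; lra.
  have [l l0 eql] := scale_exists lam0 M0.
  by exists (l, F) => _; split; [lra|exists kap, F1, F2, F3].
have [f Hf] := choice E.
by exists N0, (fun n j => (f (n, j)).1), (fun n j => (f (n, j)).2) => n j; exact: (Hf (n, j)).
Qed.

Section OneCurve.
Variables (lam p l : R) (F : R -> R).
Hypothesis lam0 : 0 < lam.
Hypothesis p1 : 1 <= p.
Hypothesis opt : optimal_arc lam p l F.
Local Notation th := (angle F l).
Local Notation Ph := (th l - pi / 2).
Local Notation G := (reflection_closure l th).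
Local Notation B := (G l).

Lemma optimal_arc_pos : 0 < l. Proof. by case: opt => kap [F1 [F2 [F3 []]]]. Qed.

Lemma optimal_arc_mid : Ph = F 1.
Proof. by case: opt => kap [F1 [F2 [F3 [_ l0 _]]]]; exact: angle_mid. Qed.

Lemma optimal_arc_minimiser : [/\ is_minimiser_on lam `[p, p + pi / 2] l th,
  midpoint_transversality l th & p < Ph < p + pi / 2].
Proof.
rewrite optimal_arc_mid; have [kap [F1 [F2 [F3 [prof l0 sc]]]]] := opt; split.
- exact: (angle_minimiser prof l0 lam0 sc).
- exact: (angle_transversality prof l0).
- exact: (profile_turning prof).
Qed.

Lemma optimal_arc_immersion :
  [/\ smooth_near l (xc (doubled_arc th)) /\ smooth_near l (yc (doubled_arc th)),
      smooth_closed_immersion (4 * l) G & forall s, speed G s = 1].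
Proof.
have [kap [F1 [F2 [F3 [prof l0 sc]]]]] := opt; split.
- exact: (doubled_arc_smooth_near prof l0).
- exact: (closed_immersionG prof l0).
- exact: (speedG prof l0).
Qed.

Lemma optimal_arc_symmetries :
  [/\ B = G (3 * l),
      forall s, s \in `[0, l] -> G (l + s) = B *+ 2 - G (l - s) &
      forall s, s \in `[2 * l, 4 * l] -> G s = (xc G (4 * l - s), - yc G (4 * l - s))].
Proof.
have [kap [F1 [F2 [F3 [prof l0 sc]]]]] := opt.
rewrite (xcG prof l0) (ycG prof l0) (reflection_closureE prof l0); split.
- have [ex ey] := curve_rev prof l0 (2 * l).
  have e : l + 2 * l = 3 * l by ring.
  have e' : l - 2 * l = - l by ring.
  move: ex ey; rewrite e e' (curve_xN prof) (curve_yN prof) (curve_y_mid prof l0) => -> ->.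
  by congr (_, _); ring.
- move=> s _; have [-> ->] := curve_rev prof l0 s.
  by rewrite mulr2n; apply: congr2; rewrite /=; ring.
move=> s _; rewrite addrC (curve_x_period prof l0) (curve_y_period prof l0).
by rewrite (curve_xN prof) (curve_yN prof) opprK.
Qed.

Lemma optimal_arc_critical V : smooth_closed (4 * l) V -> is_first_variation lam (4 * l) G V 0.
Proof. by have [kap [F1 [F2 [F3 [prof l0 sc]]]]] := opt; exact: (critical_G prof l0 sc). Qed.

Lemma optimal_arc_turning (Theta : R -> R) : tangent_lift `[0, 4 * l] G Theta -> Theta 0 = pi / 2 ->
  [/\ Theta l = pi / 2 + Ph, Theta (2 * l) = pi / 2, Theta (3 * l) = pi / 2 - Ph &
      Theta (4 * l) = pi / 2] /\
  [/\ Theta l - Theta 0 = Ph, Theta (2 * l) - Theta l = - Ph,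
      Theta (3 * l) - Theta (2 * l) = - Ph, Theta (4 * l) - Theta (3 * l) = Ph &
      Theta (4 * l) - Theta 0 = 0].
Proof.
rewrite optimal_arc_mid; have [kap [F1 [F2 [F3 [prof l0 sc]]]]] := opt.
move=> lift T0; have H := tangent_lift_angle prof l0 lift T0.
have F0 := profile_0 prof; have hl := l0.
have F2' : F 2 = 0 by rewrite -F0 -(profile_sym prof 0) subr0.
have F3' : F 3 = - F 1 by rewrite -(profile_odd prof) -(profile_sym prof (-1)); congr F; ring.
have F4' : F 4 = 0 by rewrite -(profile_sym prof 4) -[RHS]oppr0 -F2' -(profile_odd prof); congr F; ring.
have at_l k : 0 <= k <= 4 -> Theta (k * l) = pi / 2 + F k.
  move=> k4; rewrite H; last by apply/andP; split; nra.
  by rewrite /angle mulrCA mulVf ?mulr1// gt_eqF.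
have e1 := at_l 1; rewrite mul1r in e1.
rewrite T0 e1 ?at_l ?F2' ?F3' ?F4' ?addr0; try by apply/andP; split; lra.
by split; split=> //; ring.
Qed.

Lemma optimal_arc_energy : J lam (4 * l) G = 16 / 3 * lam * l.
Proof. by have [kap [F1 [F2 [F3 [prof l0 sc]]]]] := opt; exact: (J_angle prof l0 sc). Qed.

Lemma optimal_arc_length : 9 * Ph ^+ 2 <= 2 * lam * l ^+ 4.
Proof.
rewrite optimal_arc_mid; have [kap [F1 [F2 [F3 [prof l0 sc]]]]] := opt.
by rewrite sc; have := profile_lb prof; lra.
Qed.

(** Fourth powers clear the roots: as [J = 16/3 lam l], the claim becomes [9 Ph^2 <= 2 lam l^4],
    which at the optimal scale is the bound [3 Ph^2 <= D]. *)
Lemma optimal_arc_energy_lb :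
  16 / 3 * (9 / 2) `^ (1 / 4) * lam `^ (3 / 4) * `|Ph| `^ (1 / 2) <= J lam (4 * l) G.
Proof.
rewrite optimal_arc_energy -!mulrA ler_wpM2l// ler_wpM2l//.
have hl := optimal_arc_pos.
have root (a x : R) (k : nat) : 0 <= a -> x * 4 = k%:R -> (a `^ x) ^+ 4 = a ^+ k.
  move=> a0 xk; rewrite -powR_mulrn ?powR_ge0// -powRrM.
  by rewrite -[X in x * X]/(4 : R) xk powR_mulrn.
rewrite -(@ler_pXn2r _ 4)// ?nnegrE ?mulr_ge0 ?powR_ge0 ?(ltW lam0) ?(ltW hl)//.
rewrite !exprMn (root (9 / 2) _ 1)//; last by field.
rewrite (root lam _ 3) ?(ltW lam0)//; last by field.
rewrite (root `|Ph| _ 2)//; last by field.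
rewrite expr1 real_normK ?num_real//.
have := optimal_arc_length; move: (Ph ^+ 2) => P2 H.
have l3 : 0 < lam ^+ 3 by rewrite exprn_gt0.
have -> : 9 / 2 * (lam ^+ 3 * P2) = lam ^+ 3 / 2 * (9 * P2) by field.
have -> : lam ^+ 4 * l ^+ 4 = lam ^+ 3 / 2 * (2 * lam * l ^+ 4) by field.
by rewrite ler_wpM2l// ltW// divr_gt0.
Qed.

End OneCurve.

End ClosedCurves.

(** * Lengths tending to infinity *)

Section Sequences.
Variable R : realType.
Variables (lam : R) (N0 : nat) (ell : nat -> nat -> R) (F : nat -> nat -> R -> R).
Hypothesis lam0 : 0 < lam.
Hypothesis opt : forall n j, (N0 <= n)%N ->
  [/\ 1 <= lower_end R n j & optimal_arc lam (lower_end R n j) (ell n j) (F n j)].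

(** The turning is at least [n], and [9 Ph^2 <= 2 lam l^4], so a bound on the length bounds [n]. *)
Lemma ell_large (b : R) j : exists N : nat, forall n, (N <= n)%N -> b <= ell n j.
Proof.
pose c := 2 * lam * `|b| ^+ 4.
exists (maxn N0 (Num.truncn c).+1) => n; rewrite geq_max => /andP[nN nc].
have [p1 o] := opt j nN; have := optimal_arc_length o; rewrite (optimal_arc_mid o).
have [kap [F1 [F2 [F3 [prof l0 _]]]]] := o; have /andP[t1 _] := profile_turning prof.
rewrite leNgt => H; apply/negP => lb.
have b4 : ell n j ^+ 4 <= `|b| ^+ 4.
  by rewrite lerXn2r ?nnegrE ?(ltW l0)//; have := ler_norm b; lra.
have cn : c < n%:R by apply: (@lt_le_trans _ _ (Num.truncn c).+1%:R); [exact: truncnS_gt|rewrite ler_nat].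
have nF : n%:R <= F n j 1 by have := lower_end_ge R n j; lra.
have : 2 * lam * ell n j ^+ 4 <= c by rewrite ler_wpM2l// mulr_ge0// ltW.
have F1_ge1 : 1 <= F n j 1 by lra.
nra.
Qed.

Lemma increasing_lengths j : exists n_ : nat -> nat,
  [/\ forall k, (N0 <= n_ k)%N, forall k m, (k < m)%N -> (n_ k < n_ m)%N &
      forall k m, (k < m)%N -> ell (n_ k) j < ell (n_ m) j].
Proof.
have step n : exists n', [/\ (N0 <= n')%N, (n < n')%N & ell n j < ell n' j].
  have [N H] := ell_large (ell n j + 1) j.
  exists (maxn N0 (maxn N n.+1)); split.
  - exact: leq_maxl.
  - by rewrite !leq_max leqnn !orbT.
  - by apply: lt_le_trans (H _ _); rewrite ?ltrDl// !leq_max leqnn !orbT.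
have [f Hf] := choice step.
exists (fun k => iter k f N0).
have mono (d : nat -> nat -> Prop) : (forall n, d n (f n)) ->
    (forall a b e, d a b -> d b e -> d a e) ->
    forall k m, (k < m)%N -> d (iter k f N0) (iter m f N0).
  move=> d1 tr k; elim=> // m IH; rewrite ltnS leq_eqVlt => /predU1P[->|/IH km]; first exact: d1.
  exact: tr km (d1 _).
split.
- by case=> // k; case: (Hf (iter k f N0)).
- by apply: (mono (fun a b : nat => (a < b)%N : Prop)) => [n|a b e]; [case: (Hf n)|exact: ltn_trans].
- by apply: (mono (fun a b => ell a j < ell b j : Prop)) => [n|a b e]; [case: (Hf n)|exact: lt_trans].
Qed.

End Sequences.

Unset Implicit Arguments.

Theorem theorem1p1 (R : realType) (lam : R) (lam_gt0 : 0 < lam) :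
  exists (delta : R) (N0 : nat), 0 < delta /\
  exists (ell : nat -> nat -> R) (theta : nat -> nat -> R -> R),
  let Phi (n j : nat) : R := theta n j (ell n j) - pi / 2 in
  let Gamma (n j : nat) : R -> R * R :=
    reflection_closure (ell n j) (theta n j) in
  let per (n j : nat) : R := 4 * ell n j in
  (forall n j : nat, (N0 <= n)%N -> j \in [:: 1%N; 2%N] ->
    let l := ell n j in
    let th := theta n j in
    let Ph := Phi n j in
    let G := Gamma n j in
    let B := G l in
    [/\ is_minimiser_on lam (window delta n j) l th,
        midpoint_transversality l th &
        (window delta n j)° Ph] /\
    [/\ smooth_near l (xc (doubled_arc th)) /\ smooth_near l (yc (doubled_arc th)),
        smooth_closed_immersion (4 * l) G &
        forall s, speed G s = 1] /\
    (* (i) *)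
    [/\ B = G (3 * l),
        forall s, s \in `[0, l] -> G (l + s) = B *+ 2 - G (l - s) &
        forall s, s \in `[2 * l, 4 * l] ->
          G s = (xc G (4 * l - s), - yc G (4 * l - s))] /\
    (* (ii) *)
    (forall V : R -> R * R, smooth_closed (4 * l) V ->
       is_first_variation lam (4 * l) G V 0) /\
    (* (iii) *)
    (forall Theta : R -> R,
       tangent_lift `[0, 4 * l] G Theta -> Theta 0 = pi / 2 ->
       [/\ Theta l = pi / 2 + Ph,
           Theta (2 * l) = pi / 2,
           Theta (3 * l) = pi / 2 - Ph &
           Theta (4 * l) = pi / 2] /\
       [/\ Theta l - Theta 0 = Ph,
           Theta (2 * l) - Theta l = - Ph,
           Theta (3 * l) - Theta (2 * l) = - Ph,
           Theta (4 * l) - Theta (3 * l) = Ph &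
           Theta (4 * l) - Theta 0 = 0]) /\
    (* (iv) *)
    16 / 3 * (9 / 2) `^ (1 / 4) * lam `^ (3 / 4) * `|Ph| `^ (1 / 2)
      <= J lam (4 * l) G) /\
  (forall j : nat, j \in [:: 1%N; 2%N] ->
     J lam (per n j) (Gamma n j) @[n --> \oo] --> +oo) /\
  (exists n_ j_ : nat -> nat,
     [/\ forall k, (N0 <= n_ k)%N /\ j_ k \in [:: 1%N; 2%N],
         forall k m, (k < m)%N -> (n_ k < n_ m)%N &
         forall k m, k <> m ->
           ~ congruent (per (n_ k) (j_ k)) (Gamma (n_ k) (j_ k))
                       (per (n_ m) (j_ m)) (Gamma (n_ m) (j_ m))]).
Proof.
have [N0 [ell [F opt]]] := optimal_arcs lam_gt0.
exists (pi / 4), N0; split; first by rewrite divr_gt0// pi_gt0.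
exists ell, (fun n j => angle (F n j) (ell n j)) => /=; split; [|split].
- move=> n j nN _; have [p1 o] := opt n j nN.
  have [m1 m2 m3] := optimal_arc_minimiser lam_gt0 o; rewrite window_lower.
  split; first by split=> //; rewrite interior_itv_bnd /= in_itv.
  split; first exact: optimal_arc_immersion o.
  split; first exact: optimal_arc_symmetries o.
  split; first by move=> V sV; exact: (optimal_arc_critical o sV).
  split; first by move=> Theta lift T0; exact: (optimal_arc_turning o lift T0).
  exact: optimal_arc_energy_lb lam_gt0 o.
- move=> j _; apply/cvgryPge => A.
  have [N H] := ell_large lam_gt0 opt (3 / 16 * lam^-1 * A) j.
  exists (maxn N0 N) => // n /=; rewrite geq_max => /andP[nN nN'].
  have [_ o] := opt n j nN; rewrite (optimal_arc_energy o).
  have c0 : 0 < 16 / 3 * lam by rewrite mulr_gt0.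
  have -> : A = 16 / 3 * lam * (3 / 16 * lam^-1 * A) by field; rewrite gt_eqF.
  by rewrite ler_pM2l// H.
(* The windows with [j = 1] are enough: strictly increasing lengths separate the congruence
   classes. *)
- have [n_ [nN n_mono ell_mono]] := increasing_lengths lam_gt0 opt 1.
  exists n_, (fun=> 1%N); split=> // k m km.
  have [_ ok] := opt (n_ k) 1%N (nN k); have [_ om] := opt (n_ m) 1%N (nN m).
  have [_ ik sk] := optimal_arc_immersion ok; have [_ im sm] := optimal_arc_immersion om.
  move=> /(congruent_period ik im sk sm) e.
  have {}e : ell (n_ k) 1%N = ell (n_ m) 1%N by lra.
  have [/ell_mono|/ell_mono|//] := ltngtP k m; by rewrite e ltxx.
Qed.
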